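(* Any Zariski closed algebra has a representation for whose full quiver the maximal length of the branches equals the index of nilpotence of the radical minus $1$.
   Context: Let $F$ be a field and $K$ an algebraically closed field containing $F$; if $F$ is finite put $q=|F|$, and if $F$ is infinite put $q=1$. Representations $\rho\colon A\to M_n(K)$ of an $F$-algebra $A$ are always taken to be faithful, and one identifies $A$ with $\rho(A)$. $A$ is Zariski closed if $\rho(A)$ is closed in the Zariski topology of $M_n(K)=K^{n^2}$. $J$ denotes the Jacobson radical of $A$, which is nilpotent; its index of nilpotence is the number $m$ such that $J^m=0$ but $J^{m-1}\neq 0$. Wedderburn block form. Let $A$ be Zariski closed. Then $A=S\oplus J$ with $S\cong A/J$ a subalgebra and $A/J= A_1\times\cdots\times A_k$, $A_u\cong M_{n_u}(F_u)$, where each $F_u$ is a field with $F\subseteq F_u\subseteq K$ that is either finite or equal to $K$. A representation $\rho\colon A\to M_n(K)$ is in Wedderburn block form if there are $s_1,\dots,s_k\ge 1$ with $n=\sum_u s_un_u$ and disjoint diagonal blocks $A_u^{(i)}$ ($1\le u\le k$, $1\le i\le s_u$) containing the diagonal, $A_u^{(i)}$ having size $n_u\times n_u$ and being isomorphic to $A_u$, such that $\rho$ restricts to an embedding $A_u\to A_u^{(1)}\times\cdots\times A_u^{(s_u)}$ whose composite with each projection is an isomorphism $A_u\to A_u^{(i)}$, and $\rho(J)$ lies in the sum of the strictly upper triangular blocks (above the diagonal blocks). Blocks with the same $u$ are called (diagonally) glued; the matrix units are chosen so that the entries of one glued block are $q^t$-powers of the corresponding entries of another. Full quiver. Given a representation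 in Wedderburn block form, let $B_1,\dots,B_\ell$ be the diagonal blocks in order along the diagonal, with unit elements $e_1,\dots,e_\ell\in M_n(K)$. The full quiver is the directed graph with vertices $1,\dots,\ell$ (each labelled by its matrix degree, its field, and gluing information), with an arrow $r\to s$ ($r<s$, no loops) if and only if $e_r\rho(A)e_s\neq 0$. A branch is a path that cannot be extended (no arrow enters its first vertex and no arrow exits its final vertex); the length of a path is its number of arrows. *)

(* Defs.v *)
From HB Require Import structures.
From mathcomp Require Import all_boot all_algebra finmap.
From mathcomp Require Import boolp classical_sets functions cardinality.
(* Not imported: the notations of mpoly clash with those of the other files.   *)
From mathcomp Require mpoly.

Set Implicit Arguments.
Unset Strict Implicit.
Unset Printing Implicit Defensive.

Import GRing.Theory.
Local Open Scope classical_set_scope.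
Local Open Scope ring_scope.

(* The number q: |F| if F is finite, and 1 otherwise.                          *)
Definition qcard (F : fieldType) : nat :=
  if `[< finite_set [set: F] >] then #|` fset_set [set: F]|%fset else 1%N.

Section JacobsonRadical.
Variable A : nzRingType.
Implicit Types I N : set A.

Definition left_ideal I : Prop :=
  [/\ I 0, forall x y, I x -> I y -> I (x + y)
         & forall a x, I x -> I (a * x)].

Definition maximal_left_ideal I : Prop :=
  [/\ left_ideal I, I <> [set: A]
    & forall I', left_ideal I' -> I `<=` I' -> I' = I \/ I' = [set: A]].

Definition jacobson : set A := \bigcap_(I in maximal_left_ideal) I.

(* Additive subgroup generated by the products x * y; no closure under         *)
(* opposites is needed when one of the factors is an ideal.                    *)
Definition ideal_mul I N : set A :=
  [set x | exists2 s : seq (A * A),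
     (forall p, p \in s -> I p.1 /\ N p.2) & x = \sum_(p <- s) p.1 * p.2].

Fixpoint ideal_pow N (m : nat) : set A :=
  if m is m'.+1 then ideal_mul (ideal_pow N m') N else [set: A].

Definition nilpotency_index N (m : nat) : Prop :=
  [/\ (0 < m)%N, ideal_pow N m = [set 0] & ideal_pow N m.-1 <> [set 0]].

End JacobsonRadical.

Arguments jacobson A _ : clear implicits.

Definition zariski_closed (K : fieldType) (n : nat) (Z : set 'M[K]_n) : Prop :=
  exists P : set (mpoly.mpoly (n * n) K),
    Z = [set X | forall p, P p -> mpoly.meval (fun i => mxvec X 0 i) p = 0].

(* A representation of A is a unital F-algebra morphism into 'M[K]_n, where F  *)
(* acts on 'M[K]_n through iota; K is regarded as an extension of F via iota.  *)
Notation representation iota A n :=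
  ({lrmorphism A -> 'M_n | iota \; *:%R}) (only parsing).

Definition faithful_closed (F : fieldType) (K : closedFieldType)
    (iota : {rmorphism F -> K}) (A : algType F) (n : nat)
    (rho : representation iota A n) : Prop :=
  injective rho /\ zariski_closed (range rho).

(* Data of a Wedderburn block form: the simple components A_u (of degree n_u   *)
(* over the subfield F_u of K) and the diagonal blocks in order along the      *)
(* diagonal. The r-th block is one of the copies A_u^(i) of A_u for            *)
(* u = bglue r, so that two blocks are glued when they have the same value of  *)
(* bglue; its entries are the q ^ (bfrob r)-th powers of those of              *)
(* A_u = M_{n_u}(F_u).                                                         *)
Record block_data (K : fieldType) := BlockData {
  bcomp : nat;
  bdeg : 'I_bcomp -> nat;
  bfield : 'I_bcomp -> {pred K};
  bell : nat;
  bglue : 'I_bell -> 'I_bcomp;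
  bfrob : 'I_bell -> nat
}.

Definition bsize (K : fieldType) (D : block_data K) (r : 'I_(bell D)) : nat :=
  bdeg (bglue r).

(* n = sum_u s_u n_u, where s_u is the number of blocks r with bglue r = u.    *)
Definition bdim (K : fieldType) (D : block_data K) : nat :=
  (\sum_(r < bell D) bsize r)%N.

Section WedderburnBlockForm.
Variables (F : fieldType) (K : closedFieldType) (iota : {rmorphism F -> K}).
Variables (A : algType F) (D : block_data K).

Definition subfield_finite_or_full (E : {pred K}) : Prop :=
  [/\ divring_closed E, forall x : F, iota x \in E
    & finite_set [set` E] \/ forall x : K, x \in E].

(* The theta u are the components of an isomorphism of F-algebras from A / J   *)
(* onto the product of the M_{n_u}(F_u).                                       *)
Definition wedderburn_quotient
    (theta : forall u : 'I_(bcomp D), representation iota A (bdeg u)) : Prop :=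
  [/\ forall a, jacobson A a <-> forall u, theta u a = 0,
      forall a u, theta u a \is a mxOver (@bfield K D u)
    & forall X : (forall u : 'I_(bcomp D), 'M[K]_(bdeg u)),
        (forall u, X u \is a mxOver (@bfield K D u)) ->
        exists a, forall u, theta u a = X u].

(* A = S (+) J; then S is isomorphic to A / J.                                 *)
Definition wedderburn_complement (S : {pred A}) : Prop :=
  [/\ GRing.subalg_closed S,
      forall a, exists x y, [/\ x \in S, jacobson A y & a = x + y]
    & forall a, a \in S -> jacobson A a -> a = 0].

(* The copy of A_u inside S.                                                   *)
Definition component (S : {pred A})
    (theta : forall u : 'I_(bcomp D), representation iota A (bdeg u))
    (u : 'I_(bcomp D)) : set A :=
  [set a | a \in S /\ forall v, v != u -> theta v a = 0].

(* The image of A_u is supported on the blocks r with bglue r = u. On each of  *)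
(* them it is the entrywise q ^ t-th power, t = bfrob r, of the isomorphism    *)
(* theta u : A_u -> M_{n_u}(F_u); since x |-> x ^+ (q ^ t) is an injective     *)
(* morphism on K, the projection of A_u to the block is an isomorphism onto    *)
(* its image A_u^(i), and matrix units of A_u go to those of the block.        *)
Definition wedderburn_block_form (rho : representation iota A (bdim D)) : Prop :=
  exists (S : {pred A})
         (theta : forall u : 'I_(bcomp D), representation iota A (bdeg u)),
  [/\ forall u : 'I_(bcomp D),
        [/\ (0 < bdeg u)%N, subfield_finite_or_full (bfield u)
          & exists r, bglue r = u],
      wedderburn_quotient theta,
      wedderburn_complement S,
      forall u a, component S theta u a ->
        rho a = \mxdiag_(r < bell D)
          (if bglue r == u
           then map_mx (fun x => x ^+ (qcard F ^ bfrob r)) (theta (bglue r) a)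
           else 0)
    & forall a, jacobson A a ->
        forall r s : 'I_(bell D), (s <= r)%N ->
          submxblock (rho a : 'M_(\sum_r bsize r)) r s = 0].

End WedderburnBlockForm.

(* Directed graph on 'I_qv_size with vertices labelled by a matrix degree, a   *)
(* field, and gluing information: the class of glued vertices, and the         *)
(* Frobenius exponent.                                                         *)
Record quiver (K : fieldType) := Quiver {
  qv_size : nat;
  qv_deg : 'I_qv_size -> nat;
  qv_field : 'I_qv_size -> {pred K};
  qv_glued : rel 'I_qv_size;
  qv_frob : 'I_qv_size -> nat;
  qv_arrow : rel 'I_qv_size
}.

Section FullQuiver.
Variables (F : fieldType) (K : closedFieldType) (iota : {rmorphism F -> K}).
Variables (A : algType F) (D : block_data K).

(* The unit element e_r of the r-th diagonal block.                            *)
Definition block_unit (r : 'I_(bell D)) : 'M[K]_(bdim D) :=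
  \mxdiag_(s < bell D) (((s == r)%:R)%:M : 'M[K]_(bsize s)).

Definition full_quiver (rho : representation iota A (bdim D)) : quiver K :=
  {| qv_deg := @bsize K D;
     qv_field := fun r => bfield (bglue r);
     qv_glued := fun r s => bglue r == bglue s;
     qv_frob := @bfrob K D;
     qv_arrow := fun r s => (r < s)%N &&
       `[< exists a, block_unit r *m rho a *m block_unit s != 0 >] |}.

End FullQuiver.

(* The vertex sequence x :: p, of length (number of arrows) size p, is a path  *)
(* that can be extended neither to the left nor to the right.                  *)
Definition branch (K : fieldType) (Q : quiver K)
    (x : 'I_(qv_size Q)) (p : seq 'I_(qv_size Q)) : Prop :=
  [/\ path (@qv_arrow K Q) x p, forall y, ~~ qv_arrow y x
    & forall y, ~~ qv_arrow (last x p) y].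

Definition max_branch_length (K : fieldType) (Q : quiver K) (L : nat) : Prop :=
  (exists x p, @branch K Q x p /\ size p = L) /\
  (forall x p, @branch K Q x p -> (size p <= L)%N).

(* Main.v *)
(* The irreducible subquotients of a faithful closed representation are        *)
(* Frobenius twists of finitely many pairwise unrelated ones, the theta_u.     *)
(* Over an infinite field F, the image is a K-subspace; over a finite field,   *)
(* it is a closed additive group, hence it is cut out by additive polynomials, *)
(* and a linear functional on the coefficients, compatible with Frobenius, can *)
(* be evaluated at a point of A. By linear independence of the coefficients of *)
(* unrelated representations, the theta_u therefore map A onto the product of  *)
(* the M_{n_u}(F_u); Lang's theorem provides F_u when theta_u is isomorphic to *)
(* one of its twists.                                                          *)
(* Matrix units of A / J and a root of unity generating F_u lift to A and give *)
(* idempotents e of the K-span of A, on which each lift of a diagonal torus    *)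
(* acts through a power of Frobenius. The space of row vectors is filtered by  *)
(* the K^n J^l; building a basis from the last step of the filtration up, each *)
(* new block being generated by a vector fixed by such an idempotent, puts A   *)
(* in Wedderburn block form, with a level l < m on each block such that J maps *)
(* every block into the blocks of strictly larger level. Levels thus increase  *)
(* along arrows, which bounds paths by m - 1; conversely a nonzero product of  *)
(* m - 1 elements of J has a nonzero block, and the indices of the factors     *)
(* form a path of length m - 1, which cannot be extended.                      *)

Require Import Defs.
From HB Require Import structures.
From mathcomp Require Import all_boot all_algebra all_field zify ring.
From mathcomp Require Import boolp classical_sets functions cardinality.
From mathcomp Require Import -(notations) mpoly.

Set Implicit Arguments.
Unset Strict Implicit.
Unset Printing Implicit Defensive.

Import GRing.Theory.
Local Open Scope ring_scope.

(** * Cyclic representations and linear independence of their coefficients *)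

(** Fix a faithful closed representation [rho]. The first task is to determine which relations the
    image of [rho] can satisfy. [composition_factors] provides the irreducible subquotients and
    shows that long products of elements of the span vanishing on all of them are zero. By
    [matrix_coef_indep] the coefficients of pairwise inequivalent irreducibles are linearly
    independent, so the only relations between subquotients come from isomorphisms with Frobenius
    twists. When an irreducible is isomorphic to a twist of itself, [lang] provides a basis in which
    its entries lie in a finite field.

    Every tuple of matrices allowed by these relations is attained. For infinite [F] the image is a
    [K]-subspace, and linear duality suffices ([surjective_scale]). For finite [F], [primitive]
    shows that additive polynomial functions are [p]-linear, [dense_hull] deduces that a point
    satisfying the [p]-linear relations of [A] lies in its Zariski closure, and [frob_graph_point]
    and [surjective_pchar] turn this into an element of [A]. The outcome is the record
    [semisimple_quotient]; [rad_jacobson] identifies [J] with the common kernel of the maps [th u].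

    The second task is to choose a basis. [corner_units_full] and [torus_projections] lift matrix
    units and scalars of the simple components to [A], with projections in the [K]-span of [A]
    separating the twists of a component. With these, [adapted_basis] builds blocks compatible with
    the filtration by the spaces spanned by the powers of [J]: a complement of [J] acts on each
    block exactly through a twist of some [th u], and [J] strictly raises a level which stays below
    the index [m]. [block_form_exists] conjugates [rho] into this basis.

    The levels then control the quiver. Off-diagonal blocks of [A] are blocks of elements of [J], so
    arrows raise the level and a path has at most [m - 1] arrows. Conversely, a nonzero block of an
    element of the power [m - 1] of [J] expands into a path with [m - 1] arrows ([path_exists]),
    which is a branch since a longer path is impossible. *)

Lemma span_family (K : fieldType) (X : Type) m (v : X -> 'rV[K]_m) :
  exists r (h : 'I_r -> X), row_free (\matrix_(i < r) v (h i)) /\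
    forall x, (v x <= \matrix_(i < r) v (h i))%MS.
Proof.
pose P r := `[< exists h : 'I_r -> X, row_free (\matrix_(i < r) v (h i)) >].
have exP : exists r, P r.
  exists 0%N; apply/asboolP.
  exists (fun i : 'I_0 => match i with Ordinal _ lt => False_rect _ (notF lt) end).
  by rewrite /row_free; apply/eqP; rewrite flatmx0 mxrank0.
have bP r : P r -> (r <= m)%N.
  by move/asboolP=> [h /eqP <-]; exact: rank_leq_col.
case: (ex_maxnP exP bP) => r /asboolP [h free_h] max_r.
exists r, h; split=> // x; apply: contraT => nvx.
set M := (X in row_free X) in free_h nvx.
suff /max_r : P r.+1 by rewrite ltnn.
apply/asboolP.
exists (fun i : 'I_r.+1 => if unlift ord0 i is Some j then h j else x).
have eqM : (col_mx (v x) M :=: \matrix_(i < r.+1)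
    v (if unlift ord0 i is Some j then h j else x))%MS.
  apply/eqmxP; apply/andP; split.
  - set N := (X in (_ <= X)%MS); rewrite col_mx_sub; apply/andP; split.
      by have := row_sub ord0 N; rewrite rowK unlift_none.
    apply/row_subP => j; rewrite rowK.
    by have := row_sub (lift ord0 j) N; rewrite rowK liftK.
  - apply/row_subP => i.
case: (unliftP ord0 i) => [j|] ->.
      rewrite rowK liftK (submx_trans _ (_ : (M <= _)%MS)) //; last first.
        by rewrite -addsmxE addsmxSr.
      by rewrite -[v _](rowK (fun i => v (h i))) row_sub.
    by rewrite rowK unlift_none -addsmxE addsmxSl.
rewrite /row_free -eqM eqn_leq rank_leq_row /= -addsmxE.
rewrite -[X in (X <= _)%N]add1n.
have: (M < v x + M)%MS.
  rewrite ltmxE addsmxSr /=; apply: contra nvx => /(submx_trans (addsmxSl _ _)) //.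
by rewrite ltmxErank => /andP[_]; rewrite (eqP free_h).
Qed.

Section RingRepresentations.
Variables (A : nzRingType) (K : fieldType).

(** No linearity is required, because a Frobenius twist of an [F]-linear representation need not be
    [F]-linear. *)
Record ring_rep n (f : A -> 'M[K]_n) : Prop := RingRep {
  ring_repD : forall x y, f (x + y) = f x + f y;
  ring_repM : forall x y, f (x * y) = f x *m f y;
  ring_rep1 : f 1 = 1%:M
}.

(** Irreducibility, expressed by duality: for every nonzero [v] the rows [v *m f a] span the whole
    space. *)
Definition cyclic_rep n (f : A -> 'M[K]_n) : Prop :=
  forall (v : 'rV_n) (y : 'cV_n), v != 0 -> (forall a, v *m f a *m y = 0) ->
  y = 0.

Definition intertwiner m n (f : A -> 'M[K]_m) (g : A -> 'M[K]_n)
    (T : 'M[K]_(m, n)) : Prop :=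
  forall a, f a *m T = T *m g a.

Lemma ring_rep0 n (f : A -> 'M[K]_n) : ring_rep f -> f 0 = 0.
Proof.
move=> rf; have := ring_repD rf 0 0; rewrite addr0.
by move/(congr1 (fun x => x - f 0)); rewrite subrr addrK.
Qed.

Lemma ring_repN n (f : A -> 'M[K]_n) x : ring_rep f -> f (- x) = - f x.
Proof.
move=> rf; apply/eqP; rewrite -addr_eq0 -(ring_repD rf) addNr.
by rewrite (ring_rep0 rf).
Qed.

Lemma ring_repB n (f : A -> 'M[K]_n) x y : ring_rep f -> f (x - y) = f x - f y.
Proof. by move=> rf; rewrite (ring_repD rf) (ring_repN _ rf). Qed.

Lemma ring_rep_sum n (f : A -> 'M[K]_n) (I : Type) (r : seq I) (P : pred I)
    (x : I -> A) :
  ring_rep f -> f (\sum_(i <- r | P i) x i) = \sum_(i <- r | P i) f (x i).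
Proof.
by move=> rf; apply: (big_morph f (ring_repD rf) (ring_rep0 rf)).
Qed.

Lemma cyclic_repP n (f : A -> 'M[K]_n) m (v : 'rV_n) (Y : 'M_(n, m)) :
  cyclic_rep f -> v != 0 -> (forall a, v *m f a *m Y = 0) -> Y = 0.
Proof.
move=> cf nzv vY; apply/matrixP => i j; rewrite mxE.
have /(congr1 (fun M : 'cV_n => M i 0)) : col j Y = 0.
  by apply: (cf v) => // a; rewrite colE mulmxA vY mul0mx.
by rewrite !mxE.
Qed.

(** Schur's lemma: a nonzero row killed by [T] would generate a module killed by [T], and a nonzero
    row of [T] generates the target. *)
Lemma intertwiner_iso m n (f : A -> 'M[K]_m) (g : A -> 'M[K]_n) T :
  cyclic_rep f -> cyclic_rep g -> T != 0 -> intertwiner f g T ->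
  row_free T /\ row_full T.
Proof.
move=> cf cg nzT fT; split.
  apply/inj_row_free => v vT0; apply: contraNeq nzT => nzv.
  by apply/eqP/(cyclic_repP cf nzv) => a; rewrite -mulmxA fT mulmxA vT0 mul0mx.
have [i nzTi] : exists i, row i T != 0.
  apply/existsP; apply: contraNT nzT; rewrite negb_exists => /forallP T0.
  by apply/eqP/row_matrixP=> i; rewrite linear0; apply/eqP; have := T0 i; rewrite negbK.
rewrite -sub1mx; apply: contraT; rewrite submxE mul1mx => nz.
have Ty: T *m cokermx T = 0 by rewrite mulmx_coker.
suff C0 : cokermx T = 0 by rewrite C0 eqxx in nz.
apply: (cyclic_repP cg nzTi) => a.
by rewrite -row_mul -fT row_mul -mulmxA Ty mulmx0.
Qed.

End RingRepresentations.

(** An eigenvector of [T] generates the module, so [T] acts everywhere by its eigenvalue. *)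
Lemma schur_scalar (A : nzRingType) (K : closedFieldType) n
    (f : A -> 'M[K]_n) T :
  cyclic_rep f -> intertwiner f f T -> exists c, T = c%:M.
Proof.
case: n f T => [|n] f T cf fT; first by exists 0; rewrite !thinmx0.
have [c rc] : exists c, root (char_poly T) c.
  by apply/closed_rootP; rewrite size_char_poly.
move: rc; rewrite -eigenvalue_root_char => /eigenvalueP[v vT nzv].
exists c; apply/eqP; rewrite -subr_eq0; apply/eqP.
apply: (cyclic_repP cf nzv) => a.
by rewrite mulmxBr -mulmxA fT mulmxA vT -scalemxAl mul_mx_scalar subrr.
Qed.

(* Take a relation of minimal total rank and a nonzero row [v] of one of the   *)
(* [C s]: an element of the span of [A] which kills [v] lowers the rank, hence *)
(* kills all the [C s], so that sending [v] to any row of [C s] is an          *)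
(* intertwiner.                                                                *)
Lemma matrix_coef_indep (A : nzRingType) (K : closedFieldType) (I : finType)
    (d : I -> nat) (f : forall s, A -> 'M[K]_(d s)) :
  (forall s, ring_rep (f s)) -> (forall s, cyclic_rep (f s)) ->
  (forall s t T, s != t -> intertwiner (f s) (f t) T -> T = 0) ->
  forall C : (forall s, 'M[K]_(d s)),
  (forall a, \sum_s \tr (C s *m f s a) = 0) -> forall s, C s = 0.
Proof.
move=> rf cf ineq C.
have [N] := ubnP (\sum_s \rank (C s)); elim: N C => // N IHN C ltN relC.
case: (pselect (forall s, C s = 0)) => // /existsNP [s0 /eqP nzC] s; exfalso.
have [i0 nzv] : exists i, row i (C s0) != 0.
  apply/existsP; apply: contraNT nzC; rewrite negb_exists => /forallP C0.
  apply/eqP/row_matrixP=> i; rewrite linear0; apply/eqP.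
  by have := C0 i; rewrite negbK.
set v := row i0 (C s0) in nzv.
have [r [h [free_h span_h]]] := span_family (fun a => v *m f s0 a).
set H := (X in row_free X) in free_h.
have {}span_h a : (v *m f s0 a <= H)%MS := span_h a.
have full_H : row_full H.
  rewrite -sub1mx submxE mul1mx; apply/eqP.
  apply: (cyclic_repP (cf s0) nzv) => a; apply/eqP; rewrite -submxE.
  exact: span_h.
(* Multiplying every [C t] on the right by this combination gives a new relation. It kills the row
   [v] of [C s0], so the total rank drops and the induction hypothesis applies. *)
have kill r' (x : 'I_r' -> A) (c : 'I_r' -> K) :
    v *m (\sum_i c i *: f s0 (x i)) = 0 ->
    forall t, C t *m (\sum_i c i *: f t (x i)) = 0.
  move=> vB; apply: IHN.
    apply: leq_trans (ltnSE ltN); rewrite [X in (_ < X)%N](bigD1 s0) //=.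
    rewrite [X in (X < _)%N](bigD1 s0) //= -addSn leq_add //; last first.
      by apply: leq_sum => t _; apply: mxrankM_maxl.
    rewrite -(mxrank_mul_ker (C s0) (\sum_i c i *: f s0 (x i))).
    rewrite -[X in (X < _)%N]addn0 ltn_add2l lt0n mxrank_eq0.
    apply: contra nzv => /eqP cap0; rewrite -submx0 -cap0 sub_capmx row_sub.
    by rewrite sub_kermx vB eqxx.
  move=> a.
  transitivity (\sum_i c i * \sum_t \tr (C t *m f t (x i * a))).
    under [RHS]eq_bigr do rewrite mulr_sumr.
    rewrite exchange_big; apply: eq_bigr => t _.
    rewrite mulmx_sumr mulmx_suml raddf_sum; apply: eq_bigr => i _ /=.
    by rewrite -scalemxAr -scalemxAl mxtraceZ (ring_repM (rf t)) mulmxA.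
  by rewrite big1 // => i _; rewrite relC mulr0.
(* [T t j] is to send [v *m f s0 a] to [row j (C t) *m f t a]. It is defined on the basis [H], and
   [kill] makes this consistent for every [a]. *)
have [T Tact] : exists T : forall t, 'I_(d t) -> 'M_(d s0, d t),
    forall t j a, v *m f s0 a *m T t j = row j (C t) *m f t a.
  exists (fun t j => pinvmx H *m \matrix_i (row j (C t) *m f t (h i))).
  move=> t j a.
  rewrite mulmxA; set c := _ *m pinvmx H.
  have vE : v *m f s0 a = c *m H by rewrite mulmxKpV // span_h.
  pose x i := if unlift ord0 i is Some k then h k else a : A.
  pose e (i : 'I_r.+1) := if unlift ord0 i is Some k then c 0 k else - 1.
  have /kill/(_ t)/(congr1 (row j)) : v *m (\sum_i e i *: f s0 (x i)) = 0.
    rewrite big_ord_recl /e /x unlift_none scaleN1r.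
    under eq_bigr do rewrite liftK.
    rewrite mulmxDr mulmxN vE mulmx_sumr [c *m H]mulmx_sum_row.
    apply/eqP; rewrite addrC subr_eq0; apply/eqP/eq_bigr => i _.
    by rewrite -scalemxAr /H rowK.
  rewrite row_mul big_ord_recl /e /x unlift_none scaleN1r.
  under eq_bigr do rewrite liftK.
  rewrite linear0 mulmxDr mulmxN => /eqP; rewrite addrC subr_eq0 => /eqP <-.
  rewrite mulmx_sumr [c *m _]mulmx_sum_row; apply: eq_bigr => i _.
  by rewrite -scalemxAr rowK.
have Hinj m (X Y : 'M_(_, m)) : H *m X = H *m Y -> X = Y.
  by move/(congr1 (mulmx (pinvmx H))); rewrite !mulmxA mulVpmx // !mul1mx.
have Tint t j : intertwiner (f s0) (f t) (T t j).
  move=> a; apply: Hinj; apply/row_matrixP => i.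
  rewrite !mulmxA !row_mul rowK -[v *m _ *m f s0 a]mulmxA -(ring_repM (rf s0)).
  rewrite Tact (ring_repM (rf t)) mulmxA -Tact /H.
  by congr (_ *m _); rewrite -Tact rowK.
(* Inequivalence kills the other [C t], and Schur's lemma makes the rows of [C s0] multiples of [v];
   the remaining rank one relation contradicts cyclicity. *)
have C0 t : t != s0 -> C t = 0.
  move=> nts; apply/row_matrixP => j; rewrite linear0.
  rewrite -[LHS]mulmx1 -(ring_rep1 (rf t)) -Tact.
  by rewrite (ineq _ _ _ _ (Tint t j)) ?mulmx0 // eq_sym.
have Cj j : exists c, row j (C s0) = c *: v.
  have [c Tc] := schur_scalar (cf s0) (Tint s0 j).
  exists c; rewrite -[LHS]mulmx1 -(ring_rep1 (rf s0)) -Tact Tc.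
  by rewrite (ring_rep1 (rf s0)) mulmx1 mul_mx_scalar.
have [l Cl] : exists l : 'cV_(d s0), C s0 = l *m v.
  exists (\col_j projT1 (cid (Cj j))); apply/row_matrixP => j.
  by rewrite row_mul (projT2 (cid (Cj j))) -mul_scalar_mx; congr (_ *m _);
     apply/matrixP => x y; rewrite !ord1 !mxE eqxx.
suff l0 : l = 0 by rewrite Cl l0 mul0mx eqxx in nzC.
apply: (cf s0 _ _ nzv) => a; apply/matrixP => x y; rewrite !ord1 [RHS]mxE.
have := relC a; rewrite (bigD1 s0) //= big1 ?addr0; last first.
  by move=> t nts; rewrite C0 // mul0mx mxtrace0.
by rewrite Cl -mulmxA mxtrace_mulC trace_mx11.
Qed.

(** * Composition factors *)

Section LinearSpan.
Variables (A : nzRingType) (K : fieldType) (n : nat) (f : A -> 'M[K]_n).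

(* Membership in the [K]-span of the image of [f], by duality.                 *)
Definition in_span (b : 'M[K]_n) : Prop :=
  forall C : 'M_n, (forall a, \tr (C *m f a) = 0) -> \tr (C *m b) = 0.

Lemma in_span_rep a : in_span (f a).
Proof. by move=> C; apply. Qed.

Lemma in_spanD b c : in_span b -> in_span c -> in_span (b + c).
Proof.
by move=> sb sc C fC; rewrite mulmxDr mxtraceD sb // sc // addr0.
Qed.

Lemma in_spanZ x b : in_span b -> in_span (x *: b).
Proof. by move=> sb C fC; rewrite -scalemxAr mxtraceZ sb // mulr0. Qed.

Lemma in_span_sum (I : Type) (r : seq I) (P : pred I) (b : I -> 'M_n) :
  (forall i, P i -> in_span (b i)) -> in_span (\sum_(i <- r | P i) b i).
Proof.
move=> sb; elim/big_ind: _ => //; last exact: in_spanD.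
by move=> C _; rewrite mulmx0 mxtrace0.
Qed.

Lemma in_spanM b c : ring_rep f -> in_span b -> in_span c -> in_span (b *m c).
Proof.
move=> rf sb sc C fC; rewrite mulmxA mxtrace_mulC mulmxA; apply: sb => a.
rewrite -mulmxA mxtrace_mulC; apply: sc => a'.
by rewrite -mulmxA -(ring_repM rf).
Qed.

Lemma in_span_eq p q (X : 'M_(p, n)) (Y : 'M_(n, q)) b :
  in_span b -> (forall a, X *m f a *m Y = 0) -> X *m b *m Y = 0.
Proof.
move=> sb XY; apply/matrixP => i j; rewrite [RHS]mxE.
have trE c : (X *m c *m Y) i j = \tr ((col j Y *m row i X) *m c).
  rewrite -[in RHS]mulmxA [RHS]mxtrace_mulC trace_mx11 -row_mul colE mulmxA.
  by rewrite -colE !mxE; apply: eq_bigr => k _; rewrite !mxE.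
by rewrite trE; apply: sb => a; rewrite -trE XY mxE.
Qed.

End LinearSpan.

Lemma in_span_mulmx (A : nzRingType) (K : fieldType) m n (f : A -> 'M[K]_n)
    (X : 'M_(m, n)) (Y : 'M_(n, m)) b :
  in_span f b -> in_span (fun a => X *m f a *m Y) (X *m b *m Y).
Proof.
have trE C c : \tr (C *m (X *m c *m Y)) = \tr ((Y *m C *m X) *m c).
  by rewrite !mulmxA [LHS]mxtrace_mulC !mulmxA.
by move=> sb C fC; rewrite trE; apply: sb => a; rewrite -trE fC.
Qed.

Definition mxprod (K : fieldType) n (s : seq 'M[K]_n) : 'M_n :=
  foldr mulmx 1%:M s.

Lemma min_invariant (A : nzRingType) (K : fieldType) n (f : A -> 'M[K]_n.+1) :
  ring_rep f -> exists U : 'M_n.+1,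
  [/\ U != 0, forall a, (U *m f a <= U)%MS
    & forall m (W : 'M_(m, n.+1)), (forall a, (W *m f a <= W)%MS) ->
        (W <= U)%MS -> W != 0 -> (U <= W)%MS].
Proof.
move=> rf.
pose P r := `[< exists U : 'M_n.+1,
  [/\ U != 0, forall a, (U *m f a <= U)%MS & \rank U = r] >].
have exP : exists r, P r.
  exists n.+1; apply/asboolP; exists 1%:M; split; last exact: mxrank1.
    by rewrite -mxrank_eq0 mxrank1.
  by move=> a; rewrite submx1.
case: (ex_minnP exP) => r /asboolP [U [nzU invU rU]] min_r.
exists U; split=> // m W invW sWU nzW.
rewrite -mxrank_leqif_sup // eqn_leq mxrankS //= rU min_r //.
apply/asboolP; exists <<W>>%MS; split; last by rewrite mxrank_gen.
  by rewrite -mxrank_eq0 mxrank_gen mxrank_eq0.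
by move=> a; rewrite genmxE (eqmxMr _ (genmxE W)).
Qed.

(* The irreducible subquotients of a representation, cut out as blocks of the  *)
(* matrices [f a] in a basis adapted to a composition series.                  *)
Lemma composition_factors (A : nzRingType) (K : fieldType) n (f : A -> 'M[K]_n) :
  ring_rep f ->
  exists (I : finType) (d : I -> nat) (X : forall i, 'M_(d i, n))
         (Y : forall i, 'M_(n, d i)) (N : nat),
  [/\ forall i, (0 < d i)%N,
      forall i, ring_rep (fun a => X i *m f a *m Y i),
      forall i, cyclic_rep (fun a => X i *m f a *m Y i)
    & forall s, size s = N ->
        (forall b, b \in s -> in_span f b /\ forall i, X i *m b *m Y i = 0) ->
        mxprod s = 0].
Proof.
have [m] := ubnP n; elim: m n f => // m IHm [|n] f ltnm rf.
  exists void, (fun=> 0%N), (fun=> 0), (fun=> 0), 0%N; split; try by case.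
  by move=> s _ _; apply: flatmx0.
have [U [nzU invU minU]] := min_invariant rf.
(* The rows of [R] span the minimal submodule and those of [R'] a complement. With [Y] and [Y'] the
   matching columns of the inverse, [R' *m f a *m Y'] is the quotient representation. *)
set r := \rank U; pose R : 'M_(r, n.+1) := row_base U.
set r' := \rank (U^C)%MS; pose R' : 'M_(r', n.+1) := row_base (U^C)%MS.
have eRU : (R :=: U)%MS := eq_row_base U.
have freeR : row_free R := row_base_free U.
have rr' : (r + r' = n.+1)%N by rewrite /r /r' mxrank_compl subnKC // rank_leq_row.
have fullP : row_full (col_mx R R').
  rewrite -sub1mx -addsmxE (adds_eqmx eRU (eq_row_base _)).
  by rewrite sub1mx addsmx_compl_full.
have freeP : row_free (col_mx R R').
  by rewrite /row_free (eqP fullP) rr'.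
pose Q := pinvmx (col_mx R R'); pose Y := lsubmx Q; pose Y' := rsubmx Q.
have QE : Q = row_mx Y Y' by rewrite hsubmxK.
have : row_mx Y Y' *m col_mx R R' = 1%:M by rewrite -QE mulVpmx.
rewrite mul_row_col => YR1.
have : col_mx R R' *m row_mx Y Y' = 1%:M by rewrite -QE mulmxVp.
rewrite mul_col_row scalar_mx_block => /eq_block_mx [RY1 RY'0 R'Y0 R'Y'1].
clearbody R R' Y Y'.
have Rf a : R *m f a = R *m f a *m Y *m R.
  have : (R *m f a <= R)%MS by rewrite eRU (eqmxMr _ eRU).
  by case/submxP => c ->; rewrite -(mulmxA c R Y) RY1 mulmx1.
have RfY' a : R *m f a *m Y' = 0 by rewrite Rf -mulmxA RY'0 mulmx0.
have rf1 : ring_rep (fun a => R *m f a *m Y).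
  split=> [x y|x y|].
  - by rewrite (ring_repD rf) mulmxDr mulmxDl.
  - by rewrite (ring_repM rf) [in LHS]mulmxA {1}Rf !mulmxA.
  - by rewrite (ring_rep1 rf) mulmx1.
have rf2 : ring_rep (fun a => R' *m f a *m Y').
  split=> [x y|x y|].
  - by rewrite (ring_repD rf) mulmxDr mulmxDl.
  - rewrite (ring_repM rf) mulmxA -[in LHS](mulmx1 (R' *m f x)) -YR1.
    rewrite mulmxDr !mulmxDl [X in X + _](_ : _ = 0) ?add0r ?mulmxA //.
    by rewrite -!mulmxA (mulmxA R) RfY' !mulmx0.
  - by rewrite (ring_rep1 rf) mulmx1.
have ltr' : (r' < m)%N.
  by apply: leq_trans (ltnSE ltnm); rewrite -rr' -add1n leq_add2r lt0n mxrank_eq0.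
have [I [d [X2 [Y2 [N [d0 r2 c2 nil2]]]]]] := IHm _ _ ltr' rf2.
pose d' i := if i is Some j then d j else r.
exists (option I), d'.
exists (fun i => match i return 'M_(d' i, n.+1) with
          Some j => X2 j *m R' | None => R end).
exists (fun i => match i return 'M_(n.+1, d' i) with
          Some j => Y' *m Y2 j | None => Y end), N.+1.
have blk j b : X2 j *m R' *m b *m (Y' *m Y2 j) = X2 j *m (R' *m b *m Y') *m Y2 j.
  by rewrite !mulmxA.
split.
- by case=> [j|] //=; rewrite /r lt0n mxrank_eq0.
- case=> [j|] //.
  by have := r2 j; congr (ring_rep _); apply: funext => a; rewrite blk.
- case=> [j|] //.
    by have := c2 j; congr (cyclic_rep _); apply: funext => a; rewrite blk.
  move=> v y nzv vy0.
  have [k [h [_ span_h]]] := span_family (fun a => v *m R *m f a).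
  set H := \matrix_(i < k) _ in span_h.
  have {}span_h a : (v *m R *m f a <= H)%MS := span_h a.
  have sUH : (U <= H)%MS.
    apply: minU.
    - move=> a; apply/row_subP => i; rewrite row_mul rowK -mulmxA -(ring_repM rf).
      exact: span_h.
    - apply/row_subP => i; rewrite rowK -eRU.
      by rewrite -mulmxA Rf !mulmxA submxMl.
    - apply: contra nzv => /eqP H0; have := span_h 1.
      rewrite H0 (ring_rep1 rf) mulmx1 => /submx0null vR.
      by rewrite -(mulmx1 v) -RY1 mulmxA vR mul0mx.
  have /submxP [c Rc] : (R <= H)%MS by rewrite eRU.
  have HYy : H *m (Y *m y) = 0.
    by apply/row_matrixP => i; rewrite row_mul rowK linear0 -(vy0 (h i)) !mulmxA.
  by rewrite -(mul1mx y) -RY1 Rc -!mulmxA HYy mulmx0.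
- move=> s; case/lastP: s => // s b; rewrite size_rcons => -[szs] Hs.
  (* An element vanishing on the submodule factors through the quotient, so a product of such
     elements is a product in the quotient followed by one last factor; hence [N.+1]. *)
  have Rb0 c : c \in rcons s b -> R *m c = 0.
    move=> /Hs [sc Xc0]; have := Xc0 None => /= RcY.
    have : R *m c *m (1%:M - Y *m R) = 0.
      apply: (in_span_eq sc) => a.
      by rewrite mulmxBr mulmx1 mulmxA -Rf subrr.
    by rewrite mulmxBr mulmx1 mulmxA RcY mul0mx subr0.
  have bE c : c \in rcons s b -> c = Y' *m (R' *m c).
    by move=> /Rb0 Rc; rewrite -{1}(mul1mx c) -YR1 mulmxDl -!mulmxA Rc mulmx0 add0r.
  have prodE t : {subset t <= s} ->
      R' *m foldr mulmx b t = mxprod [seq R' *m c *m Y' | c <- t] *m (R' *m b)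
      /\ R *m foldr mulmx b t = 0.
    elim: t => [|c t IHt] sts /=; first by rewrite mul1mx Rb0 // mem_rcons mem_head.
    have sc : c \in rcons s b by rewrite mem_rcons in_cons sts ?mem_head ?orbT.
    have [|IH1 IH2] := IHt; first by move=> x tx; apply: sts; rewrite in_cons tx orbT.
    split; last by rewrite mulmxA Rb0 ?mul0mx.
    rewrite -[foldr _ _ _]mul1mx -{1}YR1 mulmxDl -!mulmxA IH2 mulmx0 add0r IH1.
    by rewrite !mulmxA.
  have -> : mxprod (rcons s b) = foldr mulmx b s.
    by rewrite /mxprod -cats1 foldr_cat /= mulmx1.
  have [//|R'p Rp] := prodE s.
  rewrite -[LHS]mul1mx -YR1 mulmxDl -!mulmxA Rp mulmx0 add0r R'p.
  rewrite (nil2 [seq R' *m c *m Y' | c <- s]) ?size_map ?mul0mx ?mulmx0 //.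
  move=> _ /mapP [c sc ->]; have [|spc Xc0] := Hs c.
    by rewrite mem_rcons in_cons sc orbT.
  by split; [exact: in_span_mulmx | move=> i; rewrite -blk; apply: (Xc0 (Some i))].
Qed.

(** * Frobenius twists *)

Section AdditiveExponent.
Variable K : closedFieldType.
Implicit Types e : nat.

(* [e] is 1 or a power of the characteristic: it plays the role of [q ^ t].    *)
Definition add_exp e : Prop :=
  (0 < e)%N /\ forall x y : K, (x + y) ^+ e = x ^+ e + y ^+ e.

Lemma add_exp1 : add_exp 1.
Proof. by split=> // x y; rewrite !expr1. Qed.

Lemma add_exp_pchar p : p \in [pchar K] -> add_exp p.
Proof.
move=> pK; split; first exact: prime_gt0 (pcharf_prime pK).
by move=> x y; rewrite exprDn_pchar // pnatE // (pcharf_prime pK).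
Qed.

Lemma add_expM e1 e2 : add_exp e1 -> add_exp e2 -> add_exp (e1 * e2).
Proof.
case=> e1_gt0 D1 [e2_gt0 D2]; split; first by rewrite muln_gt0 e1_gt0.
by move=> x y; rewrite exprM D1 D2 -!exprM.
Qed.

Lemma add_expX e t : add_exp e -> add_exp (e ^ t).
Proof.
move=> ae; elim: t => [|t IH]; first exact: add_exp1.
by rewrite expnS; apply: add_expM.
Qed.

Lemma add_exp_rmorph e : add_exp e ->
  exists s : {rmorphism K -> K}, forall x, s x = x ^+ e.
Proof.
case=> e_gt0 eD; pose f (x : K) := x ^+ e.
have fB : zmod_morphism f.
  by move=> x y; apply/eqP; rewrite eq_sym subr_eq -eD subrK.
have fM : monoid_morphism f.
  by split=> [|x y]; rewrite /f ?expr1n // exprMn.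
pose mB := GRing.isZmodMorphism.Build K K f fB.
pose mM := GRing.isMonoidMorphism.Build K K f fM.
pose s : {rmorphism K -> K} := HB.pack f mB mM.
by exists s.
Qed.

Lemma exp_root e (c : K) : add_exp e -> exists x, x ^+ e = c.
Proof.
case=> e_gt0 _; have /closed_rootP [x] : size ('X^e - c%:P) != 1%N.
  by rewrite size_XnsubC // eqSS -lt0n.
by rewrite rootE !hornerE subr_eq0 => /eqP <-; exists x.
Qed.

Definition twist e m n (B : 'M[K]_(m, n)) : 'M[K]_(m, n) :=
  map_mx (fun x => x ^+ e) B.

Section Twist.
Variables (e : nat) (ae : add_exp e).

Lemma twistE : exists s : {rmorphism K -> K},
  forall m n (B : 'M[K]_(m, n)), twist e B = map_mx s B.
Proof.
have [s sE] := add_exp_rmorph ae; exists s => m n B.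
by apply/matrixP => i j; rewrite !mxE sE.
Qed.

Lemma twistM m n r (B : 'M[K]_(m, n)) (C : 'M_(n, r)) :
  twist e (B *m C) = twist e B *m twist e C.
Proof. by have [s sE] := twistE; rewrite !sE map_mxM. Qed.

Lemma twistD m n (B C : 'M[K]_(m, n)) : twist e (B + C) = twist e B + twist e C.
Proof. by have [s sE] := twistE; rewrite !sE map_mxD. Qed.

Lemma twist0 m n : twist e (0 : 'M[K]_(m, n)) = 0.
Proof. by have [s sE] := twistE; rewrite !sE map_mx0. Qed.

Lemma twist_scalar n c : twist e (c%:M : 'M[K]_n) = (c ^+ e)%:M.
Proof.
apply/matrixP => i j; rewrite !mxE; case: eqP => _; rewrite ?mulr1n ?mulr0n //.
by rewrite expr0n; case: e ae => [[]|].
Qed.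

Lemma twist1 n : twist e (1%:M : 'M[K]_n) = 1%:M.
Proof. by rewrite twist_scalar expr1n. Qed.

Lemma twist_inj m n (B C : 'M[K]_(m, n)) : twist e B = twist e C -> B = C.
Proof. by have [s sE] := twistE; rewrite !sE => /map_mx_inj. Qed.

Lemma twist_root m n (B : 'M[K]_(m, n)) : exists C, twist e C = B.
Proof.
exists (\matrix_(i, j) projT1 (cid (exp_root (B i j) ae))).
by apply/matrixP => i j; rewrite !mxE (projT2 (cid (exp_root (B i j) ae))).
Qed.

Lemma twist_eq0 m n (B : 'M[K]_(m, n)) : (twist e B == 0) = (B == 0).
Proof.
apply/eqP/eqP => [B0|->]; last exact: twist0.
by apply: twist_inj; rewrite twist0.
Qed.

End Twist.

Lemma twist_twist e1 e2 m n (B : 'M[K]_(m, n)) :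
  twist e1 (twist e2 B) = twist (e2 * e1) B.
Proof. by apply/matrixP => i j; rewrite !mxE -exprM. Qed.

Lemma twist_id m n (B : 'M[K]_(m, n)) : twist 1 B = B.
Proof. by apply/matrixP => i j; rewrite !mxE expr1. Qed.

Section TwistRep.
Variables (A : nzRingType) (e : nat) (ae : add_exp e).

Lemma ring_rep_twist n (f : A -> 'M[K]_n) :
  ring_rep f -> ring_rep (fun a => twist e (f a)).
Proof.
move=> rf; split=> [x y|x y|].
- by rewrite (ring_repD rf) twistD.
- by rewrite (ring_repM rf) twistM.
- by rewrite (ring_rep1 rf) twist1.
Qed.

Lemma cyclic_rep_twist n (f : A -> 'M[K]_n) :
  cyclic_rep f -> cyclic_rep (fun a => twist e (f a)).
Proof.
move=> cf v y; have [w <-] := twist_root ae v; have [z <-] := twist_root ae y.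
rewrite twist_eq0 // => nzw wz; apply/eqP; rewrite twist_eq0 //; apply/eqP.
by apply: (cf w) => // a; apply/eqP; rewrite -(twist_eq0 ae) !twistM // wz.
Qed.

Lemma intertwiner_twist m n (f : A -> 'M[K]_m) (g : A -> 'M[K]_n) T :
  intertwiner f g T ->
  intertwiner (fun a => twist e (f a)) (fun a => twist e (g a)) (twist e T).
Proof. by move=> fg a; rewrite -!twistM // fg. Qed.

Lemma intertwiner_root m n (f : A -> 'M[K]_m) (g : A -> 'M[K]_n) T :
  intertwiner (fun a => twist e (f a)) (fun a => twist e (g a)) T ->
  exists2 T', T = twist e T' & intertwiner f g T'.
Proof.
have [T' <-] := twist_root ae T => fg; exists T' => // a.
by apply: (twist_inj ae); rewrite !twistM.
Qed.

End TwistRep.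
End AdditiveExponent.

(* A fixed point of the triangular system [x 0 = b 0 * x k ^+ e] and           *)
(* [x i.+1 = x i ^+ e + b i.+1 * x k ^+ e], found as a nonzero root of a       *)
(* one-variable polynomial in [c = x k].                                       *)
Lemma triangular_fixpoint (K : closedFieldType) e (b : nat -> K) k :
  (1 < e)%N -> (exists2 i, (i <= k)%N & b i != 0) ->
  exists x : nat -> K, [/\ x 0%N = b 0%N * x k ^+ e,
    forall i, x i.+1 = x i ^+ e + b i.+1 * x k ^+ e & x k != 0].
Proof.
move=> e_gt1 nzb.
(* [G i] is [x i] as a polynomial in the unknown [c = x k]; the system amounts to [(G k).[c] =
   c]. *)
pose G := fix G i : {poly K} := if i is j.+1 then G j ^+ e + (b i)%:P * 'X^e
  else (b 0%N)%:P * 'X^e.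
have e_gt0 : (0 < e)%N := ltnW e_gt1.
have szX (c : K) : c != 0 -> size (c%:P * 'X^e : {poly K}) = e.+1.
  by move=> nzc; rewrite size_Cmul // size_polyXn.
have szXle (c : K) : (size (c%:P * 'X^e : {poly K})%R <= e.+1)%N.
  by have [->|/szX->//] := eqVneq c 0; rewrite mul0r size_poly0.
have G0 i : (forall j, (j <= i)%N -> b j = 0) -> G i = 0.
  elim: i => [|i IH] b0 /=; rewrite b0 // mul0r // addr0 IH ?expr0n.
    by case: (e) e_gt0.
  by move=> j le_ji; rewrite b0 // leqW.
have szG i : (exists2 j, (j <= i)%N & b j != 0) -> (e < size (G i))%N.
  elim: i => [|i IH] [j le_ji nzj] /=.
    by move: le_ji nzj; rewrite leqn0 => /eqP -> nz; rewrite szX.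
  case: (pselect (exists2 j, (j <= i)%N & b j != 0)) => [/IH szi|nob].
    have nzG : G i != 0 by rewrite -size_poly_gt0 (leq_ltn_trans _ szi).
    have szGe : (e.+1 < size (G i ^+ e))%N.
      rewrite -[size _]prednK ?size_poly_gt0 ?expf_neq0 // size_exp ltnS.
      apply: (@leq_trans (2 * e)); first by rewrite mul2n -addnn -addn1 leq_add2l.
      by rewrite leq_mul2r (leq_trans e_gt1) ?orbT // -ltnS prednK ?size_poly_gt0.
    by rewrite size_polyDl ?(leq_ltn_trans (szXle _)) // ltnW.
  have b0 l : (l <= i)%N -> b l = 0.
    by move=> li; apply/eqP/negPn/negP => nz; apply: nob; exists l.
  have /eqP <- : j == i.+1.
    rewrite eqn_leq le_ji ltnNge; apply/negP => /b0 bj0.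
    by rewrite bj0 eqxx in nzj.
  by rewrite G0 // expr0n gtn_eqF // add0r szX.
have dvdG i : exists R, G i = 'X^2 * R.
  elim: i => [|i [R IH]] /=.
    by exists ((b 0%N)%:P * 'X^(e - 2)); rewrite mulrCA -exprD subnKC.
  exists ('X^(2 * e - 2) * R ^+ e + (b i.+1)%:P * 'X^(e - 2)).
  rewrite IH mulrDr [X in _ = _ + X]mulrCA -exprD subnKC //; congr (_ + _).
  by rewrite exprMn -exprM [RHS]mulrA -exprD subnKC // leq_pmulr.
(* Since [G k = 'X^2 * R], any root of ['X * R - 1] is a nonzero solution of [(G k).[c] = c]. *)
have [R GR] := dvdG k.
have nzR : R != 0.
  by have := szG k nzb; apply: contraTneq => R0; rewrite GR R0 mulr0 size_poly0.
have /closed_rootP [c] : size ('X * R - 1) != 1%N.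
  rewrite size_polyDl; first by rewrite mulrC size_mulX // eqSS size_poly_eq0.
  by rewrite size_polyN size_poly1 mulrC size_mulX // ltnS size_poly_gt0.
rewrite rootE !hornerE subr_eq0 => /eqP cR.
have Gc : (G k).[c] = c by rewrite GR hornerM hornerXn expr2 -mulrA cR mulr1.
exists (fun i => (G i).[c]); split.
- by rewrite Gc /= !hornerE.
- by move=> i; rewrite Gc /= !hornerE.
- by rewrite Gc; apply: contra_eq_neq cR => ->; rewrite mul0r eq_sym oner_neq0.
Qed.

(** * Lang's theorem for invertible matrices *)

Section Lang.
Variables (K : closedFieldType) (e : nat) (ae : add_exp K e) (e_gt1 : (1 < e)%N).
Variables (n : nat) (T : 'M[K]_n) (uT : T \in unitmx).

Let sigma (v : 'rV[K]_n) := twist e v *m T.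

(** The orbit under [sigma] of a row outside the span of [B] becomes dependent modulo [B]. A fixed
    vector is sought as a combination of this orbit, with coefficients from [triangular_fixpoint],
    corrected by rows of [B]. *)
Lemma fixed_rows_extend r (B : 'M_(r, n)) :
  twist e B *m T = B -> (r < n)%N -> row_free B ->
  exists2 x : 'rV_n, sigma x = x & ~~ (x <= B)%MS.
Proof.
move=> fixB ltrn freeB.
have [v nvB] : exists v : 'rV_n, ~~ (v <= B)%MS.
  apply/not_existsP => all_B; have : (1%:M <= B)%MS.
    by apply/row_subP => i; apply/negPn/negP => /all_B.
  by rewrite sub1mx /row_full (eqP freeB) ltn_eqF.
pose s i := iter i sigma v.
have s0 : s 0%N = v by [].
have sS i : s i.+1 = sigma (s i) by [].
clearbody s; pose S k := \matrix_(i < k) s i.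
have subS k i : (i < k)%N -> (s i <= S k)%MS.
  by move=> lt_ik; rewrite -[s i](rowK (fun i : 'I_k => s i) (Ordinal lt_ik)) row_sub.
have exk : exists k, (s k <= B + S k)%MS.
  apply/not_existsP => nsub.
  have: forall k, (k <= \rank (B + S k)%MS)%N.
    elim=> // k IH; apply: (leq_ltn_trans IH).
    rewrite (ltn_leqif (mxrank_leqif_sup _)).
      apply/negP => sub; apply: (nsub k); apply: submx_trans sub.
      by rewrite (submx_trans (subS _ _ (ltnSn k))) ?addsmxSr.
    rewrite addsmxS //; apply/row_subP => i; rewrite rowK.
    exact: subS (leqW (ltn_ord i)).
  move/(_ n.+1); apply/negP; rewrite -ltnNge ltnS; exact: rank_leq_col.
case: (ex_minnP exk) => [[|k] sk min_k].
  case/negP: nvB; rewrite -s0; apply: (submx_trans sk).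
  by rewrite addsmx_sub submx_refl [S _]flatmx0 sub0mx.
have nsk : ~~ (s k <= B + S k)%MS.
  by apply/negP => /min_k; rewrite ltnn.
have sigmaD u w : sigma (u + w) = sigma u + sigma w.
  by rewrite /sigma twistD // mulmxDl.
have sigmaZ c u : sigma (c *: u) = c ^+ e *: sigma u.
  by rewrite /sigma -!mul_scalar_mx twistM // twist_scalar // mulmxA.
have sigmaB r' (y : 'M_(r', _)) : twist e (y *m B) *m T = twist e y *m B.
  by rewrite twistM // -mulmxA fixB.
have sigma0 : sigma 0 = 0 by rewrite /sigma twist0 // mul0mx.
case/sub_addsmxP: sk => -[beta u] sk.
pose b i := u 0 (inord i).
have {}sk : s k.+1 = \sum_(i < k.+1) b i *: s i + beta *m B.
  rewrite sk addrC; congr (_ + _); rewrite mulmx_sum_row.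
  by apply: eq_bigr => i _; rewrite rowK /b inord_val.
(* If all [b i] vanished, injectivity of [sigma] would put [s k] in the span of [B]. *)
have nzb : exists2 i, (i <= k)%N & b i != 0.
  apply/not_exists2P => b0; case/negP: nsk.
  have [g eg] := twist_root ae beta.
  suff -> : s k = g *m B by rewrite (submx_trans (submxMl _ _)) ?addsmxSl.
  apply: (twist_inj ae); apply: (can_inj (mulmxK uT)).
  rewrite sigmaB eg -/(sigma _) -sS sk big1 ?add0r // => i _.
  have [|/negP/negPn/eqP ->] := b0 i; last by rewrite scale0r.
  by case; rewrite -ltnS.
have [x [x0 xS nzxk]] := triangular_fixpoint e_gt1 nzb.
pose c := x k.
(* An equation of Artin-Schreier type, which determines the coordinates along the fixed rows [B]. *)
have exy (d : K) : exists y, y ^+ e + d = y.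
  have /closed_rootP [y] : size ('X^e - 'X + d%:P) != 1%N.
    rewrite size_polyDl.
      by rewrite size_polyDl ?size_polyXn ?size_polyN ?size_polyX // eqSS gtn_eqF // ltnW.
    rewrite size_polyDl ?size_polyXn ?size_polyN ?size_polyX //.
    by rewrite (leq_ltn_trans (size_polyC_leq1 _)) // ltnS ltnW.
  by rewrite rootE !hornerE addrAC subr_eq0 => /eqP; exists y.
pose y := \row_j projT1 (cid (exy (c ^+ e * beta 0 j))).
have yE : twist e y + c ^+ e *: beta = y.
  apply/rowP => j; rewrite !mxE ?ord1.
  exact: (projT2 (cid (exy (c ^+ e * beta 0 j)))).
exists (\sum_(i < k.+1) x i *: s i + y *m B).
  rewrite sigmaD [sigma (y *m B)]sigmaB (big_morph sigma sigmaD sigma0).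
  under eq_bigr do rewrite sigmaZ -sS.
  rewrite big_ord_recr /= sk -/c -[in RHS]yE mulmxDl [RHS]addrA [RHS]addrAC.
  congr (_ + _); rewrite scalerDr addrA scalemxAl; congr (_ + _).
  rewrite scaler_sumr !big_ord_recl x0 -/c addrCA scalerA mulrC; congr (_ + _).
  rewrite -big_split; apply: eq_bigr => i _ /=.
  by rewrite xS scalerDl scalerA [c ^+ e * _]mulrC.
apply: contra nsk; rewrite big_ord_recr /= => sub.
rewrite -(eqmx_scale _ nzxk).
have -> : x k *: s k = (\sum_(i < k) x i *: s i + x k *: s k + y *m B)
    - (\sum_(i < k) x i *: s i + y *m B).
  by rewrite [X in X - _]addrAC [X in X - _]addrC addrK.
apply: addmx_sub; first by rewrite (submx_trans sub) ?addsmxSl.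
rewrite eqmx_opp addmx_sub //; last by rewrite (submx_trans (submxMl _ _)) ?addsmxSl.
apply: summx_sub => i _; apply: scalemx_sub.
by rewrite (submx_trans (subS _ _ (ltn_ord i))) ?addsmxSr.
Qed.

(** Lang's theorem for the general linear group: [T] is the inverse of [twist e H] times [H]. The
    rows of [H] are a maximal free family of fixed points of [sigma], a basis by
    [fixed_rows_extend]. *)
Lemma lang : exists2 H : 'M[K]_n, H \in unitmx & twist e H *m T = H.
Proof.
pose P r := `[< exists2 B : 'M_(r, n), row_free B & twist e B *m T = B >].
have exP : exists r, P r.
  exists 0%N; apply/asboolP; exists 0; last exact: flatmx0.
  by rewrite /row_free mxrank0.
have bP r : P r -> (r <= n)%N.
  by case/asboolP => B /eqP rB _; move: (rank_leq_col B); rewrite rB.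
case: (ex_maxnP exP bP) => r /[dup] /bP le_rn /asboolP [B freeB fixB] max_r.
case: (ltnP r n) => [lt_rn | le_nr].
  have [x fixx nxB] := fixed_rows_extend fixB lt_rn freeB.
  suff /max_r : P (1 + r)%N by rewrite ltnn.
  apply/asboolP; exists (col_mx x B).
    have: (\rank B < \rank (col_mx x B))%N.
      rewrite -addsmxE (ltn_leqif (mxrank_leqif_sup _)) ?addsmxSr //.
      by apply: contra nxB => /(submx_trans (addsmxSl _ _)).
    by rewrite (eqP freeB) => lt_r; rewrite /row_free eqn_leq rank_leq_row.
  by rewrite /twist map_col_mx mul_col_mx -/(twist e x) -/(twist e B) fixB -/(sigma x) fixx.
have eq_rn : r = n by apply/eqP; rewrite eqn_leq le_rn.
subst r; exists B => //; by rewrite -row_free_unit.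
Qed.

End Lang.

(** * Additive functions among polynomials in additive functions *)

Section PrimitiveElements.
Variables (K : fieldType) (p : nat) (pK : p \in [pchar K]) (G : zmodType).
Implicit Types (L : (G -> K) -> Prop) (f g l : G -> K) (D : nat).

(* Polynomials of degree [< D] in the functions of [L].                        *)
Inductive dlt L : nat -> (G -> K) -> Prop :=
| dlt0 D : dlt L D (fun=> 0)
| dltc D c : dlt L D.+1 (fun=> c)
| dltM D l f : L l -> dlt L D f -> dlt L D.+1 (fun x => l x * f x)
| dltD D f g : dlt L D f -> dlt L D g -> dlt L D (fun x => f x + g x).

Lemma dlt_ext L D f g : f =1 g -> dlt L D f -> dlt L D g.
Proof. by move=> /funext ->. Qed.

Lemma dlt_eq0 L f x : dlt L 0 f -> f x = 0.
Proof.
move=> df; move: {-2}0%N (erefl 0%N) df => D eD df.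
by elim: df eD => // {}D f1 g _ IHf _ IHg eD; rewrite IHf // IHg // addr0.
Qed.

Lemma dltS L D f : dlt L D f -> dlt L D.+1 f.
Proof.
elim=> {D f} [D|D c|D l f Ll _ IH|D f g _ IHf _ IHg].
- exact: dlt0.
- exact: dltc.
- exact: dltM.
- exact: dltD.
Qed.

Lemma dlt_le L D E f : (D <= E)%N -> dlt L D f -> dlt L E f.
Proof. by move=> /subnK <-; elim: (E - D)%N => // k IH /IH /dltS. Qed.

Lemma dlt_sub (L L' : (G -> K) -> Prop) D f :
  (forall l, L l -> L' l) -> dlt L D f -> dlt L' D f.
Proof.
move=> sL; elim=> {D f} [D|D c|D l f /sL Ll _ IH|D f g _ IHf _ IHg].
- exact: dlt0.
- exact: dltc.
- exact: dltM.
- exact: dltD.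
Qed.

Lemma dltZ L D c f : dlt L D f -> dlt L D (fun x => c * f x).
Proof.
elim=> {D f} [D|D d|D l f Ll _ IH|D f g _ IHf _ IHg].
- by apply: dlt_ext (dlt0 L D) => x; rewrite mulr0.
- exact: dltc.
- by apply: dlt_ext (dltM Ll IH) => x; rewrite mulrCA.
- by apply: dlt_ext (dltD IHf IHg) => x; rewrite mulrDr.
Qed.

Lemma dltB L D f g : dlt L D f -> dlt L D g -> dlt L D (fun x => f x - g x).
Proof.
by move=> df /(dltZ (-1)) dg; apply: dlt_ext (dltD df dg) => x; rewrite mulN1r.
Qed.

Lemma dlt_sum L D (I : Type) (r : seq I) (f : I -> G -> K) :
  (forall i, dlt L D (f i)) -> dlt L D (fun x => \sum_(i <- r) f i x).
Proof.
move=> df; elim: r => [|i r IH].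
  by apply: dlt_ext (dlt0 L D) => x; rewrite big_nil.
by apply: dlt_ext (dltD (df i) IH) => x; rewrite big_cons.
Qed.

Lemma dlt_mulX L D l e f :
  L l -> dlt L D f -> dlt L (e + D) (fun x => l x ^+ e * f x).
Proof.
move=> Ll df; elim: e => [|e IH].
  by apply: dlt_ext df => x; rewrite expr0 mul1r.
by apply: dlt_ext (dltM Ll IH) => x; rewrite exprS mulrA.
Qed.

Lemma dltM_pred L D l f : L l -> dlt L D.-1 f -> (D = 0%N -> f =1 fun=> 0) ->
  dlt L D (fun x => l x * f x).
Proof.
case: D => [|D] Ll df f0; last exact: dltM.
by apply: dlt_ext (dlt0 L 0) => x; rewrite f0 // mulr0.
Qed.

(** [z] is a formal [K]-combination of points. It defines a functional [ev z] and a combination of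
    finite differences [pd z], which behaves like a derivation: it is the constant [ev z] on
    additive functions, and obeys Leibniz's rule up to terms of lower degree. *)
Definition ev (z : seq (K * G)) f := \sum_(u <- z) u.1 * f u.2.
Definition pd (z : seq (K * G)) f x := \sum_(u <- z) u.1 * (f (x + u.2) - f x).

Definition additive_fun f := forall x y, f (x + y) = f x + f y.

Lemma additive_fun0 f : additive_fun f -> f 0 = 0.
Proof.
by move=> af; have := af 0 0; rewrite addr0 => /(congr1 (fun x => x - f 0));
  rewrite subrr addrK.
Qed.

Lemma pdD z f g x : pd z (fun x => f x + g x) x = pd z f x + pd z g x.
Proof.
rewrite /pd -big_split; apply: eq_bigr => u _ /=.
by rewrite -mulrDr opprD addrACA.
Qed.

Lemma pd_sum z (I : Type) (r : seq I) (f : I -> G -> K) x :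
  pd z (fun x => \sum_(i <- r) f i x) x = \sum_(i <- r) pd z (f i) x.
Proof.
elim: r => [|i r IH].
  rewrite big_nil /pd big1 // => u _.
  by rewrite !big_nil subrr mulr0.
by rewrite big_cons -IH -pdD; congr (pd z _ x); apply: funext => y; rewrite big_cons.
Qed.

Lemma pd_const z c x : pd z (fun=> c) x = 0.
Proof. by rewrite /pd big1 // => u _; rewrite subrr mulr0. Qed.

Lemma pd_additive z f x : additive_fun f -> pd z f x = ev z f.
Proof.
by move=> af; apply: eq_bigr => u _; rewrite af addrAC subrr add0r.
Qed.

Lemma pdM z l g x : additive_fun l ->
  pd z (fun x => l x * g x) x = l x * pd z g x + ev z l * g x +
    \sum_(u <- z) (u.1 * l u.2) * (g (x + u.2) - g x).
Proof.
move=> al; rewrite /pd /ev mulr_sumr mulr_suml -!big_split.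
apply: eq_bigr => u _ /=; rewrite al; ring.
Qed.

Section Degree.
Variables (L : (G -> K) -> Prop) (addL : forall l, L l -> additive_fun l).

Lemma dlt_delta D h f : dlt L D f -> dlt L D.-1 (fun x => f (x + h) - f x).
Proof.
elim=> {D f} [D|D c|D l f Ll df IH|D f g _ IHf _ IHg].
- by apply: dlt_ext (dlt0 L _) => x; rewrite subr0.
- by apply: dlt_ext (dlt0 L _) => x; rewrite subrr.
- have d1 : dlt L D (fun x => l x * (f (x + h) - f x)).
    apply: dltM_pred => // D0 x; rewrite D0 in df.
    by rewrite !(dlt_eq0 _ df) subrr.
  have d2 := dltZ (l h) df.
  have d3 : dlt L D (fun x => l h * (f (x + h) - f x)).
    by apply: dltZ; apply: dlt_le IH; apply: leq_pred.
  by apply: dlt_ext (dltD (dltD d1 d2) d3) => x; rewrite (addL Ll); ring.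
- by apply: dlt_ext (dltD IHf IHg) => x; rewrite opprD addrACA.
Qed.

Lemma dlt_pd D z f : dlt L D f -> dlt L D.-1 (pd z f).
Proof.
move=> df; apply: dlt_sum => u; apply: dltZ; exact: dlt_delta.
Qed.

Lemma dlt_pdM D z l g : L l -> dlt L D g -> dlt L D.-1
  (fun x => pd z (fun x => l x * g x) x - (l x * pd z g x + ev z l * g x)).
Proof.
move=> Ll dg; apply: (@dlt_ext _ _
    (fun x => \sum_(u <- z) (u.1 * l u.2) * (g (x + u.2) - g x))).
  by move=> x; rewrite (pdM _ _ _ (addL Ll)); ring.
by apply: dlt_sum => u; apply: dltZ; apply: dlt_delta.
Qed.

Lemma dltM_pred2 N l r : L l -> dlt L N.-2 r -> dlt L N.-1 (fun x => l x * r x).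
Proof.
case: N => [|[|N]] Ll dr /=; last exact: dltM.
  by apply: dlt_ext (dlt0 L _) => x; rewrite (dlt_eq0 _ dr) mulr0.
by apply: dlt_ext (dlt0 L _) => x; rewrite (dlt_eq0 _ dr) mulr0.
Qed.

End Degree.

Fixpoint lspan (ts : seq (G -> K)) l : Prop :=
  if ts is t :: ts' then
    exists c l', lspan ts' l' /\ l = (fun x => c * t x + l' x)
  else l = (fun=> 0).

Lemma lspan0 ts : lspan ts (fun=> 0).
Proof.
elim: ts => //= t ts IH; exists 0, (fun=> 0); split=> //.
by apply: funext => x; rewrite mul0r addr0.
Qed.

Lemma lspanD ts l l' : lspan ts l -> lspan ts l' ->
  lspan ts (fun x => l x + l' x).
Proof.
elim: ts l l' => [|t ts IH] l l' /=.
  by move=> -> ->; apply: funext => x; rewrite addr0.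
move=> [c [k [sk ->]]] [c' [k' [sk' ->]]].
exists (c + c'), (fun x => k x + k' x); split; first exact: IH.
by apply: funext => x; ring.
Qed.

Lemma lspanZ ts a l : lspan ts l -> lspan ts (fun x => a * l x).
Proof.
elim: ts l => [|t ts IH] l /=.
  by move=> ->; apply: funext => x; rewrite mulr0.
move=> [c [k [sk ->]]].
exists (a * c), (fun x => a * k x); split; first exact: IH.
by apply: funext => x; ring.
Qed.

Lemma lspan_head t ts : lspan (t :: ts) t.
Proof.
exists 1, (fun=> 0); split; first exact: lspan0.
by apply: funext => x; rewrite mul1r addr0.
Qed.

Lemma lspan_behead t ts l : lspan ts l -> lspan (t :: ts) l.
Proof.
by exists 0, l; split=> //; apply: funext => x; rewrite mul0r add0r.
Qed.

Lemma lspan_catl ts ts' l : lspan ts l -> lspan (ts ++ ts') l.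
Proof.
elim: ts l => [|t ts IH] l /=; first by move=> ->; apply: lspan0.
by move=> [c [k [/IH sk ->]]]; exists c, k.
Qed.

Lemma lspan_catr ts ts' l : lspan ts' l -> lspan (ts ++ ts') l.
Proof. by elim: ts => // t ts IH /IH; apply: lspan_behead. Qed.

Lemma ev_cat y z f : ev (y ++ z) f = ev y f + ev z f.
Proof. by rewrite /ev big_cat. Qed.

Lemma ev_scale a z f : ev [seq (a * u.1, u.2) | u <- z] f = a * ev z f.
Proof.
rewrite /ev big_map mulr_sumr; apply: eq_bigr => u _ /=; by rewrite mulrA.
Qed.

Lemma evD z f g : ev z (fun x => f x + g x) = ev z f + ev z g.
Proof. by rewrite /ev -big_split; apply: eq_bigr => u _; rewrite mulrDr. Qed.

Lemma evZ z c f : ev z (fun x => c * f x) = c * ev z f.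
Proof. by rewrite /ev mulr_sumr; apply: eq_bigr => u _; rewrite mulrCA. Qed.

(** Finite-dimensional duality, by elimination: combinations of evaluations at points suffice to
    separate linearly independent functions. *)
Lemma separate t ts : ~ lspan ts t ->
  exists z, ev z t = 1 /\ forall l, lspan ts l -> ev z l = 0.
Proof.
elim: ts t => [|s ts IH] t nst.
  have [h nzt] : exists h, t h != 0.
    apply/not_existsP => t0; apply: nst; apply: funext => h.
    by apply/eqP/negPn/negP/t0.
  exists [:: ((t h)^-1, h)]; split; first by rewrite /ev big_seq1 mulVf.
  by move=> l ->; rewrite /ev big_seq1 mulr0.
case: (pselect (lspan ts s)) => [ss | /IH [y [ys y0]]].
  have [|z [zt z0]] := IH t; first by move=> /(lspan_behead s).
  exists z; split=> // l [c [k [sk ->]]].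
  by rewrite evD evZ z0 // z0 // mulr0 addr0.
pose c := ev y t; have [|z [zt z0]] := IH (fun x => t x + (- c) * s x).
  move=> st; apply: nst; exists c, (fun x => t x + (- c) * s x); split=> //.
  by apply: funext => x; ring.
exists (z ++ [seq ((- ev z s) * u.1, u.2) | u <- y]).
split; first by rewrite ev_cat ev_scale -zt evD evZ /c; ring.
move=> l [d [k [sk ->]]].
by rewrite ev_cat ev_scale !evD !evZ (z0 _ sk) (y0 _ sk) ys; ring.
Qed.

Lemma dlt_normal t ts D h : dlt (lspan (t :: ts)) D h ->
  exists g : nat -> G -> K, (forall e, dlt (lspan ts) (D - e) (g e)) /\
    forall x, h x = \sum_(e < D) t x ^+ e * g e x.
Proof.
elim=> {D h} [D|D c|D l f [c [l' [sl' ->]]] _ [g [dg fE]]|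
              D f f' _ [g [dg fE]] _ [g' [dg' fE']]].
- exists (fun _ _ => 0); split=> [e|x]; first exact: dlt0.
  by rewrite big1 // => e _; rewrite mulr0.
- exists (fun e _ => if e is 0%N then c else 0); split=> [[|e]|x].
  + exact: dltc.
  + exact: dlt0.
  + rewrite big_ord_recl /= expr0 mul1r big1 ?addr0 // => e _.
    by rewrite mulr0.
- exists (fun e x => (if e is e'.+1 then c * g e' x else 0) + l' x * g e x).
  split=> [[|e]|x].
  + apply: dltD; first exact: dlt0.
    by rewrite subn0; apply: dltM => //; have := dg 0%N; rewrite subn0.
  + apply: dltD; first by rewrite subSS; apply: dltZ.
    rewrite subSS; apply: dltM_pred => //; first by rewrite -subnS.
    by move=> De x; apply: (@dlt_eq0 (lspan ts)); have := dg e.+1; rewrite subnS De.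
  + under eq_bigr do rewrite mulrDr.
    rewrite big_split /= big_ord_recl /= mulr0 add0r fE mulrDl !mulr_sumr.
    congr (_ + _).
      by apply: eq_bigr => e _; rewrite /bump /= add1n exprS; ring.
    rewrite big_ord_recr /= (_ : g D x = 0) ?mulr0 ?addr0.
      by apply: eq_bigr => e _; ring.
    by apply: (@dlt_eq0 (lspan ts)); have := dg D; rewrite subnn.
- exists (fun e x => g e x + g' e x); split=> [e|x]; first exact: dltD.
  rewrite fE fE' -big_split; apply: eq_bigr => e _ /=; by rewrite mulrDr.
Qed.

Lemma dlt_lspan0 D h : dlt (lspan [::]) D h -> exists c, h =1 fun=> c.
Proof.
elim=> {D h} [D|D c|D l f -> _ _|D f g _ [c fc] _ [d gd]].
- by exists 0.
- by exists c.
- by exists 0 => x; rewrite mul0r.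
- by exists (c + d) => x; rewrite fc gd.
Qed.

Section Additive.
Variables (L : (G -> K) -> Prop) (addL : forall l, L l -> additive_fun l).
Hypothesis LX : forall l, L l -> L (fun x => l x ^+ p).

Section Derivation.
Variables (t : G -> K) (ts : seq (G -> K)) (z : seq (K * G)).
Hypotheses (Lt : L t) (Lts : forall l, lspan ts l -> L l).
Hypotheses (zt : ev z t = 1) (zts : forall l, lspan ts l -> ev z l = 0).

(** As [ev z] vanishes on [ts], the first-order part of [pd z] disappears, and the degree drops by
    two instead of one. *)
Lemma pd_lspan D g : dlt (lspan ts) D g -> dlt L D.-2 (pd z g).
Proof.
elim=> {D g} [D|D c|D l f sl df IH|D f g _ IHf _ IHg].
- by apply: dlt_ext (dlt0 L _) => x; rewrite pd_const.
- by apply: dlt_ext (dlt0 L _) => x; rewrite pd_const.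
- have Ll := Lts sl.
  have d1 := dlt_pdM addL z Ll (dlt_sub Lts df).
  have d2 := dltM_pred2 Ll IH.
  apply: dlt_ext (dltD d1 d2) => x; rewrite zts //; ring.
- by apply: dlt_ext (dltD IHf IHg) => x; rewrite pdD.
Qed.

Lemma pd_mulX D g e : dlt (lspan ts) D g ->
  dlt L (e + D).-2
    (fun x => pd z (fun x => t x ^+ e * g x) x - e%:R * t x ^+ e.-1 * g x).
Proof.
move=> dg; elim: e => [|e IH].
  apply: dlt_ext (pd_lspan dg) => x; rewrite mul0r mul0r subr0.
  by congr (pd z _ x); apply: funext => y; rewrite expr0 mul1r.
have d1 := dlt_pdM addL z Lt (dlt_mulX e Lt (dlt_sub Lts dg)).
have d2 := dltM_pred2 Lt IH.
apply: dlt_ext (dltD d1 d2) => x; rewrite zt.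
have -> : (fun x => t x ^+ e.+1 * g x) = (fun x => t x * (t x ^+ e * g x)).
  by apply: funext => y; rewrite exprS mulrA.
set u := pd z _ x; set v := pd z _ x.
have -> : (e.+1)%:R * t x ^+ e.+1.-1 * g x =
    t x * (e%:R * t x ^+ e.-1 * g x) + t x ^+ e * g x.
  by case: e {IH d1 d2 u v} => [|e] /=; rewrite ?exprS; ring.
ring.
Qed.

(** Up to lower degree, [pd z] is the derivative with respect to [t], so its [E]-th iterate isolates
    the top coefficient. *)
Lemma iter_pd E N (g : nat -> G -> K) F r :
  (E <= N)%N -> (forall e, dlt (lspan ts) (N - e) (g e)) -> dlt L N.-1 r ->
  (forall x, F x = \sum_(e < E.+1) t x ^+ e * g e x + r x) ->
  dlt L (N.-1 - E) (fun x => iter E (pd z) F x - E`!%:R * g E x).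
Proof.
elim: E N g F r => [|E IH] N g F r leEN dg dr FE.
  rewrite subn0; apply: dlt_ext dr => x.
  by rewrite /= FE big_ord_recl big_ord0 /= fact0; ring.
case: N leEN dg dr => // N leEN dg dr.
pose r' x := pd z F x - \sum_(e < E.+1) t x ^+ e * (e.+1%:R * g e.+1 x).
have dr' : dlt L N.-1 r'.
  have d1 : dlt L N.-1 (fun x => \sum_(e < E.+2)
      (pd z (fun x => t x ^+ e * g e x) x - e%:R * t x ^+ e.-1 * g e x)).
    apply: dlt_sum => e; have := pd_mulX e (dg e).
    by rewrite subnKC // (leq_trans _ leEN) // -ltnS.
  apply: dlt_ext (dltD d1 (dlt_pd addL z dr)) => x; rewrite /r'.
  have -> : F = (fun x => \sum_(e < E.+2) t x ^+ e * g e x + r x).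
    by apply: funext => y; rewrite FE.
  rewrite pdD pd_sum sumrB [X in _ - X]big_ord_recl /= mul0r mul0r add0r addrAC.
  by congr (_ - _); apply: eq_bigr => e _; rewrite /bump /= add1n; ring.
have d : dlt L (N.-1 - E)
    (fun x => iter E (pd z) (pd z F) x - E`!%:R * (E.+1%:R * g E.+1 x)).
  apply: (IH N (fun e x => e.+1%:R * g e.+1 x) _ r') => //.
    by move=> e; apply: dltZ; have := dg e.+1; rewrite subSS.
  by move=> x; rewrite /r'; ring.
rewrite -subn1 -subnDA add1n in d.
apply: dlt_ext d => x; rewrite -iterSr factS natrM; ring.
Qed.

End Derivation.

Lemma iter_pd_additive z f E : additive_fun f ->
  exists c, iter E.+1 (pd z) f =1 fun=> c.
Proof.
move=> af; elim: E => [|E [c fc]].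
  by exists (ev z f) => x; rewrite /= pd_additive.
exists 0 => x; rewrite iterS (funext fc); exact: pd_const.
Qed.

Lemma iter_pd_additive2 z f E : additive_fun f -> iter E.+2 (pd z) f =1 fun=> 0.
Proof.
move=> af x; have [c fc] := iter_pd_additive z E af.
by rewrite iterS (funext fc) pd_const.
Qed.

Hypothesis L0 : L (fun=> 0).

(** The powers of [t] in [h] are removed from the top. If [E >= p], a factor [t ^ p] is itself in
    [L], which lowers the degree. If [E < p], applying [pd z] [E] times makes the additive [f]
    constant, and the factorial of [E] is invertible, so the coefficient of [t ^ E] has smaller
    degree than expected. *)
Lemma primitive_step ts f h D : (1 < D)%N -> (forall l, lspan ts l -> L l) ->
  additive_fun f -> dlt (lspan ts) D.+1 h -> dlt L D (fun x => f x - h x) ->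
  dlt L D f.
Proof.
move=> D_gt1; elim: ts h => [|t ts IH] h sL af dh dfh.
  have [c hc] := dlt_lspan0 dh.
  have dc : dlt L D (fun=> c) by case: D D_gt1 {dh dfh} => // D _; apply: dltc.
  by apply: dlt_ext (dltD dfh dc) => x; rewrite hc subrK.
have sL' l : lspan ts l -> L l by move=> /(lspan_behead t); apply: sL.
case: (pselect (lspan ts t)) => [st | /separate [z [zt z0]]].
  apply: (IH h) => //; apply: dlt_sub dh => l [c [k [sk ->]]].
  by apply: lspanD => //; apply: lspanZ.
have Lt : L t by apply: sL; apply: lspan_head.
have [g [dg hE]] := dlt_normal dh.
suff Q E : (0 < E <= D.+1)%N ->
    dlt L D (fun x => f x - \sum_(e < E) t x ^+ e * g e x).
  apply: (IH (g 0%N)) => //; first by have := dg 0%N; rewrite subn0.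
  apply: dlt_ext (Q 1%N isT) => x; by rewrite big_ord1 expr0 mul1r.
case/andP => E_gt0 leED; rewrite -(subKn leED).
have: (D.+1 - E <= D)%N by lia.
elim: (D.+1 - E)%N => [_|k IHk ltkD].
  by rewrite subn0; apply: dlt_ext dfh => x; rewrite hE.
have := IHk (ltnW ltkD); rewrite subSS subSn; last exact: ltnW.
have: (0 < D - k)%N by rewrite subn_gt0.
have: (D - k <= D)%N by rewrite leq_subr.
move: (D - k)%N => {E_gt0 leED IHk ltkD k}E leED E_gt0 dr.
suff dtg : dlt L D (fun x => t x ^+ E * g E x).
  apply: dlt_ext (dltD dr dtg) => x; rewrite big_ord_recr /=; ring.
case: (leqP p E) => [lepE | ltEp].
  have dg' := dlt_mulX (E - p) Lt (dlt_sub sL' (dg E)).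
  have := dltM (LX Lt) dg'.
  have -> : (fun x => t x ^+ p * (t x ^+ (E - p) * g E x)) =
      (fun x => t x ^+ E * g E x).
    by apply: funext => x; rewrite mulrA -exprD subnKC.
  apply: dlt_le; have := prime_gt1 (pcharf_prime pK).
  lia.
have nzE : (E`!%:R : K) != 0.
  rewrite -(dvdn_pcharf pK); elim: E ltEp {dr E_gt0 leED} => [|E IHE] ltEp.
    by rewrite fact0 dvdn1 gtn_eqF // prime_gt1 // (pcharf_prime pK).
  rewrite factS Euclid_dvdM ?(pcharf_prime pK) // negb_or IHE ?andbT 1?ltnW //.
  by rewrite gtnNdvd.
have dEg : dlt L (D - E) (fun x => E`!%:R * g E x).
  have dit : dlt L (D - E) (fun x => iter E (pd z) f x - E`!%:R * g E x).
    by apply: (iter_pd Lt sL' zt z0 (leqW leED) dg dr) => x; rewrite addrC subrK.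
  have dit' : dlt L (D - E) (iter E (pd z) f).
    case: E {leED dr dit ltEp nzE} E_gt0 => [|[|E]] // _.
      have [c fc] := iter_pd_additive z 0 af.
      apply: (@dlt_ext _ _ (fun=> c)) => [x|]; first by rewrite fc.
      by case: D D_gt1 {IH dh dfh dg hE} => [|[|D]] // _; rewrite subSS subn0; apply: dltc.
    apply: (@dlt_ext _ _ (fun=> 0)) => [x|]; first by rewrite iter_pd_additive2.
    exact: dlt0.
  apply: dlt_ext (dltB dit' dit) => x; ring.
have := dlt_mulX E Lt (dltZ (E`!%:R)^-1 dEg); rewrite subnKC //.
by apply: dlt_ext => x; rewrite mulKf.
Qed.

Hypothesis LD : forall l l', L l -> L l' -> L (fun x => l x + l' x).
Hypothesis LZ : forall c l, L l -> L (fun x => c * l x).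

Lemma lspan_catP ts ts' : (forall l, lspan ts l -> L l) ->
  (forall l, lspan ts' l -> L l) -> forall l, lspan (ts ++ ts') l -> L l.
Proof.
elim: ts => // t ts IH Lts Lts' l [c [l' [sl' ->]]].
apply: LD; first by apply: LZ; apply: Lts; apply: lspan_head.
by apply: IH => // k /(lspan_behead t) /Lts.
Qed.

Lemma dlt_finite_support D f : dlt L D f ->
  exists ts, (forall l, lspan ts l -> L l) /\ dlt (lspan ts) D f.
Proof.
elim=> {D f} [D|D c|D l f Ll _ [ts [Lts df]]|D f g _ [ts [Lts df]] _ [us [Lus dg]]].
- by exists [::]; split=> [l -> //|]; apply: dlt0.
- by exists [::]; split=> [l -> //|]; apply: dltc.
- exists (l :: ts); split=> [k [c [l' [/Lts Ll' ->]]]|].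
    by apply: LD => //; apply: LZ.
  apply: dltM; first exact: lspan_head.
  by apply: dlt_sub df => k; apply: lspan_behead.
- exists (ts ++ us); split; first exact: lspan_catP.
  apply: dltD; first by apply: dlt_sub df => k; apply: lspan_catl.
  by apply: dlt_sub dg => k; apply: lspan_catr.
Qed.

(** This is the fact that additive polynomials in characteristic [p] are [p]-polynomials, stated for
    functions on [G]. The degree of [f] is lowered to one by [primitive_step], and additivity
    removes the constant term. *)
Lemma primitive D f : dlt L D f -> additive_fun f -> L f.
Proof.
move=> df af; suff [c [l [Ll fE]]] : exists c l, L l /\ forall x, f x = c + l x.
  have c0 : c = 0.
    by have := additive_fun0 af; rewrite fE (additive_fun0 (addL Ll)) addr0.
  by rewrite (_ : f = l) //; apply: funext => x; rewrite fE c0 add0r.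
(* The bound in [dlt] is strict: this says that [f] has degree at most one. *)
have {D df} : dlt L 2 f.
  have: dlt L D.+2 f by do 2!apply: dltS.
  elim: D {df} => // D IH dD; apply: IH.
  have [ts [Lts dts]] := dlt_finite_support dD.
  apply: (primitive_step _ Lts af dts) => //.
  by apply: dlt_ext (dlt0 L _) => x; rewrite subrr.
have aux E h : dlt L E h -> E = 1%N -> exists c, h =1 fun=> c.
  elim=> {E h} [E|E c|E l h _ dh _ [E0]|E h k _ IHh _ IHk E1].
  - by exists 0.
  - by exists c.
  - by subst E; exists 0 => x; rewrite (dlt_eq0 _ dh) mulr0.
  - have [c hc] := IHh E1; have [d kd] := IHk E1.
    by exists (c + d) => x; rewrite hc kd.
move=> df; move: df (erefl 2%N); move: {-2}2%N => E.
elim=> {E f af} [E|E c|E l f Ll df _ [E1]|E f g _ IHf _ IHg E2].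
- by exists 0, (fun=> 0); split=> // x; rewrite addr0.
- by exists c, (fun=> 0); split=> // x; rewrite addr0.
- have [c fc] := aux _ _ df (esym E1); exists 0, (fun x => c * l x); split; first exact: LZ.
  by move=> x; rewrite fc add0r mulrC.
- have [c [l [Ll fE]]] := IHf E2; have [d [k [Lk gE]]] := IHg E2.
  exists (c + d), (fun x => l x + k x); split; first exact: LD.
  by move=> x; rewrite fE gE addrACA.
Qed.

End Additive.
End PrimitiveElements.

(** * Zariski closure of an additive group *)

Section AdditiveClosure.
Variables (K : closedFieldType) (p : nat) (pK : p \in [pchar K]).
Variables (A : zmodType) (X : finType) (x : X -> A -> K).
Hypothesis addx : forall i, additive_fun (x i).

Inductive polyfun : ((X -> K) -> K) -> Prop :=
| polyfun_const c : polyfun (fun=> c)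
| polyfun_coord i : polyfun (fun w => w i)
| polyfunD P Q : polyfun P -> polyfun Q -> polyfun (fun w => P w + Q w)
| polyfunM P Q : polyfun P -> polyfun Q -> polyfun (fun w => P w * Q w).

(** The [p]-polynomials: combinations of the [p ^ i]-th powers of the coordinates. *)
Inductive plin : ((X -> K) -> K) -> Prop :=
| plin0 : plin (fun=> 0)
| plin_coord i : plin (fun w => w i)
| plinD P Q : plin P -> plin Q -> plin (fun w => P w + Q w)
| plinZ c P : plin P -> plin (fun w => c * P w)
| plinX P : plin P -> plin (fun w => P w ^+ p).

Lemma plin_additive P u v : plin P ->
  P (fun i => u i + v i) = P u + P v.
Proof.
elim=> {P} [|i|P Q _ IHP _ IHQ|c P _ IHP|P _ IHP].
- by rewrite addr0.
- by [].
- by rewrite IHP IHQ addrACA.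
- by rewrite IHP mulrDr.
- by rewrite IHP; case: (add_exp_pchar pK) => _ ->.
Qed.

Section Hull.
Variable w : X -> K.

(** The map [y] sends [G] onto the additive group generated by the points of [A] and [w]; working on
    [G] avoids forming this subgroup. *)
Let G : zmodType := (A * int)%type.
Let y (g : G) : X -> K := fun i => x i g.1 + w i *~ g.2.
Let L (f : G -> K) : Prop := exists2 P, plin P & f = (fun g => P (y g)).

Lemma hull_coordD g h : y (g + h) = (fun i => y g i + y h i).
Proof. by apply: funext => i; rewrite /y /= addx mulrzDr addrACA. Qed.

Lemma hull_additive f : L f -> additive_fun f.
Proof. by case=> P pP -> g h; rewrite hull_coordD plin_additive. Qed.

Lemma dlt_mul D E f g : dlt L D f -> dlt L E g ->
  exists F, dlt L F (fun h : G => f h * g h).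
Proof.
move=> df dg; elim: df => {D f} [D|D c|D l f Ll _ [F IH]|D f f' _ [F IH] _ [F' IH']].
- by exists 0%N; apply: dlt_ext (dlt0 L 0) => h; rewrite mul0r.
- by exists E; apply: dltZ.
- by exists F.+1; apply: dlt_ext (dltM Ll IH) => h; rewrite mulrA.
- exists (maxn F F'); apply: dlt_ext (dltD (dlt_le (leq_maxl _ _) IH)
    (dlt_le (leq_maxr _ _) IH')) => h; by rewrite mulrDl.
Qed.

Lemma polyfun_dlt P : polyfun P -> exists D, dlt L D (fun g => P (y g)).
Proof.
elim=> {P} [c|i|P Q _ [D IHP] _ [E IHQ]|P Q _ [D IHP] _ [E IHQ]].
- by exists 1%N; apply: dltc.
- exists 2%N; have Li : L (fun g => y g i) by exists (fun w => w i) => //; apply: plin_coord.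
  by apply: dlt_ext (dltM Li (dltc L 0 1)) => g; rewrite mulr1.
- exists (maxn D E); exact: dltD (dlt_le (leq_maxl _ _) IHP) (dlt_le (leq_maxr _ _) IHQ).
- exact: dlt_mul IHP IHQ.
Qed.

Hypothesis w_rel : forall P, plin P -> (forall a, P (x^~ a) = 0) -> P w = 0.

(* A polynomial of minimal degree vanishing on [A] but not on the group        *)
(* generated by [A] and [w] is additive, hence a [p]-linear relation of [A].   *)
Lemma dense_hull P : polyfun P -> (forall a, P (x^~ a) = 0) -> P w = 0.
Proof.
move=> pP PA; apply/eqP; apply: contraT => nzPw; exfalso.
have y0 a : y (a, 0) = x^~ a by apply: funext => i; rewrite /y mulr0z addr0.
have x0 i : x i 0 = 0 by apply: additive_fun0.
have y1 : y (0, 1) = w by apply: funext => i; rewrite /y x0 add0r.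
pose bad D := `[< exists f, [/\ dlt L D f, forall a, f (a, 0) = 0
                    & exists g, f g != 0] >].
have exbad : exists D, bad D.
  have [D dP] := polyfun_dlt pP; exists D; apply/asboolP.
  exists (fun g => P (y g)); split=> // [a|]; first by rewrite y0.
  by exists (0, 1); rewrite y1.
case: (ex_minnP exbad) => D /asboolP [f [df fA [g0 nzf]]] minD.
case: D df minD => [|D] df minD; first by rewrite (dlt_eq0 g0 df) eqxx in nzf.
have small h : dlt L D h -> (forall a, h (a, 0) = 0) -> forall g, h g = 0.
  move=> dh hA g; apply/eqP; apply: contraT => nzh; exfalso.
  suff /minD : bad D by rewrite ltnn.
  by apply/asboolP; exists h; split=> //; exists g.
have f0 : f 0 = 0 by apply: fA.
have ftr a g : f (g + (a, 0)) = f g.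
  apply/eqP; rewrite -subr_eq0; apply/eqP.
  apply: (small (fun g => f (g + (a, 0)) - f g)).
    exact: (dlt_delta hull_additive (a, 0) df).
  by move=> b /=; rewrite -[(b, 0) + (a, 0)]/(b + a, 0 + 0) addr0 !fA subrr.
case: D => [|D] in df minD small *.
  have d0 := dlt_delta hull_additive g0 df.
  have := dlt_eq0 0 d0; rewrite add0r f0 subr0 => fg0.
  by rewrite fg0 eqxx in nzf.
have af : additive_fun f.
  move=> g h; apply/eqP; rewrite -subr_eq0 opprD addrA; apply/eqP.
  apply: (small (fun g => f (g + h) - f g - f h)).
    exact: (dltB (dlt_delta hull_additive h df) (dltc L D (f h))).
  by move=> a /=; rewrite [(a, 0) + h]addrC ftr fA subr0 subrr.
have [Q pQ fE] : L f.
  apply: (primitive pK hull_additive _ _ _ _ df af).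
  - by move=> l [Q pQ ->]; exists (fun w => Q w ^+ p) => //; apply: plinX.
  - by exists (fun=> 0) => //; apply: plin0.
  - move=> l l' [Q pQ ->] [R pR ->]; exists (fun w => Q w + R w) => //; exact: plinD.
  - by move=> c l [Q pQ ->]; exists (fun w => c * Q w) => //; apply: plinZ.
have fw : f (0, 1) = 0.
  by rewrite fE y1; apply: w_rel => // a; rewrite -y0 -(fA a) fE.
have fn (n : nat) : f (0, n%:Z) = 0.
  elim: n => [|n IH]; first exact: fA.
  by rewrite -addn1 PoszD -[0 in LHS]addr0 -[(_, _)]/((0, n%:Z) + (0, 1)) af IH fw addr0.
have fz (k : int) : f (0, k) = 0.
  case: k => n; first exact: fn.
  have := af (0, Negz n) (0, n.+1%:Z); rewrite fn addr0 => <-.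
  by rewrite -[(0, Negz n) + _]/(0 + 0, Negz n + n.+1%:Z) NegzE addNr addr0 fA.
move: nzf; case: g0 => a k; rewrite -[a]add0r -[k]addr0.
by rewrite -[(_, _)]/((0, k) + (a, 0)) ftr fz eqxx.
Qed.

End Hull.
End AdditiveClosure.

(** * Linear functionals compatible with Frobenius *)

Section FrobeniusGraph.
Variables (K : closedFieldType) (p : nat) (pK : p \in [pchar K]).

(** An additive polynomial in [t]. Its coefficients are stored in an ordinary polynomial, so that
    [size s] serves as the degree. *)
Definition ppoly (s : {poly K}) (t : K) : K :=
  \sum_(i < size s) s`_i * t ^+ (p ^ i).

Lemma ppolyE n (s : {poly K}) t : (size s <= n)%N ->
  ppoly s t = \sum_(i < n) s`_i * t ^+ (p ^ i).
Proof.
move=> le_sn; rewrite /ppoly -(subnKC le_sn) big_split_ord /=.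
rewrite [X in _ = _ + X]big1 ?addr0 // => i _.
by rewrite nth_default ?mul0r // leq_addr.
Qed.

Lemma ppoly0 t : ppoly 0 t = 0.
Proof. by rewrite /ppoly size_poly0 big_ord0. Qed.

Lemma ppolyD s s' t : ppoly (s + s') t = ppoly s t + ppoly s' t.
Proof.
pose n := maxn (size s) (size s').
rewrite !(@ppolyE n) ?leq_maxl ?leq_maxr //; last exact: size_polyD.
by rewrite -big_split; apply: eq_bigr => i _; rewrite coefD mulrDl.
Qed.

Lemma ppolyZ c s t : ppoly (c *: s) t = c * ppoly s t.
Proof.
rewrite !(@ppolyE (size s)) ?size_scale_leq // mulr_sumr.
by apply: eq_bigr => i _; rewrite coefZ mulrA.
Qed.

Lemma ppolyC c t : ppoly c%:P t = c * t.
Proof.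
by rewrite (@ppolyE 1) ?size_polyC_leq1 // big_ord1 coefC /= expn0 expr1.
Qed.

Lemma expr_sum_pchar (I : Type) (r : seq I) (F : I -> K) :
  (\sum_(i <- r) F i) ^+ p = \sum_(i <- r) F i ^+ p.
Proof.
have [p_gt0 pD] := add_exp_pchar pK.
apply: (big_morph (fun x => x ^+ p) pD); by rewrite expr0n gtn_eqF.
Qed.

Lemma ppoly_frob (s : {poly K}) : exists s' : {poly K},
  [/\ size s' = if s == 0 then 0%N else (size s).+1,
      lead_coef s' = lead_coef s ^+ p
    & forall t, ppoly s' t = ppoly s t ^+ p].
Proof.
have [p_gt0 _] := add_exp_pchar pK.
have [->|nzs] := eqVneq s 0.
  exists 0; split=> [||t]; rewrite ?size_poly0 ?lead_coef0 ?ppoly0 ?expr0n //.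
    by rewrite gtn_eqF.
  by rewrite gtn_eqF.
have [f fE] := add_exp_rmorph (add_exp_pchar pK).
have nzfs : map_poly f s != 0 by rewrite map_poly_eq0.
exists (map_poly f s * 'X); split=> [||t].
- by rewrite size_mulX // size_map_poly.
- by rewrite lead_coef_Mmonic ?monicX // lead_coef_map fE.
rewrite (@ppolyE (size s).+1) ?size_mulX ?size_map_poly //.
rewrite big_ord_recl coefMX /= mul0r add0r /ppoly expr_sum_pchar.
apply: eq_bigr => i _; rewrite coefMX /= coef_map /= fE exprMn -exprM -expnSr.
by [].
Qed.

Lemma ppoly_frobX (s : {poly K}) k : s != 0 -> exists s' : {poly K},
  [/\ size s' = (size s + k)%N, lead_coef s' = lead_coef s ^+ (p ^ k)
    & forall t, ppoly s' t = ppoly s t ^+ (p ^ k)].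
Proof.
move=> nzs; elim: k => [|k [s' [szs lcs sE]]].
  by exists s; split=> [||t]; rewrite ?addn0 ?expn0 ?expr1.
have nzs' : s' != 0 by rewrite -size_poly_gt0 szs addn_gt0 size_poly_gt0 nzs.
have [s'' [szs' lcs' sE']] := ppoly_frob s'; exists s''; split=> [||t].
- by rewrite szs' (negPf nzs') szs addnS.
- by rewrite lcs' lcs -exprM expnSr.
- by rewrite sE' sE -exprM expnSr.
Qed.

Lemma ppoly_root (s : {poly K}) u : s != 0 -> exists t, u + ppoly s t = 0.
Proof.
move=> nzs; have p_gt1 := prime_gt1 (pcharf_prime pK).
pose Q : {poly K} := u%:P + \sum_(i < size s) s`_i *: 'X^(p ^ i).
have /closed_rootP [t] : size Q != 1%N.
  rewrite neq_ltn; apply/orP; right.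
  apply: (@leq_ltn_trans (p ^ (size s).-1)); first by rewrite expn_gt0 ltnW.
  rewrite ltnNge; apply/negP => /leq_sizeP /(_ _ (leqnn _)).
  rewrite coefD coefC gtn_eqF ?expn_gt0 ?(ltnW p_gt1) // add0r coef_sum.
  have lts : ((size s).-1 < size s)%N by rewrite prednK // size_poly_gt0.
  rewrite (bigD1 (Ordinal lts)) //= big1 ?addr0 => [|i nei].
    by rewrite coefZ coefXn eqxx mulr1 => /eqP; rewrite -/(lead_coef s) lead_coef_eq0 (negPf nzs).
  rewrite coefZ coefXn eqn_exp2l // eq_sym (_ : _ == _ = false) ?mulr0 //.
  by apply: contraNF nei => /eqP e; apply/eqP/val_inj.
rewrite rootE hornerD hornerC horner_sum => /eqP Qt; exists t.
by rewrite -[RHS]Qt; congr (_ + _); apply: eq_bigr => i _; rewrite hornerZ hornerXn.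
Qed.

Variable A : Type.
Implicit Types (Ga : (A -> K) -> K -> Prop) (f : A -> K) (u : K).

(* The graph of a [K]-linear functional compatible with the [p]-th power map.  *)
Record frob_graph Ga : Prop := FrobGraph {
  frob_graphD : forall f g u v, Ga f u -> Ga g v -> Ga (fun a => f a + g a) (u + v);
  frob_graphZ : forall c f u, Ga f u -> Ga (fun a => c * f a) (c * u);
  frob_graphX : forall f u, Ga f u -> Ga (fun a => f a ^+ p) (u ^+ p);
  frob_graph0 : Ga (fun=> 0) 0;
  frob_graph_fun : forall f u, Ga f u -> (forall a, f a = 0) -> u = 0
}.

Lemma frob_graphXX Ga f u k : frob_graph Ga -> Ga f u ->
  Ga (fun a => f a ^+ (p ^ k)) (u ^+ (p ^ k)).
Proof.
move=> gG Gfu; elim: k => [|k IH].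
  by rewrite expn0 expr1 (_ : (fun a => _) = f) //; apply: funext => a; rewrite expr1.
have := frob_graphX gG IH; rewrite -exprM -expnSr.
by congr (Ga _ _); apply: funext => a; rewrite -exprM -expnSr.
Qed.

(** The value [v] at [y] must satisfy [u + ppoly s v = 0] whenever [f + ppoly s y] vanishes on [A]
    and [Ga f u]. Solving one such relation of minimal size suffices: the others reduce to it by
    Euclidean division, subtracting multiples of its Frobenius powers. *)
Lemma frob_graph_extend Ga y : frob_graph Ga ->
  exists v Ga', [/\ frob_graph Ga', forall f u, Ga f u -> Ga' f u & Ga' y v].
Proof.
move=> gG.
suff [v vE] : exists v, forall (s : {poly K}) f u, Ga f u ->
    (forall a, f a + ppoly s (y a) = 0) -> u + ppoly s v = 0.
  exists v, (fun f u => exists f0 u0 s, [/\ Ga f0 u0,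
    f = (fun a => f0 a + ppoly s (y a)) & u = u0 + ppoly s v]).
  split.
  - split.
    + move=> _ _ _ _ [f [u [s [Gf -> ->]]]] [g [w [r [Gg -> ->]]]].
      exists (fun a => f a + g a), (u + w), (s + r).
      split; rewrite ?ppolyD; [exact: frob_graphD| |by rewrite addrACA].
      by apply: funext => a; rewrite ppolyD addrACA.
    + move=> c _ _ [f [u [s [Gf -> ->]]]].
      exists (fun a => c * f a), (c * u), (c *: s).
      split; rewrite ?ppolyZ; [exact: frob_graphZ| |by rewrite mulrDr].
      by apply: funext => a; rewrite ppolyZ mulrDr.
    + move=> _ _ [f [u [s [Gf -> ->]]]]; have [s' [_ _ sE]] := ppoly_frob s.
      have [_ pD] := add_exp_pchar pK.
      exists (fun a => f a ^+ p), (u ^+ p), s'.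
      split; rewrite ?sE ?pD //; first exact: frob_graphX.
      by apply: funext => a; rewrite sE pD.
    + exists (fun=> 0), 0, 0; split; rewrite ?ppoly0 ?addr0 //.
        exact: frob_graph0 gG.
      by apply: funext => a; rewrite ppoly0 addr0.
    + by move=> _ _ [f [u [s [Gf -> ->]]]]; apply: vE.
  - move=> f u Gf; exists f, u, 0; split; rewrite ?ppoly0 ?addr0 //.
    by apply: funext => a; rewrite ppoly0 addr0.
  - exists (fun=> 0), 0, 1%:P; split; rewrite ?ppolyC ?mul1r ?add0r //.
      exact: frob_graph0 gG.
    by apply: funext => a; rewrite ppolyC mul1r add0r.
pose rel n := `[< exists (s : {poly K}) f u, [/\ s != 0, size s = n, Ga f u
                    & forall a, f a + ppoly s (y a) = 0] >].
case: (pselect (exists n, rel n)) => [exrel | norel]; last first.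
  exists 0 => s f u Gf; have [-> fE|nzs fE] := eqVneq s 0.
    rewrite ppoly0 addr0; apply: (frob_graph_fun gG Gf) => a.
    by have := fE a; rewrite ppoly0 addr0.
  by exfalso; apply: norel; exists (size s); apply/asboolP; exists s, f, u.
case: (ex_minnP exrel) => n /asboolP [s0 [f0 [u0 [nzs0 szs0 Gf0 f0E]]]] minn0.
have [v vE] := ppoly_root u0 nzs0; exists v.
have [p_gt0 _] := add_exp_pchar pK.
move=> s; have [m] := ubnP (size s); elim: m s => // m IHm s ltsm f u Gf fE.
have [s_eq0|nzs] := eqVneq s 0.
  rewrite s_eq0 ppoly0 addr0; apply: (frob_graph_fun gG Gf) => a.
  by have := fE a; rewrite s_eq0 ppoly0 addr0.
have le_s0s : (size s0 <= size s)%N.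
  by rewrite szs0; apply: minn0; apply/asboolP; exists s, f, u.
pose k := (size s - size s0)%N.
have [s1 [szs1 lcs1 s1E]] := ppoly_frobX k nzs0.
have {}szs1 : size s1 = size s by rewrite szs1 subnKC.
pose c := lead_coef s / lead_coef s1.
have lc1 : lead_coef s1 != 0 by rewrite lcs1 expf_neq0 // lead_coef_eq0.
have kD := (add_expX k (add_exp_pchar pK)).2.
have k_gt0 := (add_expX k (add_exp_pchar pK)).1.
have G1 := frob_graphD gG Gf (frob_graphZ gG (- c) (frob_graphXX k gG Gf0)).
have lts : (size (s + (- c) *: s1)%R < m)%N.
  apply: leq_trans (ltnSE ltsm); rewrite -[X in (_ < X)%N]prednK ?size_poly_gt0 //.
  rewrite ltnS; apply/leq_sizeP => j lej; rewrite coefD coefZ.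
  move: lej; rewrite leq_eqVlt => /orP [/eqP <-|ltj].
    rewrite -/(lead_coef s) -szs1 -/(lead_coef s1) mulNr /c divfK //.
    by rewrite subrr.
  have les : (size s <= j)%N := leq_trans (leqSpred _) ltj.
  by rewrite !nth_default ?szs1 // mulr0 addr0.
have := IHm _ lts _ _ G1; rewrite ppolyD ppolyZ s1E.
have -> : u + - c * u0 ^+ (p ^ k) + (ppoly s v + - c * ppoly s0 v ^+ (p ^ k)) =
   (u + ppoly s v) - c * (u0 + ppoly s0 v) ^+ (p ^ k) by rewrite kD; ring.
rewrite vE expr0n gtn_eqF // mulr0 subr0; apply => a.
rewrite ppolyD ppolyZ s1E.
have -> : f a + - c * f0 a ^+ (p ^ k) +
    (ppoly s (y a) + - c * ppoly s0 (y a) ^+ (p ^ k)) =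
   (f a + ppoly s (y a)) - c * (f0 a + ppoly s0 (y a)) ^+ (p ^ k).
  by rewrite kD; ring.
by rewrite fE f0E expr0n gtn_eqF // mulr0 subr0.
Qed.

Lemma frob_graph_extend_seq Ga (I : eqType) (y : I -> A -> K) (s : seq I) :
  frob_graph Ga ->
  exists Ga', [/\ frob_graph Ga', forall f u, Ga f u -> Ga' f u
                & forall i, i \in s -> exists v, Ga' (y i) v].
Proof.
move=> gG; elim: s => [|i s [Ga1 [gG1 sG1 G1y]]]; first by exists Ga.
have [v [Ga2 [gG2 sG2 G2y]]] := frob_graph_extend (y i) gG1.
exists Ga2; split=> // [f u /sG1 /sG2 //|j].
rewrite inE => /predU1P [->|/G1y [u /sG2 Gu]]; first by exists v.
by exists u.
Qed.

End FrobeniusGraph.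

Section ClosedPoints.
Variables (K : closedFieldType) (p : nat) (pK : p \in [pchar K]).
Variables (A : zmodType) (X : finType) (x : X -> A -> K).
Hypothesis addx : forall i, additive_fun (x i).
Hypothesis closedx : forall w : X -> K,
  (forall P, polyfun P -> (forall a, P (x^~ a) = 0) -> P w = 0) ->
  exists a, forall i, x i a = w i.

(** Extend the functional to all coordinates. Its values [w] satisfy the [p]-linear relations of
    [A], hence all polynomial relations by [dense_hull], and closedness makes [w] a point of [A]. *)
Lemma frob_graph_point Ga : frob_graph p Ga ->
  exists a, forall P u, plin p P -> Ga (fun b => P (x^~ b)) u -> P (x^~ a) = u.
Proof.
move=> gG; have [Ga' [gG' sG Gx]] := frob_graph_extend_seq pK x (enum X) gG.
have {}Gx i : exists v, Ga' (x i) v by apply: Gx; rewrite mem_enum.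
pose w i := projT1 (cid (Gx i)).
have Gw i : Ga' (x i) (w i) := projT2 (cid (Gx i)).
have Gpl P : plin p P -> Ga' (fun b => P (x^~ b)) (P w).
  elim=> {P} [|i|P Q _ IHP _ IHQ|c P _ IHP|P _ IHP].
  - exact: frob_graph0 gG'.
  - exact: Gw.
  - exact: (frob_graphD gG' IHP IHQ).
  - exact: (frob_graphZ gG' c IHP).
  - exact: (frob_graphX gG' IHP).
have [a ax] : exists a, forall i, x i a = w i.
  apply: closedx => P pP PA; apply: (dense_hull pK addx _ pP PA) => Q pQ QA.
  exact: (frob_graph_fun gG' (Gpl _ pQ) QA).
exists a => P u pP /sG Gu; have -> : x^~ a = w by apply: funext => i; rewrite ax.
apply/eqP; rewrite -subr_eq0; apply/eqP.
have := frob_graphD gG' (Gpl _ pP) (frob_graphZ gG' (-1) Gu).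
rewrite mulN1r => /(frob_graph_fun gG'); apply=> b.
by rewrite mulN1r subrr.
Qed.

End ClosedPoints.

(** * Zariski closed algebras *)

Lemma zariski_closed_points (K : closedFieldType) n (A : Type) (f : A -> 'M[K]_n)
    (w : 'I_n * 'I_n -> K) :
  zariski_closed (range f) ->
  (forall P, polyfun P -> (forall a, P (fun ij => f a ij.1 ij.2) = 0) -> P w = 0) ->
  exists a, forall ij, f a ij.1 ij.2 = w ij.
Proof.
case=> S rangeE wP; pose W := \matrix_(i, j) w (i, j).
suff [a _ fa] : range f W.
  by exists a => -[i j]; rewrite fa mxE.
rewrite rangeE => P SP.
have polyP : polyfun (fun u : 'I_n * 'I_n -> K =>
    mpoly.meval (fun k => mxvec (\matrix_(i, j) u (i, j)) 0 k) P).
  under eq_fun do rewrite mpoly.mevalE.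
  elim: (mpoly.msupp P) => [|m s IH].
    by under eq_fun do rewrite big_nil; apply: polyfun_const.
  under eq_fun do rewrite big_cons.
  apply: polyfunD => //; apply: polyfunM; first exact: polyfun_const.
  elim: (index_enum _) => [|k r IHr].
    by under eq_fun do rewrite big_nil; apply: polyfun_const.
  under eq_fun do rewrite big_cons.
  apply: polyfunM => //; elim: (mpoly.fun_of_multinom m k) => [|e IHe].
    by under eq_fun do rewrite expr0; apply: polyfun_const.
  under eq_fun do rewrite exprS.
  apply: polyfunM => //; case/mxvec_indexP: k {IHe} => i j.
  by under eq_fun do rewrite mxvecE mxE; apply: polyfun_coord.
apply: (wP _ polyP) => a.
have : range f (f a) by exists a.
rewrite rangeE => /(_ P SP); congr (mpoly.meval _ _ = 0).
by apply: funext => k; congr (mxvec _ _ _); apply/matrixP => i j; rewrite mxE.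
Qed.

(** An equation of the image, restricted to the line through [f a], is a polynomial in the scalar
    which vanishes on the infinite field [F], hence identically. *)
Lemma infinite_closed_scale (F : fieldType) (K : closedFieldType)
    (iota : {rmorphism F -> K}) (A : lmodType F) n (f : A -> 'M[K]_n) :
  ~ finite_set [set: F] -> zariski_closed (range f) ->
  (forall c a, f (c *: a) = iota c *: f a) ->
  forall c a, exists b, f b = c *: f a.
Proof.
move=> infF clf fZ c a.
have [|b bE] := @zariski_closed_points _ _ _ f
  (fun ij => c * f a ij.1 ij.2) clf; last first.
  by exists b; apply/matrixP => i j; rewrite (bE (i, j)) mxE.
move=> P polyP PA.
have [Q QE] : exists Q : {poly K}, forall t,
    P (fun ij => t * f a ij.1 ij.2) = Q.[t].
  elim: polyP {PA} => {P} [d|ij|P P' _ [Q QE] _ [Q' QE']|P P' _ [Q QE] _ [Q' QE']].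
  - by exists d%:P => t; rewrite hornerC.
  - by exists ((f a ij.1 ij.2)%:P * 'X) => t; rewrite !hornerE mulrC.
  - by exists (Q + Q') => t; rewrite hornerD QE QE'.
  - by exists (Q * Q') => t; rewrite hornerM QE QE'.
rewrite QE; have [->|nzQ] := eqVneq Q 0; first by rewrite horner0.
have [r Qr] := closed_field_poly_normal Q.
exfalso; apply: infF; apply: (@sub_finite_set _ _ (iota @^-1` [set` r])%classic).
  move=> x _ /=.
  have : root Q (iota x).
    rewrite rootE -QE -(PA (x *: a)); apply/eqP; congr P.
    by apply: funext => ij; rewrite fZ mxE.
  by rewrite Qr rootZ ?lead_coef_eq0 // root_prod_XsubC.
apply: finite_preimage; last exact: finite_seq.
by move=> x y _ _; apply: fmorph_inj.
Qed.

Lemma finite_field_char (F : fieldType) :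
  finite_set [set: F] -> exists p, p \in [pchar F].
Proof.
move=> finF; case: (pselect (injective (fun n => n%:R : F))) => [inj|].
  exfalso; apply: infinite_nat.
  have := @finite_preimage _ _ [set: F]%classic (fun n : nat => n%:R : F).
  rewrite preimage_setT; apply=> //; by move=> m n _ _; apply: inj.
move=> /existsNP [m /existsNP [n /not_implyP [emn nmn]]].
wlog ltmn : m n emn nmn / (m < n)%N.
  move=> W; case: (ltngtP m n) => [/W|/W|//]; apply=> //; exact: nesym.
have n0 : ((n - m)%:R : F) == 0 by rewrite natrB ?(ltnW ltmn) // emn subrr.
by have [|p pF] := natf0_pchar _ n0; [rewrite subn_gt0|exists p].
Qed.

(** Write [q = p ^ f] and let [r] be the remainder of [t] modulo [f]. All [p ^ f] elements of [F]
    are roots of ['X^(p ^ r) - 'X], which is too many unless [r = 0]. *)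
Lemma pow_fix_qcard (F : fieldType) p t :
  finite_set [set: F] -> p \in [pchar F] ->
  (forall x : F, x ^+ (p ^ t) = x) -> exists t', (p ^ t = qcard F ^ t')%N.
Proof.
move=> finF pF fixF.
have [s sE] := (finite_seqP [set: F]%classic).1 finF.
have mems x : x \in s by have : [set: F]%classic x by []; rewrite sE.
have eF : Finite.axiom (undup s).
  by apply: Finite.uniq_enumP => [|x]; rewrite ?undup_uniq // mem_undup mems.
have rK : cancel (fun x => index x s) (fun i => nth 0 s i).
  by move=> x; rewrite nth_index.
pose cM := CanIsCountable rK.
pose fM := isFinite.Build F eF.
pose Ff : finFieldType := HB.pack F cM fM.
have cF : qcard F = #|Ff|.
  rewrite /qcard asboolT // cardE; apply: perm_size; apply: uniq_perm.
  - exact: finmap.fset_uniq.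
  - exact: enum_uniq.
  - by move=> x; rewrite in_fset_set // in_setT (@mem_enum Ff).
have pFf : p \in [pchar Ff] := pF.
have p_gt1 : (1 < p)%N := prime_gt1 (pcharf_prime pF).
have [f cardF] : exists f, #|Ff| = (p ^ f)%N.
  by exists (logn p #|Ff|); rewrite {1}(card_pprimeChar pFf).
have f_gt0 : (0 < f)%N.
  have := finNzRing_gt1 Ff; rewrite cardF; case: (f) => //; by rewrite expn0.
have qfix m (x : Ff) : x ^+ (p ^ (m * f)) = x.
  elim: m => [|m IHm]; first by rewrite mul0n expn0 expr1.
  by rewrite mulSn expnD exprM -cardF expf_card IHm.
pose r := (t %% f)%N.
have rfix (x : Ff) : x ^+ (p ^ r) = x.
  have := fixF x; rewrite {1}(divn_eq t f) expnD exprM.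
  by have -> : (x : F) ^+ (p ^ (t %/ f * f)) = x := qfix _ x.
have r0 : r = 0%N.
  apply/eqP; apply: contraT => nzr.
  have pr_gt1 : (1 < p ^ r)%N by rewrite -(expn0 p) ltn_exp2l // lt0n.
  have szQ : size ('X^(p ^ r) - 'X : {poly Ff}) = (p ^ r).+1.
    by rewrite size_polyDl ?size_polyXn // size_polyN size_polyX.
  have nzQ : 'X^(p ^ r) - 'X != 0 :> {poly Ff} by rewrite -size_poly_gt0 szQ.
  have : all (root ('X^(p ^ r) - 'X)) (enum Ff).
    by apply/allP => x _; rewrite rootE !hornerE rfix subrr.
  move=> /(max_poly_roots nzQ) /(_ (enum_uniq _)).
  rewrite szQ -cardE cardF ltnS leq_exp2l // leqNgt.
  by rewrite ltn_mod f_gt0.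
exists (t %/ f)%N; rewrite cF cardF -expnM {1}(divn_eq t f) -/r r0 addn0.
by rewrite mulnC.
Qed.

(** * Irreducible representations up to Frobenius twists *)

Section Conjugation.
Variables (K : fieldType) (m n : nat) (U : 'M[K]_(n, m)) (V : 'M[K]_(m, n)).
Hypotheses (UV : U *m V = 1%:M) (VU : V *m U = 1%:M).

Lemma ring_rep_conj (A : nzRingType) (f : A -> 'M[K]_m) :
  ring_rep f -> ring_rep (fun a => U *m f a *m V).
Proof.
move=> rf; split=> [x y|x y|].
- by rewrite (ring_repD rf) mulmxDr mulmxDl.
- by rewrite (ring_repM rf) !mulmxA -(mulmxA _ V U) VU mulmx1.
- by rewrite (ring_rep1 rf) mulmx1 UV.
Qed.

Lemma conj_inj : injective (fun X : 'M[K]_m => U *m X *m V).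
Proof.
move=> X Y /= /(congr1 (fun Z => V *m Z *m U)).
by rewrite !mulmxA VU !mul1mx -!mulmxA VU !mulmx1.
Qed.

End Conjugation.

Section Linked.
Variables (A : nzRingType) (K : closedFieldType).

(** For irreducible representations this means isomorphic, by [intertwiner_iso], without assuming
    that the degrees agree. *)
Definition linked m n (f : A -> 'M[K]_m) (g : A -> 'M[K]_n) : Prop :=
  exists2 T, T != 0 & intertwiner f g T.

Lemma linked_refl n (f : A -> 'M[K]_n) : (0 < n)%N -> linked f f.
Proof.
move=> n_gt0; exists 1%:M; last by move=> a; rewrite mulmx1 mul1mx.
by rewrite -mxrank_eq0 mxrank1 -lt0n.
Qed.

Lemma linked_sym m n (f : A -> 'M[K]_m) (g : A -> 'M[K]_n) :
  cyclic_rep f -> cyclic_rep g -> linked f g -> linked g f.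
Proof.
move=> cf cg [T nzT fT]; have [freeT fullT] := intertwiner_iso cf cg nzT fT.
have TV := mulmxVp freeT; have VT := mulVpmx fullT.
exists (pinvmx T).
  by apply: contraNneq nzT => V0; rewrite -(mulmx1 T) -VT V0 mul0mx mulmx0.
move=> a; rewrite -[LHS]mul1mx -VT -(mulmxA (pinvmx T)) (mulmxA T) -fT.
by rewrite -(mulmxA (f a)) TV mulmx1.
Qed.

Lemma linked_trans m n r (f : A -> 'M[K]_m) (g : A -> 'M[K]_n)
    (h : A -> 'M[K]_r) :
  cyclic_rep f -> cyclic_rep g -> linked f g -> linked g h -> linked f h.
Proof.
move=> cf cg [T nzT fT] [S nzS gS]; exists (T *m S); last first.
  by move=> a; rewrite mulmxA fT -!mulmxA gS.
have [_ /mulVpmx VT] := intertwiner_iso cf cg nzT fT.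
by apply: contraNneq nzS => TS; rewrite -(mul1mx S) -VT -mulmxA TS mulmx0.
Qed.

Lemma linked_twist e m n (f : A -> 'M[K]_m) (g : A -> 'M[K]_n) :
  add_exp K e ->
  linked f g <-> linked (fun a => twist e (f a)) (fun a => twist e (g a)).
Proof.
move=> ae; split=> [[T nzT fT]|[T nzT /(intertwiner_root ae) [T' eT fT]]].
  by exists (twist e T); [rewrite twist_eq0 | apply: intertwiner_twist].
by exists T' => //; move: nzT; rewrite eT twist_eq0.
Qed.

Lemma linked_eq m n (f f' : A -> 'M[K]_m) (g g' : A -> 'M[K]_n) :
  f =1 f' -> g =1 g' -> linked f g -> linked f' g'.
Proof. by move=> /funext -> /funext ->. Qed.

Lemma linked_twistD P k l m n (f : A -> 'M[K]_m) (g : A -> 'M[K]_n) :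
  add_exp K P -> (k <= l)%N ->
  linked (fun a => twist (P ^ k) (f a)) (fun a => twist (P ^ l) (g a)) ->
  linked f (fun a => twist (P ^ (l - k)) (g a)).
Proof.
move=> aP le_kl lk; apply/(linked_twist _ _ (add_expX k aP)).
apply: linked_eq lk => // a.
by rewrite twist_twist -expnD subnK.
Qed.

Section Conjugate.
Variables (n : nat) (f : A -> 'M[K]_n) (H : 'M[K]_n) (uH : H \in unitmx).

Lemma cyclic_rep_conj :
  cyclic_rep f -> cyclic_rep (fun a => H *m f a *m invmx H).
Proof.
move=> cf v y nzv vy.
have nzvH : v *m H != 0.
  by apply: contraNneq nzv => vH; rewrite -(mulmxK uH v) vH mul0mx.
rewrite -(mulKVmx uH y) (cf _ (invmx H *m y) nzvH) ?mulmx0 // => a.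
by rewrite -(vy a) !mulmxA.
Qed.

Lemma linked_conj : (0 < n)%N -> linked f (fun a => H *m f a *m invmx H).
Proof.
move=> n_gt0; exists (invmx H); last by move=> a; rewrite !mulmxA mulVmx // mul1mx.
apply: contraTneq n_gt0 => H0; rewrite -leqNgt leqn0 -(mxrank1 K n).
by rewrite -(mulVmx uH) H0 mul0mx mxrank0.
Qed.

End Conjugate.
End Linked.

Section Selection.
Variables (A : nzRingType) (K : closedFieldType) (I : finType) (d : I -> nat).
Variables (rh : forall i, A -> 'M[K]_(d i)) (P : nat) (aP : add_exp K P).
Hypotheses (d_gt0 : forall i, (0 < d i)%N) (rh_cyc : forall i, cyclic_rep (rh i)).

Let tw k i a := twist (P ^ k) (rh i a).
Let tw_cyc k i : cyclic_rep (tw k i).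
Proof. by apply: cyclic_rep_twist => //; apply: add_expX. Qed.

Definition dominates u v := exists t, linked (rh v) (tw t u).

Lemma dominates_refl u : dominates u u.
Proof.
exists 0%N; apply: linked_eq (linked_refl (rh u) (d_gt0 u)) => // a.
by rewrite /tw expn0 twist_id.
Qed.

Lemma dominates_trans u v w : dominates u v -> dominates v w -> dominates u w.
Proof.
move=> [t lt] [s ls]; exists (t + s)%N.
have := (linked_twist _ _ (add_expX s aP)).1 lt.
move=> /(linked_trans (@rh_cyc w) (@tw_cyc s v) ls).
by apply: linked_eq => // a; rewrite /tw twist_twist -expnD.
Qed.

(** In a covering subset of least cardinality no element dominates another, since the dominated one
    could be dropped. *)
Lemma select_minimal : exists U : {set I},
  (forall j, exists2 i, i \in U & dominates i j) /\
  {in U &, forall u v, dominates u v -> u = v}.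
Proof.
pose cov (U : {set I}) := `[< forall j, exists2 i, i \in U & dominates i j >].
have covT : cov [set: I]%SET.
  by apply/asboolP => j; exists j; [rewrite inE | apply: dominates_refl].
case: (@arg_minnP _ [set: I]%SET cov (fun U : {set I} => #|U|) covT) => U /asboolP covU minU.
exists U; split=> // u v Uu Uv duv; apply/eqP; apply: contraT => neuv.
have : (#|U| <= #|U :\ v|)%N.
  apply: minU; apply/asboolP => j; have [i Ui dij] := covU j.
  have [eiv|neiv] := eqVneq i v.
    exists u; first by rewrite !inE neuv.
    by apply: dominates_trans duv _; rewrite -eiv.
  by exists i => //; rewrite !inE neiv.
by rewrite (cardsD1 v U) Uv add1n ltnn.
Qed.

Lemma unrelated (U : {set I}) u v k l :
  {in U &, forall u v, dominates u v -> u = v} -> u \in U -> v \in U ->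
  linked (tw k u) (tw l v) -> u = v.
Proof.
move=> minU Uu Uv; case: (leqP k l) => [le_kl | /ltnW le_lk].
  move=> /(linked_twistD aP le_kl) lk; apply/esym/minU => //.
  by exists (l - k)%N.
move=> /(linked_sym (@tw_cyc k u) (@tw_cyc l v)) /(linked_twistD aP le_lk) lk.
by apply: minU => //; exists (k - l)%N.
Qed.

End Selection.

(** [per] is the least positive exponent for which [f] is isomorphic to its twist, and 0 if there is
    none. Lang's theorem, applied to the intertwiner, gives a basis in which the entries are fixed
    by this power of Frobenius. *)
Lemma periodic_form (A : nzRingType) (K : closedFieldType) p n
    (f : A -> 'M[K]_n) : p \in [pchar K] -> cyclic_rep f ->
  exists (H : 'M_n) (per : nat), [/\ H \in unitmx,
    forall a, (0 < per)%N ->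
      twist (p ^ per) (H *m f a *m invmx H) = H *m f a *m invmx H
  & forall k, (0 < k)%N -> (per == 0)%N || (k < per)%N ->
      ~ linked f (fun a => twist (p ^ k) (f a))].
Proof.
move=> pK cf; have aX k := add_expX k (add_exp_pchar pK).
have cfk k : cyclic_rep (fun a => twist (p ^ k) (f a)) := cyclic_rep_twist (aX k) cf.
pose Q k := (0 < k)%N && `[< linked f (fun a => twist (p ^ k) (f a)) >].
case: (pselect (exists k, Q k)) => [exQ | noQ]; last first.
  exists 1%:M, 0%N; split=> //; first exact: unitmx1.
  by move=> k k_gt0 _ lk; apply: noQ; exists k; rewrite /Q k_gt0; apply/asboolP.
case: (ex_minnP exQ) => k /andP[k_gt0 /asboolP lk] mink.
have [T nzT fT] := linked_sym cf (cfk k) lk.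
have [freeT _] := intertwiner_iso (cfk k) cf nzT fT.
have uT : T \in unitmx by rewrite -row_free_unit.
have e_gt1 : (1 < p ^ k)%N.
  by rewrite -(expn0 p) ltn_exp2l // prime_gt1 // (pcharf_prime pK).
have [H uH HT] := lang (aX k) e_gt1 uT.
exists H, k; split=> // [a _|l l_gt0 /orP [/eqP k0|ltlk] ll].
- have utH : twist (p ^ k) H \in unitmx.
    have : twist (p ^ k) H *m T \in unitmx by rewrite HT.
    by rewrite unitmx_mul => /andP[].
  have eV : twist (p ^ k) (invmx H) = T *m invmx H.
    apply: (can_inj (mulKmx utH)); rewrite -(twistM (aX k)) mulmxV //.
    rewrite (twist1 (aX k)).
    by rewrite mulmxA HT mulmxV.
  rewrite !(twistM (aX k)) eV mulmxA -[_ *m _ *m T]mulmxA fT mulmxA HT.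
  by [].
- by rewrite k0 in k_gt0.
- by have : (k <= l)%N; [apply: mink; rewrite /Q l_gt0; apply/asboolP | rewrite leqNgt ltlk].
Qed.

(** * Surjectivity onto the simple components *)

Section Surjectivity.
Variables (K : closedFieldType) (A : nzRingType) (n : nat) (rho : A -> 'M[K]_n).
Hypotheses (rho_rep : ring_rep rho) (rho_closed : zariski_closed (range rho)).
Variables (U : finType) (d : U -> nat) (th : forall u, A -> 'M[K]_(d u)).
Variables (X : forall u, 'M[K]_(d u, n)) (Y : forall u, 'M[K]_(n, d u)).
Hypothesis thE : forall u a, th u a = X u *m rho a *m Y u.
Hypotheses (th_rep : forall u, ring_rep (th u)).
Hypotheses (th_cyc : forall u, cyclic_rep (th u)).

Section PrimeCharacteristic.
Variables (p : nat) (pK : p \in [pchar K]) (per : U -> nat).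

Let tw t m (W : 'M[K]_m) := twist (p ^ t) W.
Let ap := add_exp_pchar pK.
Let aX t : add_exp K (p ^ t) := add_expX t ap.

Hypothesis th_per : forall u a, (0 < per u)%N -> tw (per u) (th u a) = th u a.
Hypothesis th_unrel : forall u v k l,
  linked (fun a => tw k (th u a)) (fun a => tw l (th v a)) ->
  u = v /\ k = l %[mod per u].

(** [S C M] is the general [p]-linear form in the entries of a family [W], involving its first [M]
    twists. *)
Let S (C : forall u, nat -> 'M[K]_(d u)) M (W : forall u, 'M[K]_(d u)) : K :=
  \sum_u \sum_(t < M) \tr (C u t *m tw t (W u)).

Let periodic (W : forall u, 'M[K]_(d u)) :=
  forall u, (0 < per u)%N -> tw (per u) (W u) = W u.

Lemma twist_mod_per W u t : periodic W -> tw t (W u) = tw (t %% per u) (W u).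
Proof.
move=> pW; have [->|per_gt0] := posnP (per u); first by rewrite modn0.
rewrite {1}(divn_eq t (per u)) addnC /tw expnD -twist_twist.
elim: (t %/ per u)%N => [|k IH].
  by rewrite mul0n expn0 twist_id.
rewrite mulSn expnD -twist_twist.
have -> // : twist (p ^ per u) (twist (p ^ (t %% per u)) (W u)) =
  twist (p ^ (t %% per u)) (W u).
by rewrite twist_twist mulnC -twist_twist; congr twist; apply: pW.
Qed.

Let m M u := if per u == 0%N then M else per u.

Let ltm M u (t : 'I_M) : (t %% per u < m M u)%N.
Proof.
rewrite /m; have [->|nz] := eqVneq (per u) 0%N; first by rewrite modn0.
by rewrite ltn_mod lt0n.
Qed.

(** Modulo the periods, the twists that occur are pairwise inequivalent. After grouping coefficients
    accordingly, linear independence shows that a relation valid on [A] follows from periodicity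
    alone. *)
Let rel_eq0 C M : (forall a, S C M (th^~ a) = 0) ->
  forall W, periodic W -> S C M W = 0.
Proof.
pose D (s : {u & 'I_(m M u)}) : 'M[K]_(d (tag s)) :=
  \sum_(t < M | Ordinal (ltm (tag s) t) == tagged s) C (tag s) t.
have SE W : periodic W ->
    S C M W = \sum_s \tr (D s *m tw (tagged s) (W (tag s))).
  move=> pW; rewrite /S.
  transitivity (\sum_u \sum_(t < m M u)
      \tr (D (Tagged (fun u => 'I_(m M u)) t) *m tw t (W u))); last first.
    by rewrite (sig_big_dep _ _ (fun u (t : 'I_(m M u)) =>
      \tr (D (Tagged (fun u => 'I_(m M u)) t) *m tw t (W u)))) /=;
      apply: eq_bigr => -[u t] _.
  apply: eq_bigr => u _.
  rewrite (partition_big (fun t : 'I_M => Ordinal (ltm u t)) xpredT) //=.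
  apply: eq_bigr => t _; rewrite /D mulmx_suml raddf_sum /=.
  apply: eq_bigr => t' /eqP et.
  by rewrite (twist_mod_per _ _ pW) -et.
move=> relC W pW; rewrite SE // big1 // => s _.
have -> : D s = 0; last by rewrite mul0mx mxtrace0.
pose f (s : {u & 'I_(m M u)}) a := tw (tagged s) (th (tag s) a).
apply: (@matrix_coef_indep _ _ _ (fun s => d (tag s)) f).
- by move=> r; apply: ring_rep_twist.
- by move=> r; apply: cyclic_rep_twist.
- move=> [u t] [v t'] T nest fT; apply/eqP; apply: contraT => nzT; exfalso.
  have /th_unrel [/= euv] : linked (fun a => tw t (th u a))
      (fun a => tw t' (th v a)) by exists T.
  case: v / euv t' T nest fT nzT => t' T nest _ _ ett'.
  case/eqP: nest; congr existT; apply: val_inj => /=.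
  move: (ltn_ord t) (ltn_ord t') ett'.
  move: (nat_of_ord t) (nat_of_ord t') => k l; rewrite /m.
  have [->|nz] := eqVneq (per u) 0%N; first by rewrite !modn0.
  by move=> lt lt'; rewrite !modn_small.
- move=> a; rewrite -[RHS](relC a); apply/esym/(SE (th^~ a)) => u.
  exact: th_per.
Qed.

(** The graph of the functional which sends a form restricted to [A] to its value at [Z]; it is well
    defined by [rel_eq0]. *)
Let Ga (f : A -> K) (v : K) (Z : forall u, 'M[K]_(d u)) : Prop :=
  exists M C, f = (fun a => S C M (th^~ a)) /\ v = S C M Z.

Let frob_graph_S Z : periodic Z -> frob_graph p (fun f v => Ga f v Z).
Proof.
move=> pZ; split.
- move=> _ _ _ _ [M [C [-> ->]]] [N [D [-> ->]]].
  pose E u t := (if (t < M)%N then C u t else 0) + (if (t < N)%N then D u t else 0).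
  have EE W : S C M W + S D N W = S E (M + N) W.
    rewrite /S -big_split; apply: eq_bigr => u _ /=.
    have widen (B : forall u, nat -> 'M[K]_(d u)) k : (k <= M + N)%N ->
        \sum_(t < k) \tr (B u t *m tw t (W u)) =
        \sum_(t < M + N) \tr ((if (t < k)%N then B u t else 0) *m tw t (W u)).
      move=> lek; rewrite (big_ord_widen (M + N) (fun t => \tr (B u t *m tw t (W u)))) //.
      rewrite big_mkcond; apply: eq_bigr => t _.
      by case: ifP => // _; rewrite mul0mx mxtrace0.
    rewrite (widen C _ (leq_addr _ _)) (widen D _ (leq_addl _ _)) -big_split; apply: eq_bigr => t _ /=.
    by rewrite /E mulmxDl mxtraceD.
  exists (M + N)%N, E; split; last by rewrite EE.
  by apply: funext => a; rewrite EE.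
- move=> c _ _ [M [C [-> ->]]]; exists M, (fun u t => c *: C u t).
  have ZE W : c * S C M W = S (fun u t => c *: C u t) M W.
    rewrite /S mulr_sumr; apply: eq_bigr => u _; rewrite mulr_sumr.
    by apply: eq_bigr => t _; rewrite -scalemxAl mxtraceZ.
  by split=> //; apply: funext => a.
- move=> _ _ [M [C [-> ->]]].
  pose E u t := if t is t'.+1 then twist p (C u t') else 0.
  have XE W : S C M W ^+ p = S E M.+1 W.
    rewrite /S (expr_sum_pchar pK); apply: eq_bigr => u _.
    rewrite (expr_sum_pchar pK) big_ord_recl /= mul0mx mxtrace0 add0r.
    apply: eq_bigr => t _; rewrite /bump /= add1n /mxtrace (expr_sum_pchar pK).
    rewrite /tw expnSr -twist_twist -(twistM ap).
    by apply: eq_bigr => i _; rewrite [RHS]mxE.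
  by exists M.+1, E; split=> //; apply: funext => a.
- exists 0%N, (fun _ _ => 0).
  by split=> [|]; [apply: funext => a|]; rewrite /S big1 // => u _; rewrite big_ord0.
- by move=> _ _ [M [C [-> ->]]] S0; apply: rel_eq0.
Qed.

(** The functional of evaluation at [Z] is represented by a point [a] of [A]. Each entry of [th u]
    is a linear form in the coordinates of [rho], so its value at [a] is the entry of [Z]. *)
Lemma surjective_pchar (Z : forall u, 'M[K]_(d u)) :
  (forall u, (0 < per u)%N -> tw (per u) (Z u) = Z u) ->
  exists a, forall u, th u a = Z u.
Proof.
move=> pZ.
pose x (ij : 'I_n * 'I_n) a := rho a ij.1 ij.2.
have addx ij : additive_fun (x ij).
  by move=> a b; rewrite /x (ring_repD rho_rep) mxE.
have closedx : forall w : _ -> K, (forall P, polyfun P -> (forall a, P (x^~ a) = 0) -> P w = 0) ->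
    exists a, forall i, x i a = w i.
  by move=> w wP; exact: (zariski_closed_points rho_closed wP).
have [a aE] := frob_graph_point pK addx closedx (frob_graph_S pZ).
exists a => u; apply/matrixP => i j.
pose Q (w : 'I_n * 'I_n -> K) :=
  \sum_k \sum_l (X u i l * Y u k j) * w (l, k).
have QE b : Q (x^~ b) = th u b i j.
  rewrite thE mxE; apply: eq_bigr => k _; rewrite mxE mulr_suml.
  by apply: eq_bigr => l _; rewrite /x /= mulrAC.
have pQ : plin p Q.
  have plin_sum (J : Type) (r : seq J) (G : J -> ('I_n * 'I_n -> K) -> K) :
      (forall k, plin p (G k)) -> plin p (fun w => \sum_(k <- r) G k w).
    move=> pG; elim: r => [|k r IH].
      by under eq_fun do rewrite big_nil; apply: plin0.
    by under eq_fun do rewrite big_cons; apply: plinD.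
  apply: (plin_sum) => k; apply: (plin_sum) => l.
  by apply: plinZ; apply: plin_coord.
rewrite -QE; apply: aE => //.
(* The trace form of this matrix unit extracts the entry [i j] of component [u]; comparing indices
   as naturals avoids a cast along [v = u]. *)
pose C v (_ : nat) : 'M[K]_(d v) := \matrix_(i', j')
  ((v == u) && (val i' == val j) && (val j' == val i))%:R.
have SE W : S C 1 W = W u i j.
  rewrite /S (bigD1 u) //= big_ord1 big1 ?addr0 => [|v nvu]; last first.
    rewrite big_ord1 (_ : C v _ = 0) ?mul0mx ?mxtrace0 //.
    by apply/matrixP => k l; rewrite !mxE (negPf nvu).
  rewrite /tw expn0 twist_id /mxtrace (bigD1 j) //= big1 ?addr0 => [|k nkj].
    rewrite mxE (bigD1 i) //= big1 ?addr0 => [|l nli].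
      by rewrite mxE !eqxx mul1r.
    by rewrite mxE !eqxx /= val_eqE (negPf nli) mul0r.
  rewrite mxE big1 // => l _.
  by rewrite mxE eqxx /= val_eqE (negPf nkj) mul0r.
exists 1%N, C; split; last by rewrite SE.
by apply: funext => b; rewrite QE SE.
Qed.

End PrimeCharacteristic.

(** The image in the product is a [K]-subspace, and a linear form vanishing on it is a relation
    between coefficients, hence zero. *)
Lemma surjective_scale :
  (forall c a, exists b, rho b = c *: rho a) ->
  (forall u v, linked (th u) (th v) -> u = v) ->
  forall Z : (forall u, 'M[K]_(d u)), exists a, forall u, th u a = Z u.
Proof.
move=> scale unrel Z; pose T : finType := {u : U & ('I_(d u) * 'I_(d u))%type}.
pose tg u ij : T := existT (fun u => ('I_(d u) * 'I_(d u))%type) u ij.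
pose co (W : forall u, 'M[K]_(d u)) : 'rV[K]_#|T| :=
  \row_k let s := enum_val k in W (tag s) (tagged s).1 (tagged s).2.
have coE W (y : 'cV_#|T|) : (co W *m y) 0 0 =
    \sum_u \tr ((\matrix_(j, i)
      y (enum_rank (tg u (i, j))) 0) *m W u).
  rewrite mxE; transitivity (\sum_(s : T)
      W (tag s) (tagged s).1 (tagged s).2 * y (enum_rank s) 0).
    rewrite (reindex_onto enum_rank enum_val) => [|k _]; last exact: enum_valK.
    apply: eq_big => [s|s _]; first by rewrite enum_rankK eqxx.
    by rewrite mxE enum_rankK.
  transitivity (\sum_u \sum_(ij : 'I_(d u) * 'I_(d u)) W u ij.1 ij.2 *
      y (enum_rank (tg u ij)) 0).
    rewrite (sig_big_dep _ _ (fun u (ij : 'I_(d u) * 'I_(d u)) => W u ij.1 ij.2 *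
      y (enum_rank (tg u ij)) 0)) /=.
    by apply: eq_bigr => -[u ij] _.
  apply: eq_bigr => u _.
  transitivity (\sum_i \sum_j W u i j * y (enum_rank (tg u (i, j))) 0).
    by rewrite pair_bigA; apply: eq_bigr => -[i j] _.
  rewrite exchange_big; apply: eq_bigr => j _; rewrite mxE.
  by apply: eq_bigr => i _; rewrite mxE mulrC.
have [r [h [_ span_h]]] := span_family (fun a => co (th^~ a)).
set H := \matrix_(i < r) _ in span_h.
have {}span_h a : (co (th^~ a) <= H)%MS := span_h a.
have fullH : row_full H.
  rewrite -sub1mx submxE mul1mx; apply/eqP/matrixP => k l.
  pose y := col l (cokermx H); rewrite [RHS]mxE.
  have y0 a : (co (th^~ a) *m y) 0 0 = 0.
    have := span_h a; rewrite submxE => /eqP Ha.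
    by rewrite /y colE mulmxA Ha mul0mx mxE.
  have unr s t (S : 'M_(d s, d t)) : s != t -> intertwiner (th s) (th t) S -> S = 0.
    move=> nst fS; apply/eqP; apply: contraT => nzS.
    by case/eqP: nst; apply: unrel; exists S.
  have rel0 a := etrans (esym (coE (th^~ a) y)) (y0 a).
  have C0 := matrix_coef_indep th_rep th_cyc unr rel0.
  case: (enum_val k) (enum_valK k) => u [i j] kE.
  have := congr1 (fun M : 'M_(d u) => M j i) (C0 u).
  by rewrite !mxE -kE.
have /submxP [c cE] : (co Z <= H)%MS by rewrite submx_full.
have [b bE] : exists b, rho b = \sum_i c 0 i *: rho (h i).
  elim/big_ind: _ => [|B1 B2 [b1 <-] [b2 <-]|i _]; last exact: scale.
    by exists 0; rewrite (ring_rep0 rho_rep).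
  by exists (b1 + b2); rewrite (ring_repD rho_rep).
exists b => u; apply/matrixP => i j.
have thb : th u b = \sum_i c 0 i *: th u (h i).
  rewrite thE bE mulmx_sumr mulmx_suml; apply: eq_bigr => k _.
  by rewrite -scalemxAr -scalemxAl -thE.
have := congr1 (fun v : 'rV_#|T| => v 0
  (enum_rank (tg u (i, j)))) cE.
rewrite mxE enum_rankK /= => ->; rewrite thb summxE mxE; apply: eq_bigr => k _.
by rewrite !mxE enum_rankK.
Qed.

End Surjectivity.

(** * The semisimple quotient *)

Section SemisimpleQuotient.
Variables (F : fieldType) (K : closedFieldType) (iota : {rmorphism F -> K}).
Variables (A : algType F) (n : nat) (rho : A -> 'M[K]_n).

(* [P] is the characteristic if [F] is finite, and 1 otherwise. The [th u] are *)
(* the projections of [A] on the simple components of its semisimple quotient, *)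
(* and the irreducible subquotients of [rho] are the twists of the [th u] by   *)
(* [P ^ t] for [t < k u].                                                      *)
Record semisimple_quotient (P c : nat) (d : 'I_c -> nat)
    (E : 'I_c -> {pred K}) (k : 'I_c -> nat) (th : forall u, A -> 'M[K]_(d u))
    : Prop := SemisimpleQuotient {
  sq_exp : add_exp K P;
  sq_cases : [/\ P = 1%N, forall u, k u = 1%N
               & forall x a, exists b, rho b = x *: rho a] \/ P \in [pchar K];
  sq_pow : forall t, (forall x : F, iota x ^+ (P ^ t) = iota x) ->
    exists t', (P ^ t = qcard F ^ t')%N;
  sq_deg : forall u, (0 < d u)%N;
  sq_rep : forall u, ring_rep (th u);
  sq_lin : forall u x a, th u (x *: a) = iota x *: th u a;
  sq_block : exists (X : forall u, 'M[K]_(d u, n)) (Y : forall u, 'M[K]_(n, d u)),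
    forall u a, th u a = X u *m rho a *m Y u;
  sq_field : forall u, subfield_finite_or_full iota (E u);
  sq_over : forall u a, th u a \is a mxOver (E u);
  sq_surj : forall Z : (forall u, 'M[K]_(d u)),
    (forall u, Z u \is a mxOver (E u)) -> exists a, forall u, th u a = Z u;
  sq_period : forall u, (0 < k u)%N;
  sq_fix : forall u x, x ^+ (P ^ k u) = x -> x \in E u;
  sq_root : forall u x, x \in E u -> exists2 y, y \in E u & y ^+ P = x;
  sq_factors : exists (I : finType) (dI : I -> nat)
      (X : forall i, 'M[K]_(dI i, n)) (Y : forall i, 'M[K]_(n, dI i)) (N : nat),
    [/\ forall i, ring_rep (fun a => X i *m rho a *m Y i),
        forall i, exists u t (T : 'M_(dI i, d u)), [/\ (t < k u)%N,
          row_free T, row_full T & intertwiner (fun a => X i *m rho a *m Y i)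
                                     (fun a => twist (P ^ t) (th u a)) T]
      & forall s, size s = N ->
        (forall b, b \in s -> in_span rho b /\ forall i, X i *m b *m Y i = 0) ->
        mxprod s = 0]
}.

Hypotheses (rho_rep : ring_rep rho) (rhoZ : forall x a, rho (x *: a) = iota x *: rho a).
Hypothesis rho_closed : zariski_closed (range rho).

Lemma semisimple_quotient_infinite : ~ finite_set [set: F] ->
  exists P c d E k th, @semisimple_quotient P c d E k th.
Proof.
move=> infF.
have [I [d [X [Y [N [d_gt0 rh_rep rh_cyc nilN]]]]]] := composition_factors rho_rep.
pose rh i a := X i *m rho a *m Y i.
have a1 := add_exp1 K.
have [U [covU minU]] := select_minimal a1 d_gt0 rh_cyc.
pose ev (u : 'I_#|U|) : I := enum_val u.
have lk_tw k i j : linked (rh i) (fun a => twist (1 ^ k) (rh j a)) -> linked (rh i) (rh j).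
  by apply: linked_eq => // a; rewrite exp1n twist_id.
have unrel u v : linked (rh (ev u)) (rh (ev v)) -> u = v.
  move=> lk; apply: enum_val_inj; apply: (unrelated (k := 0) (l := 0) a1 rh_cyc minU).
  - exact: enum_valP.
  - exact: enum_valP.
  - by apply: linked_eq lk => a; rewrite exp1n twist_id.
have thZ u x a : rh u (x *: a) = iota x *: rh u a.
  by rewrite /rh rhoZ -scalemxAr -scalemxAl.
have surj := surjective_scale rho_rep (fun u a => erefl (rh (ev u) a))
  (fun u => rh_rep (ev u)) (fun u => @rh_cyc (ev u))
  (infinite_closed_scale infF rho_closed rhoZ) unrel.
exists 1%N, #|U|, (fun u => d (ev u)), (fun=> (predT : {pred K})), (fun=> 1%N), (fun u => rh (ev u)).
split=> //.
- by left; split=> //; apply: infinite_closed_scale infF rho_closed rhoZ.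
- by move=> t _; exists 0%N; rewrite exp1n expn0.
- by exists (fun u => X (ev u)), (fun u => Y (ev u)).
- by move=> u; split=> //; right.
- by move=> u a; apply/mxOverP.
- by move=> u x _; exists x; rewrite // expr1.
- exists I, d, X, Y, N; split=> // i.
  have [j Uj [t lk]] := covU i.
  have {lk} [T nzT lk] := lk_tw _ _ _ lk.
  have [freeT fullT] := intertwiner_iso (@rh_cyc i) (@rh_cyc j) nzT lk.
  have jE : ev (enum_rank_in Uj j) = j by rewrite /ev enum_rankK_in.
  move: T lk freeT fullT {nzT}; rewrite -jE => T lk freeT fullT.
  exists (enum_rank_in Uj j), 0%N, T; split=> // a.
  by rewrite expn0 twist_id; apply: lk.
Qed.

Lemma fixed_field (p k : nat) : p \in [pchar K] -> (0 < k)%N ->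
  GRing.divring_closed [pred x : K | x ^+ (p ^ k) == x] /\
  finite_set [set` [pred x : K | x ^+ (p ^ k) == x]].
Proof.
move=> pK k_gt0; have [e_gt0 eD] := add_expX k (add_exp_pchar pK).
have eB (x y : K) : (x - y) ^+ (p ^ k) = x ^+ (p ^ k) - y ^+ (p ^ k).
  by apply/eqP; rewrite eq_sym subr_eq -eD subrK.
split.
  split=> [|x y|x y]; rewrite !inE ?expr1n //.
  - by move=> /eqP xE /eqP yE; rewrite eB xE yE.
  - by move=> /eqP xE /eqP yE; rewrite expr_div_n xE yE.
have e_gt1 : (1 < p ^ k)%N.
  by rewrite -(expn0 p) ltn_exp2l // prime_gt1 // (pcharf_prime pK).
have nzQ : 'X^(p ^ k) - 'X != 0 :> {poly K}.
  by rewrite -size_poly_gt0 size_polyDl ?size_polyXn // size_polyN size_polyX.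
have [r Qr] := closed_field_poly_normal ('X^(p ^ k) - 'X : {poly K}).
apply: (@sub_finite_set _ _ [set` r]%classic); last exact: finite_seq.
move=> x /= /eqP xE; have : root ('X^(p ^ k) - 'X) x.
  by rewrite rootE !hornerE xE subrr.
by rewrite Qr rootZ ?lead_coef_eq0 // root_prod_XsubC.
Qed.

Lemma semisimple_quotient_finite : finite_set [set: F] ->
  exists P c d E k th, @semisimple_quotient P c d E k th.
Proof.
move=> finF; have [p pF] := finite_field_char finF.
have pK : p \in [pchar K] by rewrite (fmorph_pchar iota).
have ap := add_exp_pchar pK.
have [I [d [X [Y [N [d_gt0 rh_rep rh_cyc nilN]]]]]] := composition_factors rho_rep.
pose rh i a := X i *m rho a *m Y i.
have [U [covU minU]] := select_minimal ap d_gt0 rh_cyc.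
pose ev (u : 'I_#|U|) : I := enum_val u.
have PF i := periodic_form pK (@rh_cyc i).
pose H i := projT1 (cid (PF i)); pose per i := projT1 (cid (projT2 (cid (PF i)))).
have HP i := projT2 (cid (projT2 (cid (PF i)))).
pose th i a := H i *m rh i a *m invmx (H i).
have uH i : H i \in unitmx by have [] := HP i.
have th_per i a : (0 < per i)%N -> twist (p ^ per i) (th i a) = th i a.
  by move=> per_gt0; have [_ ->] := HP i.
have no_link i k : (0 < k)%N -> (per i == 0)%N || (k < per i)%N ->
    ~ linked (rh i) (fun a => twist (p ^ k) (rh i a)) by have [_ _] := HP i; apply.
clearbody H per => {PF HP}.
have th_rep i : ring_rep (th i) :=
  ring_rep_conj (mulmxV (uH i)) (mulVmx (uH i)) (rh_rep i).
have th_cyc i : cyclic_rep (th i) := cyclic_rep_conj (uH i) (@rh_cyc i).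
have aX k : add_exp K (p ^ k) := add_expX k ap.
have rhk_cyc k i : cyclic_rep (fun a => twist (p ^ k) (rh i a)) :=
  cyclic_rep_twist (aX k) (@rh_cyc i).
have thk_cyc k i : cyclic_rep (fun a => twist (p ^ k) (th i a)) :=
  cyclic_rep_twist (aX k) (@th_cyc i).
have rh_th k i : linked (fun a => twist (p ^ k) (rh i a)) (fun a => twist (p ^ k) (th i a)).
  exact: (linked_twist (rh i) (th i) (aX k)).1 (linked_conj (rh i) (uH i) (d_gt0 i)).
have th_rh k i : linked (fun a => twist (p ^ k) (th i a)) (fun a => twist (p ^ k) (rh i a)).
  exact: linked_sym (@rhk_cyc k i) (@thk_cyc k i) (rh_th k i).
have th_mod i t a : twist (p ^ t) (th i a) = twist (p ^ (t %% per i)) (th i a).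
  by apply: (@twist_mod_per K I d p per (th^~ a)) => j; apply: th_per.
have link_mod i k l : (k <= l)%N ->
    linked (fun a => twist (p ^ k) (rh i a)) (fun a => twist (p ^ l) (rh i a)) ->
    k = l %[mod per i].
  move=> le_kl /(linked_twistD ap le_kl) lk.
  pose r := ((l - k) %% per i)%N.
  have {}lk := linked_trans (@rh_cyc i) (@rhk_cyc (l - k)%N i) lk (rh_th (l - k)%N i).
  have {}lk : linked (rh i) (fun a => twist (p ^ r) (th i a)).
    by apply: linked_eq lk => // a; rewrite th_mod.
  have {}lk := linked_trans (@rh_cyc i) (@thk_cyc r i) lk (th_rh r i).
  apply/eqP; rewrite eq_sym eqn_mod_dvd // /dvdn; apply: contraT.
  rewrite -lt0n -/r => r_gt0; exfalso; apply: (no_link i r r_gt0 _ lk).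
  by rewrite /r; case: (per i) => // q; rewrite ltn_mod.
have unrel u v k l : linked (fun a => twist (p ^ k) (th (ev u) a))
      (fun a => twist (p ^ l) (th (ev v) a)) ->
    u = v /\ k = l %[mod per (ev u)].
  move=> lk.
  have {}lk := linked_trans (@rhk_cyc k (ev u)) (@thk_cyc k (ev u)) (rh_th k (ev u)) lk.
  have {}lk := linked_trans (@rhk_cyc k (ev u)) (@thk_cyc l (ev v)) lk (th_rh l (ev v)).
  have euv : u = v.
    apply: enum_val_inj; apply: (unrelated (k := k) (l := l) ap rh_cyc minU _ _ lk).
      exact: enum_valP.
    exact: enum_valP.
  split=> //; move: lk; rewrite -euv => lk.
  case: (leqP k l) => [le_kl | /ltnW le_lk]; first exact: link_mod.
  by apply/esym/link_mod => //; apply: linked_sym lk.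
have covU' i : exists jt : I * nat, jt.1 \in U /\
    linked (rh i) (fun a => twist (p ^ jt.2) (rh jt.1 a)).
  by have [j Uj [t lk]] := covU i; exists (j, t).
have [jt jtP] := choice covU'.
(* [k i] bounds the twists needed for the composition factors: it is the period or, failing that,
   one more than the largest exponent that occurs. *)
pose k i := if per i == 0%N then (\max_i (jt i).2).+1 else per i.
pose E i : {pred K} := if per i == 0%N then predT else
  [pred x : K | x ^+ (p ^ per i) == x].
have overE i (Z : 'M_(d i)) : Z \is a mxOver (E i) <->
    ((0 < per i)%N -> twist (p ^ per i) Z = Z).
  rewrite /E; have [e0|nz] := eqVneq (per i) 0%N.
    by split=> _; [rewrite e0 | apply/mxOverP].
  rewrite lt0n nz; split=> [/mxOverP ZE _|ZE].
    by apply/matrixP => x y; rewrite mxE; apply/eqP/ZE.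
  apply/mxOverP => x y; rewrite inE; apply/eqP.
  by have /matrixP/(_ x y) := ZE isT; rewrite mxE.
exists p, #|U|, (fun u => d (ev u)), (fun u => E (ev u)), (fun u => k (ev u)),
  (fun u => th (ev u)).
have thZ i x a : th i (x *: a) = iota x *: th i a.
  by rewrite /th /rh rhoZ -!(scalemxAr, scalemxAl).
split=> //.
- by right.
- move=> t fixF; apply: pow_fix_qcard => // x.
  by apply: (fmorph_inj iota); rewrite rmorphXn.
- exists (fun u => H (ev u) *m X (ev u)), (fun u => Y (ev u) *m invmx (H (ev u))).
  by move=> u a; rewrite /th /rh !mulmxA.
- move=> u; rewrite /E; have [e0|nz] := eqVneq (per (ev u)) 0%N.
    by split=> //; right.
  have per_gt0 : (0 < per (ev u))%N by rewrite lt0n.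
  have [divE finE] := fixed_field pK per_gt0.
  split=> //; last by left.
  move=> x; rewrite inE; apply/eqP; have := th_per (ev u) (x *: 1) per_gt0.
  rewrite thZ (ring_rep1 (th_rep _)) scalemx1 (twist_scalar (aX _)).
  move/matrixP/(_ (Ordinal (d_gt0 _)) (Ordinal (d_gt0 _))).
  by rewrite !mxE eqxx !mulr1n.
- by move=> u a; apply/overE/th_per.
- move=> Z ZE.
  apply: (@surjective_pchar _ _ _ _ rho_rep rho_closed _ _ _
    (fun u => H (ev u) *m X (ev u)) (fun u => Y (ev u) *m invmx (H (ev u)))
    _ _ _ p pK (fun u => per (ev u))) => //.
  + by move=> u a; rewrite /th /rh !mulmxA.
  + by move=> u a; apply: th_per.
  + by move=> u; apply/overE.
- by move=> u; rewrite /k; case: eqVneq => //; rewrite lt0n.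
- move=> u x; rewrite /k /E; case: eqVneq => // _ xE.
  by rewrite inE xE.
- move=> u x; rewrite /E; case: eqVneq => [_ _|nz].
    by have [y yE] := exp_root x ap; exists y.
  rewrite inE => /eqP xE; exists (x ^+ (p ^ (per (ev u)).-1)).
    by rewrite inE -exprM mulnC exprM xE.
  by rewrite -exprM -expnSr prednK ?lt0n.
- exists I, d, X, Y, N; split=> // i.
  have [Uj lk] := jtP i; set j := (jt i).1 in Uj lk.
  have {}lk := linked_trans (@rh_cyc i) (@rhk_cyc (jt i).2 j) lk (rh_th (jt i).2 j).
  have {lk} [t ltk [T nzT lk]] : exists2 t, (t < k j)%N &
      linked (rh i) (fun a => twist (p ^ t) (th j a)).
    rewrite /k; have [e0|nz] := eqVneq (per j) 0%N.
      by exists (jt i).2 => //; rewrite ltnS (leq_bigmax i).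
    exists ((jt i).2 %% per j)%N; first by rewrite ltn_mod lt0n.
    by apply: linked_eq lk => // a; rewrite -th_mod.
  have [freeT fullT] := intertwiner_iso (@rh_cyc i) (@thk_cyc t j) nzT lk.
  have jE : ev (enum_rank_in Uj j) = j by rewrite /ev enum_rankK_in.
  move: T lk freeT fullT ltk {nzT}; rewrite -jE => T lk freeT fullT ltk.
  by exists (enum_rank_in Uj j), t, T.
Qed.

End SemisimpleQuotient.

(** * The radical *)

Lemma geometric_sum (R : pzRingType) (x : R) n :
  (\sum_(i < n) x ^+ i) * (x - 1) = x ^+ n - 1.
Proof.
elim: n => [|n IH]; first by rewrite big_ord0 mul0r expr0 subrr.
by rewrite big_ord_recr /= mulrDl IH mulrBr mulr1 -exprSr addrC addrA subrK.
Qed.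

Section Radical.
Variables (F : fieldType) (K : closedFieldType) (iota : {rmorphism F -> K}).
Variables (A : algType F) (n : nat) (rho : A -> 'M[K]_n).
Hypotheses (rho_rep : ring_rep rho) (rho_inj : injective rho).
Variables (P c : nat) (d : 'I_c -> nat) (E : 'I_c -> {pred K}) (k : 'I_c -> nat).
Variables (th : forall u, A -> 'M[K]_(d u)).
Hypothesis sq : semisimple_quotient iota rho P E k th.

Let th_rep := sq_rep sq.

Definition rad (a : A) : Prop := forall u, th u a = 0.

Lemma radD a b : rad a -> rad b -> rad (a + b).
Proof. by move=> ra rb u; rewrite (ring_repD (th_rep u)) ra rb addr0. Qed.

Lemma radMl a b : rad b -> rad (a * b).
Proof. by move=> rb u; rewrite (ring_repM (th_rep u)) rb mulmx0. Qed.

Lemma radMr a b : rad a -> rad (a * b).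
Proof. by move=> ra u; rewrite (ring_repM (th_rep u)) ra mul0mx. Qed.

Lemma rad_eq a b : (forall u, th u a = th u b) -> rad (a - b).
Proof. by move=> ab u; rewrite (ring_repB _ _ (th_rep u)) ab subrr. Qed.

(** The irreducible subquotients are isomorphic to twists of the [th u], so elements of [rad] vanish
    on all of them. *)
Lemma rad_nilpotent : exists N, forall s : seq A, size s = N ->
  (forall a, a \in s -> rad a) -> \prod_(a <- s) a = 0.
Proof.
have [I [dI [X [Y [N [_ factors nilN]]]]]] := sq_factors sq.
exists N => s szs rs; apply: rho_inj; rewrite (ring_rep0 rho_rep).
transitivity (mxprod [seq rho a | a <- s]).
  elim: s {szs rs} => [|a s IH]; first by rewrite big_nil (ring_rep1 rho_rep).
  by rewrite big_cons (ring_repM rho_rep) IH.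
apply: nilN; first by rewrite size_map.
move=> _ /mapP [a sa ->]; split; first exact: in_span_rep.
move=> i; have [u [t [T [_ freeT _ fT]]]] := factors i.
have := fT a; rewrite (rs a sa) twist0 ?mulmx0; last first.
  exact: add_expX (sq_exp sq).
by move/eqP; rewrite mulmx_free_eq0 // => /eqP.
Qed.

(** The elements whose image under [th u] has zero [j]-th column form a maximal left ideal, and
    [rad] is the intersection of these. Conversely [rad] is nilpotent, so [1 - b * a] has a left
    inverse and lies in no proper left ideal. *)
Lemma rad_jacobson a : jacobson A a <-> rad a.
Proof.
split=> [Ja u | ra M [[M0 MD MM] nMT maxM]].
  apply/matrixP => i j; rewrite [RHS]mxE.
  pose I : set A := [set x | col j (th u x) = 0]%classic.
  suff maxI : maximal_left_ideal I.
    have /(congr1 (fun v : 'cV_(d u) => v i 0)) : col j (th u a) = 0 := Ja I maxI.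
    by rewrite !mxE.
  have colM x y : col j (th u (x * y)) = th u x *m col j (th u y).
    by rewrite (ring_repM (th_rep u)) !colE mulmxA.
  split.
  - split=> [|x y Ix Iy|x y Iy].
    + by rewrite /I /= (ring_rep0 (th_rep u)) linear0.
    + by rewrite /I /= (ring_repD (th_rep u)) linearD /= Ix Iy addr0.
    + by rewrite /I /= colM Iy mulmx0.
  - move=> IT; have : I 1 by rewrite IT.
    rewrite /I /= (ring_rep1 (th_rep u)) => /(congr1 (fun v : 'cV_(d u) => v j 0)).
    by rewrite !mxE eqxx => /eqP; rewrite oner_eq0.
  move=> I' [I'0 I'D I'M] sII'.
  case: (pselect (I' `<=` I)%classic) => [sI'I | /existsNP [x /not_implyP [I'x nIx]]].
    by left; apply/seteqP.
  right; have I'1 : I' 1; last first.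
    by apply/seteqP; split=> // y _; rewrite -[y]mulr1; apply: I'M.
  have [l nzw] : exists l, th u x l j != 0.
    apply/not_existsP => x0; apply: nIx; apply/matrixP => l q.
    by rewrite !mxE; apply/eqP/negPn/negP/x0.
  have [[E1 EB EV] _ _] := sq_field sq u.
  have E0 v : 0 \in E v.
    by have [[Ev1 EvB _] _ _] := sq_field sq v; rewrite -(subrr 1) EvB.
  have Ew : th u x l j \in E u by have /mxOverP := sq_over sq u x; apply.
  (* Multiplication by a lift [b] of this matrix turns column [j] of [x] into the [j]-th basis
     vector, so that [1 - b * x] lies in [I]. *)
  pose Z v : 'M[K]_(d v) := \matrix_(r, s)
    if (v == u) && (val r == val j) && (val s == val l) then (th u x l j)^-1 else 0.
  have [v|b bZ] := sq_surj sq (Z := Z).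
    apply/mxOverP => r s; rewrite mxE; case: ifP => // /andP[/andP[/eqP euv _] _].
    by rewrite euv -[_^-1]mul1r EV.
  have I'bx : I' (b * x) by apply: I'M.
  have : I (1 - b * x).
    rewrite /I /= (ring_repB _ _ (th_rep u)) linearB /= colM bZ (ring_rep1 (th_rep u)).
    apply/matrixP => r s; rewrite !mxE (bigD1 l) //= big1 => [|q nql].
      rewrite !mxE !eqxx /= andbT val_eqE addr0; case: (r =P j) => _.
        by rewrite mulVf // subrr.
      by rewrite mul0r subr0.
    by rewrite !mxE eqxx /= [val q == _]val_eqE (negPf nql) andbF mul0r.
  by move=> /sII' /I'D /(_ I'bx); rewrite subrK.
apply: contrapT => nMa; have [N nilN] := rad_nilpotent.
pose I : set A := [set x | exists y b, M y /\ x = y + b * a]%classic.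
have I_ideal : left_ideal I.
  split=> [|x y [x' [b [Mx ->]]] [y' [b' [My ->]]]|x y [y' [b [My ->]]]].
  - by exists 0, 0; rewrite mul0r addr0.
  - exists (x' + y'), (b + b'); split; first exact: MD.
    by rewrite mulrDl addrACA.
  - exists (x * y'), (x * b); split; first exact: MM.
    by rewrite mulrDr mulrA.
have sMI : (M `<=` I)%classic by move=> x Mx; exists x, 0; rewrite mul0r addr0.
have Ia : I a by exists 0, 1; rewrite mul1r add0r.
case: (maxM _ I_ideal sMI) => [IM|IT]; first by apply: nMa; rewrite -IM.
have : I 1 by rewrite IT.
move=> [y [b [My e1]]]; apply: nMT; apply/seteqP; split=> // z _.
have yE : y = 1 - b * a by rewrite e1 addrK.
have bN : (b * a) ^+ N = 0.
  rewrite -(nilN (nseq N (b * a))) ?size_nseq //.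
    by rewrite big_nseq -Monoid.iteropE.
  by move=> x /nseqP [-> _]; apply: radMl.
have M1 : M 1.
  rewrite -[1](opprK 1) -[X in - X]add0r -bN -geometric_sum -mulrN opprB -yE.
  exact: MM.
by rewrite -[z]mulr1; apply: MM.
Qed.

Lemma jacobson_rad : jacobson A = rad.
Proof. by apply/seteqP; split=> a /rad_jacobson. Qed.

Lemma ideal_pow_rad0 l : ideal_pow rad l 0.
Proof. by case: l => // l; exists [::]; rewrite ?big_nil. Qed.

Lemma ideal_pow_radMr l a x : ideal_pow rad l a -> ideal_pow rad l (a * x).
Proof.
case: l => // l [s sP ->]; exists [seq (p.1, p.2 * x) | p <- s].
  by move=> _ /mapP [p /sP [p1 p2] ->]; split=> //=; apply: radMr.
by rewrite big_map mulr_suml; apply: eq_bigr => p _ /=; rewrite mulrA.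
Qed.

Lemma ideal_pow_radS l a b : ideal_pow rad l a -> rad b ->
  ideal_pow rad l.+1 (a * b).
Proof.
move=> la rb; exists [:: (a, b)]; last by rewrite big_seq1.
by move=> p; rewrite inE => /eqP ->.
Qed.

Lemma rad_nilpotency_index : exists m, nilpotency_index (jacobson A) m.
Proof.
rewrite jacobson_rad; have [N nilN] := rad_nilpotent.
have powN : ideal_pow rad N = [set 0]%classic.
  apply/seteqP; split=> [a Na|_ ->]; last exact: ideal_pow_rad0.
  suff powP l b s : (l <= N)%N -> size s = (N - l)%N -> (forall x, x \in s -> rad x) ->
      ideal_pow rad l b -> b * \prod_(x <- s) x = 0.
    by have := powP N a [::]; rewrite big_nil mulr1; apply; rewrite ?subnn.
  elim: l b s => [|l IH] b s leN szs rs.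
    by rewrite nilN ?mulr0 // szs subn0.
  move=> [t tP ->]; rewrite mulr_suml big1_seq // => p /= tp.
  have [p1 p2] := tP p tp.
  have -> : p.1 * p.2 * \prod_(x <- s) x = p.1 * \prod_(x <- p.2 :: s) x.
    by rewrite big_cons mulrA.
  apply: IH => //.
  - exact: ltnW.
  - by rewrite /= szs subnSK.
  - by move=> x; rewrite inE => /predU1P [->|/rs].
pose Q m := `[< ideal_pow rad m = [set 0]%classic >].
have exQ : exists m, Q m by exists N; apply/asboolP.
case: (ex_minnP exQ) => m /asboolP Qm minm; exists m.
have m_gt0 : (0 < m)%N.
  case: m Qm {minm} => // pow0; have : [set 0 : A]%classic 1 by rewrite -pow0.
  by move=> /eqP; rewrite oner_eq0.
split=> // powm1; have : (m <= m.-1)%N by apply: minm; apply/asboolP.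
by rewrite leqNgt prednK ?leqnn.
Qed.

(** [W l] is the span of the rows of all [rho a] with [a] in the [l]-th power of the radical. *)
Lemma radical_filtration : exists W : nat -> 'M[K]_n,
  [/\ forall l a, ideal_pow rad l a -> (rho a <= W l)%MS,
      forall l b, in_span rho b -> (W l *m b <= W l)%MS,
      forall l a, rad a -> (W l *m rho a <= W l.+1)%MS
    & forall l, ideal_pow rad l = [set 0]%classic -> W l = 0].
Proof.
have exW l : exists W : 'M[K]_n,
    (forall a, ideal_pow rad l a -> (rho a <= W)%MS) /\
    forall r (U : 'M_(n, r)), (forall a, ideal_pow rad l a -> rho a *m U = 0) ->
      W *m U = 0.
  pose v (z : {a | ideal_pow rad l a} * 'I_n) := row z.2 (rho (projT1 z.1)).
  have [r [h [_ span_h]]] := span_family v.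
  exists <<\matrix_(i < r) v (h i)>>%MS; split.
    move=> a la; rewrite genmxE; apply/row_subP => i.
    exact: (span_h (exist _ a la, i)).
  move=> q U UP; apply/eqP; rewrite -sub_kermx genmxE sub_kermx.
  apply/eqP/row_matrixP => i; rewrite row_mul rowK /v -row_mul linear0.
  by rewrite (UP _ (projT2 (h i).1)) linear0.
have [W WP] := choice exW; exists W; split.
- by move=> l; case: (WP l).
- move=> l b sb; have [aW Wmin] := WP l.
  rewrite submxE -mulmxA; apply/eqP/Wmin => a la; rewrite mulmxA.
  apply: (in_span_eq sb) => x; rewrite -(ring_repM rho_rep); apply/eqP.
  by rewrite -submxE aW //; apply: ideal_pow_radMr.
- move=> l a ra; have [_ Wmin] := WP l; have [aW _] := WP l.+1.
  rewrite submxE -mulmxA; apply/eqP/Wmin => b lb; rewrite mulmxA -(ring_repM rho_rep).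
  by apply/eqP; rewrite -submxE aW //; apply: ideal_pow_radS.
- move=> l l0; have [_ Wmin] := WP l; rewrite -[LHS]mulmx1; apply: Wmin => a.
  by rewrite l0 => ->; rewrite (ring_rep0 rho_rep) mul0mx.
Qed.

End Radical.

(** * Lifting matrix units and tori *)

Section MatrixUnits.
Variables (F : fieldType) (K : closedFieldType) (iota : {rmorphism F -> K}).
Variables (A : algType F) (n : nat) (rho : A -> 'M[K]_n).
Hypotheses (rho_rep : ring_rep rho) (rho_inj : injective rho).
Variables (P c : nat) (d : 'I_c -> nat) (E : 'I_c -> {pred K}) (k : 'I_c -> nat).
Variables (th : forall u, A -> 'M[K]_(d u)).
Hypothesis sq : semisimple_quotient iota rho P E k th.

Let th_rep := sq_rep sq.
Let th0 u := ring_rep0 (th_rep u).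
Let th1 u := ring_rep1 (th_rep u).
Let thM u := ring_repM (th_rep u).
Let thB u a b := ring_repB a b (th_rep u).
Let rad := rad th.

Lemma rad_expn : exists2 N, (0 < N)%N & forall x, rad x -> x ^+ N = 0.
Proof.
have [N nilN] := rad_nilpotent rho_rep rho_inj sq; exists N.+1 => // x rx.
have xN : x ^+ N = 0.
  rewrite -(nilN (nseq N x)) ?size_nseq //.
    by rewrite big_nseq -Monoid.iteropE.
  by move=> y /nseqP [-> _].
by rewrite exprS xN mulr0.
Qed.

Lemma idempotent_rad e : e * e = e -> rad e -> e = 0.
Proof.
move=> ee re; have [[|N] // _ nilN] := rad_expn.
rewrite -(nilN e re); elim: N {nilN} => [|N IH]; first by rewrite expr1.
by rewrite exprS -IH ee.
Qed.

Lemma rad_idemX a N : rad (a * a - a) -> rad (a ^+ N.+1 - a).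
Proof.
move=> ra; elim: N => [|N IH]; first by rewrite expr1 subrr => u; rewrite th0.
have -> : a ^+ N.+2 - a = (a ^+ N.+1 - a) * a + (a * a - a).
  by rewrite exprSr mulrBl addrA subrK.
by apply: (radD sq) => //; apply: (radMr sq).
Qed.

(** If [N] is an exponent killing the radical elements, take [1 - (1 - a ^ N) ^ N]: it is a multiple
    of [a ^ N], its complement is a multiple of [(1 - a) ^ N], and [(a * (1 - a)) ^ N = 0]. *)
Lemma lift_idempotent a : rad (a * a - a) -> exists2 e, e * e = e & rad (e - a).
Proof.
move=> ra; have [[|N] // _ nilN] := rad_expn.
pose b := a ^+ N.+1; pose e := 1 - (1 - b) ^+ N.+1.
have radE x y : rad (x - y) -> forall u, th u x = th u y.
  by move=> rxy u; apply/eqP; rewrite -subr_eq0 -thB rxy.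
have bE u : th u b = th u a := radE _ _ (rad_idemX N ra) u.
have aE u : th u a *m th u a = th u a by rewrite -thM (radE _ _ ra).
have zE u : th u ((1 - b) ^+ N.+1) = th u (1 - b).
  apply: radE; apply: rad_idemX => v; rewrite thB thM thB th1 bE.
  by rewrite mulmxBl mul1mx mulmxBr mulmx1 aE subrr subr0 subrr.
exists e; last first.
  by apply: (rad_eq sq) => u; rewrite /e thB zE thB opprB addrC subrK bE.
apply/eqP; rewrite -subr_eq0 -{3}[e]mulr1 -mulrBr; apply/eqP.
pose g := \sum_(i < N.+1) (1 - b) ^+ i; pose h := \sum_(i < N.+1) a ^+ i.
have eE : e = g * b.
  have := geometric_sum (1 - b) N.+1; rewrite -/g addrAC subrr add0r mulrN.
  by move/(congr1 -%R); rewrite opprK opprB => ->.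
have b1E : 1 - b = h * (1 - a).
  have := geometric_sum a N.+1; rewrite -/h -/b.
  by move/(congr1 -%R); rewrite opprB -mulrN opprB => ->.
have ah : GRing.comm a h.
  by apply: commr_sum => i _; apply: commrX; apply: commr_refl.
have hy : GRing.comm h (1 - a).
  by apply: commrB; [apply: commr1 | apply: commr_sym].
have ay : GRing.comm a (1 - a) by apply: commrB; [apply: commr1 | apply: commr_refl].
have bh : GRing.comm b (h ^+ N.+1).
  by apply/commrX/commr_sym/commrX/commr_sym.
have -> : e - 1 = - (1 - b) ^+ N.+1 by rewrite /e addrAC subrr add0r.
rewrite mulrN b1E exprMn_comm // {1}eE -mulrA [b * _]mulrA bh -!mulrA.
rewrite /b -exprMn_comm // (nilN (a * (1 - a))) ?mulr0 ?oppr0 //.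
by rewrite mulrBr mulr1 -opprB => u; rewrite (ring_repN _ (th_rep u)) ra oppr0.
Qed.

Lemma sq_mem0 u : 0 \in E u.
Proof.
by have [[E1 EB _] _ _] := sq_field sq u; rewrite -(subrr 1) EB.
Qed.

Lemma sq_mem1 u : 1 \in E u.
Proof. by have [[]] := sq_field sq u. Qed.

Lemma lift_component u (B : 'M[K]_(d u)) : B \is a mxOver (E u) ->
  exists a, th u a = B /\ forall v, v != u -> th v a = 0.
Proof.
move=> EB; pose Z v : 'M[K]_(d v) :=
  if u =P v is ReflectT e then eq_rect u (fun v => 'M[K]_(d v)) B v e else 0.
have Zu : Z u = B by rewrite /Z; case: (u =P u) => // e; rewrite eq_axiomK.
have Z0 v : v != u -> Z v = 0.
  by move=> nvu; rewrite /Z; case: (u =P v) => // euv; rewrite euv eqxx in nvu.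
have [v|a aZ] := sq_surj sq (Z := Z).
  have [->|nvu] := eqVneq v u; first by rewrite Zu.
  by rewrite (Z0 v nvu); apply/mxOverP => i j; rewrite mxE sq_mem0.
by exists a; split=> [|v nvu]; [exact: etrans (aZ u) Zu
  | exact: etrans (aZ v) (Z0 v nvu)].
Qed.

Lemma delta_mxOver u i j : (delta_mx i j : 'M[K]_(d u)) \is a mxOver (E u).
Proof.
by apply/mxOverP => r s; rewrite mxE; case: (_ && _);
  rewrite ?mulr1n ?mulr0n ?sq_mem1 ?sq_mem0.
Qed.

Definition ord_first u : 'I_(d u) := Ordinal (sq_deg sq u).

Lemma lift_corner u : exists e, [/\ e * e = e,
  th u e = delta_mx (ord_first u) (ord_first u) & forall v, v != u -> th v e = 0].
Proof.
have [a [au av]] := lift_component (delta_mxOver (ord_first u) (ord_first u)).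
have [|e ee rea] := @lift_idempotent a.
  move=> v; rewrite thB thM; have [->|nvu] := eqVneq v u.
    by rewrite au mul_delta_mx subrr.
  by rewrite av // mul0mx subrr.
have ea v : th v e = th v a by apply/eqP; rewrite -subr_eq0 -thB rea.
by exists e; split=> // [|v nvu]; rewrite ea ?au ?av.
Qed.

Section Units.
Variable eps : 'I_c -> A.
Hypotheses (eps_idem : forall u, eps u * eps u = eps u)
  (eps_th : forall u, th u (eps u) = delta_mx (ord_first u) (ord_first u))
  (eps_th0 : forall u v, v != u -> th v (eps u) = 0).

Let T : finType := {u : 'I_c & 'I_(d u)}.
Let tg v (i : 'I_(d v)) : T := existT (fun v => 'I_(d v)) v i.

(** [al z] and [be z] lift the first row and the first column of matrix units; within one component,
    the products [be z * al y] are then matrix units of [A]. *)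
Record corner_units (s : seq T) (al be : T -> A) : Prop := CornerUnits {
  cu_al : forall z, z \in s -> eps (tag z) * al z = al z;
  cu_be : forall z, z \in s -> be z * eps (tag z) = be z;
  cu_albe : forall z y, z \in s -> y \in s ->
    al z * be y = if z == y then eps (tag z) else 0;
  cu_al_th : forall z, z \in s ->
    th (tag z) (al z) = delta_mx (ord_first (tag z)) (tagged z);
  cu_be_th : forall z, z \in s ->
    th (tag z) (be z) = delta_mx (tagged z) (ord_first (tag z));
  cu_al_th0 : forall z v, z \in s -> v != tag z -> th v (al z) = 0;
  cu_be_th0 : forall z v, z \in s -> v != tag z -> th v (be z) = 0
}.

(** The new units are cut out by [f], the complement of the units already built. Their product is
    [eps u] up to a nilpotent of the corner, and a geometric series makes it exact. *)
Lemma corner_units_cons z s al be : z \notin s -> uniq s ->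
  corner_units s al be -> exists al' be', corner_units (z :: s) al' be'.
Proof.
move=> nzs us cu; set u := tag z; set i := tagged z; set o := ord_first u.
pose f := 1 - \sum_(y <- s) be y * al y.
have thf y : y \in s -> tag y = u -> 
  delta_mx o i *m th u (be y * al y) = 0 /\ th u (be y * al y) *m delta_mx i o = 0.
  case: y => v j sy /= evu; move: j sy; rewrite evu => j sy.
  have nji : j != i.
    by apply: contraNneq nzs => eji; move: sy; rewrite eji /i /u; case: (z).
  have := cu_al_th cu sy; have := cu_be_th cu sy => /= be_th al_th.
  rewrite thM al_th be_th mul_delta_mx !mul_delta_mx_cond.
  by rewrite [i == j]eq_sym (negPf nji) !mulr0n.
have thf0 y : y \in s -> tag y != u -> th u (be y * al y) = 0.
  by move=> sy nyu; rewrite thM (cu_be_th0 cu sy) ?mul0mx // eq_sym.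
have oif : delta_mx o i *m th u f = delta_mx o i.
  rewrite thB th1 mulmxBr mulmx1 (ring_rep_sum _ _ _ (th_rep u)) mulmx_sumr.
  rewrite big1_seq ?subr0 // => y /= sy; have [eyu|nyu] := eqVneq (tag y) u.
    by case: (thf y sy eyu).
  by rewrite thf0 // mulmx0.
have fio : th u f *m delta_mx i o = delta_mx i o.
  rewrite thB th1 mulmxBl mul1mx (ring_rep_sum _ _ _ (th_rep u)) mulmx_suml.
  rewrite big1_seq ?subr0 // => y /= sy; have [eyu|nyu] := eqVneq (tag y) u.
    by case: (thf y sy eyu).
  by rewrite thf0 // mul0mx.
have al_f y : y \in s -> al y * f = 0.
  move=> sy; rewrite mulrBr mulr1 mulr_sumr (bigD1_seq y) //= mulrA (cu_albe cu) //.
  rewrite eqxx (cu_al cu) // big1_seq ?addr0 ?subrr // => x /andP[nxy sx].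
  by rewrite mulrA (cu_albe cu) // eq_sym (negPf nxy) mul0r.
have f_be y : y \in s -> f * be y = 0.
  move=> sy; rewrite mulrBl mul1r mulr_suml (bigD1_seq y) //= -mulrA (cu_albe cu) //.
  rewrite eqxx (cu_be cu) // big1_seq ?addr0 ?subrr // => x /andP[nxy sx].
  by rewrite -mulrA (cu_albe cu) // (negPf nxy) mulr0.
have [a0 [a0u _]] := lift_component (delta_mxOver o i).
have [b0 [b0u _]] := lift_component (delta_mxOver i o).
pose a := eps u * a0 * f; pose b := f * b0 * eps u; pose e := eps u.
have au : th u a = delta_mx o i by rewrite !thM eps_th a0u mul_delta_mx oif.
have bu : th u b = delta_mx i o by rewrite !thM eps_th b0u fio mul_delta_mx.
have av v : v != u -> th v a = 0 by move=> nvu; rewrite !thM eps_th0 // !mul0mx.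
have bv v : v != u -> th v b = 0 by move=> nvu; rewrite !thM eps_th0 // !mulmx0.
have ea : e * a = a by rewrite /a !mulrA eps_idem.
have be_ : b * e = b by rewrite /b -!mulrA eps_idem.
pose nu := a * b - e.
have rnu : rad nu.
  move=> v; rewrite thB thM; have [->|nvu] := eqVneq v u.
    by rewrite au bu mul_delta_mx eps_th subrr.
  by rewrite av // eps_th0 // mul0mx subrr.
have enu : e * nu = nu by rewrite mulrBr mulrA ea eps_idem.
have nue : nu * e = nu by rewrite mulrBl -mulrA be_ eps_idem.
have [N N_gt0 nilN] := rad_expn.
pose g := \sum_(j < N) (- nu) ^+ j.
have gnu : g * (1 + nu) = 1.
  have := geometric_sum (- nu) N; rewrite -/g exprNn (nilN _ rnu) mulr0 sub0r.
  by rewrite -opprD mulrN => /oppr_inj; rewrite addrC.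
pose c' := e * g.
have cab : c' * (a * b) = e.
  have -> : a * b = (1 + nu) * e by rewrite mulrDl mul1r nue addrC subrK.
  by rewrite /c' -mulrA [g * _]mulrA gnu mul1r eps_idem.
exists (fun y => if y == z then c' * a else al y), (fun y => if y == z then b else be y).
have neq y : y \in s -> (y == z) = false.
  by move=> sy; apply: contraNF nzs => /eqP <-.
have cau : th u (c' * a) = delta_mx o i.
  have c'o : th u c' *m delta_mx o o = delta_mx o o.
    by rewrite -[RHS](eps_th u) -/e -cab (thM u c') (thM u a) au bu mul_delta_mx.
  have -> : th u (c' * a) = th u c' *m (th u e *m th u a).
    by rewrite -(thM u e) ea -thM.
  by rewrite eps_th mulmxA c'o au mul_delta_mx.
split.
- move=> y; rewrite inE; case: eqVneq => [-> _|_ /=]; last exact: (cu_al cu).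
  by rewrite mulrA [_ * c']mulrA eps_idem.
- move=> y; rewrite inE; case: eqVneq => [-> _|_ /=]; last exact: (cu_be cu).
  by [].
- move=> y x; rewrite !inE; have [->|nyz] := eqVneq y z; have [->|nxz] := eqVneq x z => /=.
  + by rewrite ?eqxx -mulrA cab.
  + by move=> _ sx; rewrite /a -!mulrA f_be // !mulr0.
  + by move=> sy _; rewrite (negPf nyz) /b !mulrA al_f // !mul0r.
  + exact: (cu_albe cu).
- move=> y; rewrite inE; case: eqVneq => [-> _|_ /=] //; exact: (cu_al_th cu).
- move=> y; rewrite inE; case: eqVneq => [-> _|_ /=] //; exact: (cu_be_th cu).
- move=> y v; rewrite inE; case: eqVneq => [-> _ nvu|_ /=]; last exact: (cu_al_th0 cu).
  by rewrite thM av // mulmx0.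
- move=> y v; rewrite inE; case: eqVneq => [-> _ nvu|_ /=]; last exact: (cu_be_th0 cu).
  exact: bv.
Qed.

(** The sum of the [be z * al z] is an idempotent congruent to 1, so its complement is an idempotent
    of the radical, hence zero. *)
Lemma corner_units_full : exists al be : T -> A,
  corner_units (enum T) al be /\ \sum_z be z * al z = 1.
Proof.
have [al [be cu]] : exists al be, corner_units (enum T) al be.
  elim: (enum T) (enum_uniq T) => [_|z s IH /= /andP[nzs us]].
    by exists (fun=> 0), (fun=> 0).
  by have [al [be cu]] := IH us; apply: corner_units_cons cu.
exists al, be; split=> //; set e := \sum_z _.
have inT z : z \in enum T by rewrite mem_enum.
have ee : e * e = e.
  rewrite mulr_suml; apply: eq_bigr => z _; rewrite mulr_sumr (bigD1 z) //=.
  rewrite big1 ?addr0 => [|y nyz].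
    by rewrite mulrA -[be z * _ * _]mulrA (cu_albe cu) // eqxx (cu_be cu).
  rewrite mulrA -[be z * _ * _]mulrA (cu_albe cu) // eq_sym (negPf nyz).
  by rewrite mulr0 mul0r.
apply/esym/eqP; rewrite -subr_eq0; apply/eqP/idempotent_rad.
  by rewrite mulrBl mul1r mulrBr mulr1 ee subrr subr0.
move=> u; rewrite thB th1 (ring_rep_sum _ _ _ (th_rep u)); apply/eqP.
rewrite subr_eq0 eq_sym; apply/eqP.
transitivity (\sum_v \sum_(i < d v) th u (be (tg i) * al (tg i))).
  rewrite (sig_big_dep _ _ (fun v (i : 'I_(d v)) =>
    th u (be (tg i) * al (tg i)))) /=.
  by apply: eq_bigr => -[v i].
rewrite (bigD1 u) //= [X in _ + X]big1 ?addr0 => [|v nvu]; last first.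
  rewrite big1 // => i _; rewrite thM (cu_be_th0 cu) ?mul0mx //= eq_sym //.
transitivity (\sum_(i < d u) delta_mx i i : 'M[K]_(d u)).
  apply: eq_bigr => i _; rewrite thM.
  by rewrite (cu_be_th cu (inT (tg i))) (cu_al_th cu (inT (tg i)))
    mul_delta_mx.
apply/matrixP => r s; rewrite summxE !mxE (bigD1 r) //= big1 => [|i nir].
  by rewrite mxE eqxx addr0 [s == r]eq_sym.
by rewrite mxE eq_sym (negPf nir).
Qed.

End Units.
End MatrixUnits.

Lemma prim_root_exists (K : closedFieldType) M :
  (0 < M)%N -> (M%:R : K) != 0 -> exists x : K, M.-primitive_root x.
Proof.
move=> M_gt0 nzM; have [r] := closed_field_poly_normal ('X^M - 1 : {poly K}).
rewrite (monicP (monicXnsubC 1 M_gt0)) scale1r => rE.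
have szr : size r = M.
  have := congr1 (fun q : {poly K} => size q) rE.
  by rewrite size_prod_XsubC size_XnsubC // => -[].
suff /hasP [x _ px] : has M.-primitive_root r by exists x.
apply: cyclic.has_prim_root; rewrite ?szr //.
  apply/allP => x xr; rewrite /root_of_unity /= -[root _ _]/(root ('X^M - 1) x) rE.
  by rewrite root_prod_XsubC.
by rewrite -separable_prod_XsubC -rE; apply: separable_Xn_sub_1.
Qed.

Lemma expr_pcharB_comm (R : nzRingType) p (x y : R) j :
  p \in [pchar R] -> GRing.comm x y ->
  (x - y) ^+ (p ^ j) = x ^+ (p ^ j) - y ^+ (p ^ j).
Proof.
move=> pR cxy; elim: j => [|j IH]; first by rewrite expn0 !expr1.
rewrite expnSr !exprM IH -!(pFrobenius_autE pR) pFrobenius_autB_comm //.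
by apply: commrX; apply: commr_sym; apply: commrX; apply: commr_sym.
Qed.

Lemma unity_root_sum (K : fieldType) M (w z : K) :
  (M%:R : K) != 0 -> w ^+ M = 1 -> z ^+ M = 1 ->
  (M%:R)^-1 * \sum_(i < M) (w ^- i.+1 * z ^+ i.+1) = (w == z)%:R.
Proof.
move=> nzM wM zM; have nzw : w != 0.
  apply: contraNneq nzM => w0; move: wM; rewrite w0 expr0n.
  by case: M zM => // M _ /eqP; rewrite eq_sym oner_eq0.
have [<-|nwz] := eqVneq w z.
  under eq_bigr do rewrite mulVf ?expf_neq0 //.
  by rewrite sumr_const card_ord mulVf.
suff S0 : \sum_(i < M) (z / w) ^+ i = 0.
  have -> : \sum_(i < M) (w ^- i.+1 * z ^+ i.+1) = z / w * \sum_(i < M) (z / w) ^+ i.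
    by rewrite mulr_sumr; apply: eq_bigr => i _; rewrite -exprS expr_div_n mulrC.
  by rewrite S0 !mulr0.
have := geometric_sum (z / w) M; rewrite expr_div_n wM zM divr1 subrr.
move/eqP; rewrite mulf_eq0 => /orP [/eqP //|]; rewrite subr_eq0.
by rewrite -(inj_eq (mulIf nzw)) divfK // mul1r eq_sym (negPf nwz).
Qed.

(** * Roots of unity and scalars lifted to [A] *)

Section TorusLift.
Variables (F : fieldType) (K : closedFieldType) (iota : {rmorphism F -> K}).
Variables (A : algType F) (n : nat) (rho : A -> 'M[K]_n.+1).
Hypotheses (rho_rep : ring_rep rho) (rho_inj : injective rho).
Variables (p c : nat) (d : 'I_c -> nat) (E : 'I_c -> {pred K}) (k : 'I_c -> nat).
Variables (th : forall u, A -> 'M[K]_(d u)).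
Hypothesis sq : semisimple_quotient iota rho p E k th.
Hypothesis pK : p \in [pchar K].

Variables (u : 'I_c) (e : A).
Let o := ord_first sq u.
Hypotheses (ee : e * e = e) (eu : th u e = delta_mx o o)
  (ev : forall v, v != u -> th v e = 0).

Let th_rep := sq_rep sq.
Let th1 v := ring_rep1 (th_rep v).
Let thM v := ring_repM (th_rep v).
Let thB v a b := ring_repB a b (th_rep v).
Let rad := rad th.
Let M := (p ^ k u - 1)%N.
Let p_prime := pcharf_prime pK.

Let pA : p \in [pchar A].
Proof.
rewrite (pchar_lalg A) -(fmorph_pchar iota); exact: pK.
Qed.

Let M_gt0 : (0 < M)%N.
Proof.
by rewrite subn_gt0 -(expn0 p) ltn_exp2l ?(sq_period sq) // prime_gt1.
Qed.

Let MS : M.+1 = (p ^ k u)%N.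
Proof. by rewrite /M subn1 prednK // expn_gt0 prime_gt0. Qed.

Let M1 : (M%:R : K) = -1.
Proof.
have : (M.+1%:R : K) = 0.
  rewrite MS natrX (pcharf0 pK) expr0n.
  by rewrite gtn_eqF ?(sq_period sq).
by rewrite mulrSr => /eqP; rewrite addr_eq0 => /eqP.
Qed.

Let nzM : (M%:R : K) != 0.
Proof. by rewrite M1 oppr_eq0 oner_eq0. Qed.

Let corner a := e * a = a /\ a * e = a.

Let cornerM a b : corner a -> corner b -> corner (a * b).
Proof. by move=> [ea ae] [eb be]; split; rewrite ?mulrA ?ea // -mulrA be. Qed.

Let cornerX a i : corner a -> corner (a ^+ i.+1).
Proof.
move=> ca; elim: i => [|i IH]; first by rewrite expr1.
by rewrite exprS; apply: cornerM.
Qed.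

Let th_corner0 a v : corner a -> v != u -> th v a = 0.
Proof. by move=> [<- _] nvu; rewrite thM ev // mul0mx. Qed.

Let corner_lift x : x \in E u -> exists2 a, corner a & th u a = x *: delta_mx o o.
Proof.
move=> Ex; have [|a [au _]] := lift_component sq (u := u) (B := x *: delta_mx o o).
  apply/mxOverP => r s; rewrite !mxE; case: (_ && _).
    by rewrite mulr1.
  by rewrite mulr0; exact: (sq_mem0 sq).
exists (e * a * e).
  by split; rewrite ?mulrA ?ee // -mulrA ee.
by rewrite !thM au eu -scalemxAr -scalemxAl !mul_delta_mx.
Qed.

Let th_cornerX a x i : th u a = x *: delta_mx o o ->
  th u (a ^+ i.+1) = x ^+ i.+1 *: delta_mx o o.
Proof.
move=> au; elim: i => [|i IH]; first by rewrite !expr1.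
by rewrite exprS thM IH au -scalemxAl -scalemxAr mul_delta_mx scalerA -exprS.
Qed.

Let rad_corner a b : corner a -> corner b -> th u a = th u b -> rad (a - b).
Proof.
move=> ca cb ab; apply: (rad_eq sq) => v.
by have [->|nvu] := eqVneq v u; rewrite ?ab // !th_corner0.
Qed.

Let rad_pX : exists N, forall x j, (N <= j)%N -> rad x -> x ^+ (p ^ j) = 0.
Proof.
have [N N_gt0 nilN] := rad_expn rho_rep rho_inj sq.
exists N => x j leNj rx; have : (N <= p ^ j)%N.
  by apply: leq_trans leNj _; apply: ltnW; apply: ltn_expl; apply: prime_gt1.
by move=> /subnK <-; rewrite exprD nilN // mulr0.
Qed.

(** A lift [a] of [x0] satisfies [a ^ (p ^ k u) = a] up to a nilpotent commuting with [a]. A high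
    power of Frobenius, additive on commuting elements, kills this nilpotent. *)
Lemma unity_root_lift : exists x0 z,
  [/\ M.-primitive_root x0, corner z, th u z = x0 *: delta_mx o o & z ^+ M = e].
Proof.
have [x0 px0] := prim_root_exists M_gt0 nzM.
have x0M := prim_expr_order px0.
have x0fix j : x0 ^+ (p ^ (k u * j)) = x0.
  elim: j => [|j IH]; first by rewrite muln0 expn0 expr1.
  by rewrite mulnS expnD exprM -MS exprS x0M mulr1.
have Ex0 : x0 \in E u by apply: (sq_fix sq); have := x0fix 1%N; rewrite muln1.
have [a ca au] := corner_lift Ex0; have [N nilN] := rad_pX.
have pS j : exists i, (p ^ j = i.+1)%N.
  by exists (p ^ j).-1; rewrite prednK // expn_gt0 prime_gt0.
pose q := (p ^ (k u * N))%N; have [q' qE] : exists i, q = i.+1 := pS _.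
pose z := a ^+ q; exists x0, z.
have cz : corner z by rewrite /z qE; apply: cornerX.
have zu : th u z = x0 *: delta_mx o o.
  by rewrite /z qE (th_cornerX _ au) -qE /q x0fix.
have zS : z ^+ M.+1 = z.
  have cax : corner (a ^+ (p ^ k u)) by rewrite -MS; apply: cornerX.
  have rax : rad (a ^+ (p ^ k u) - a).
    apply: rad_corner => //; rewrite -MS (th_cornerX _ au) MS.
    by have := x0fix 1%N; rewrite muln1 => ->; rewrite au.
  have := nilN _ (k u * N)%N (leq_pmull _ (sq_period sq u)) rax.
  rewrite (expr_pcharB_comm _ pA); last by apply/commr_sym/commrX/commr_refl.
  move/eqP; rewrite subr_eq0 -exprM mulnC exprM -/q -/z MS => /eqP ->.
  by [].
split=> //; apply/eqP; rewrite eq_sym -subr_eq0; apply/eqP.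
have cM : corner (z ^+ M) by rewrite -(prednK M_gt0); apply: cornerX.
have zMM : z ^+ M * z ^+ M = z ^+ M.
  by rewrite -exprD -{2}(prednK M_gt0) addnS -addSn exprD zS -exprS prednK.
apply: (idempotent_rad rho_rep rho_inj sq).
  rewrite mulrBl !mulrBr ee zMM (proj1 cM) (proj2 cM) subrr subr0 //.
apply: rad_corner => //.
by rewrite -(prednK M_gt0) (th_cornerX _ zu) prednK // x0M scale1r eu.
Qed.

Section Projections.
Variables (x0 : K) (z : A).
Hypotheses (px0 : M.-primitive_root x0) (cz : corner z)
  (zu : th u z = x0 *: delta_mx o o) (zM : z ^+ M = e).

Let w t := x0 ^+ (p ^ t).
(** The projection onto the eigenspace of [rho z] with eigenvalue [w t]. It selects the [t]-th twist
    of component [u], on whose corner [z] acts as [x0 ^ (p ^ t)]. *)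
Let Pi t := M%:R^-1 *: \sum_(i < M) (w t ^- i.+1) *: rho (z ^+ i.+1).

Let wM t : w t ^+ M = 1.
Proof. by rewrite /w -exprM mulnC exprM (prim_expr_order px0) expr1n. Qed.

Let nzw t : w t != 0.
Proof.
apply: contraNneq (oner_neq0 K) => w0; rewrite -(wM t) w0 expr0n.
by rewrite gtn_eqF.
Qed.

Let w_eq t s : (t < k u)%N -> (s < k u)%N -> (w t == w s) = (t == s).
Proof.
move=> ltt lts; rewrite /w (eq_prim_root_expr px0).
have p_gt1 := prime_gt1 p_prime.
have [k1|k_gt1] := leqP (k u) 1.
  have -> : t = 0%N by lia.
  have -> : s = 0%N by lia.
  by rewrite !eqxx.
have lt_pM r : (r < k u)%N -> (p ^ r < M)%N.
  move=> ltr; apply: (@leq_ltn_trans (p ^ (k u).-1)).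
    by rewrite leq_exp2l // -ltnS prednK // ltnW.
  have k_eq : k u = (k u).-2.+2 by lia.
  rewrite /M k_eq /= !expnS; have : (0 < p ^ (k u).-2)%N by rewrite expn_gt0 ltnW.
  by move: (p ^ _)%N => q; nia.
by rewrite !modn_small ?lt_pM // eqn_exp2l.
Qed.

Let Pi_span t : in_span rho (Pi t).
Proof.
apply: in_spanZ; apply: in_span_sum => i _; apply: in_spanZ.
exact: in_span_rep.
Qed.

Let zMS : z ^+ M.+1 = z.
Proof. by rewrite exprS zM; case: cz. Qed.

Let Pi_z t : Pi t *m rho z = w t *: Pi t.
Proof.
rewrite /Pi -scalemxAl scalerA [w t * _]mulrC -scalerA; congr (_ *: _).
pose g i := (w t ^- i) *: rho (z ^+ i.+1).
transitivity (\sum_(i < M) g i.+1).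
  rewrite mulmx_suml; apply: eq_bigr => i _.
  by rewrite /g -scalemxAl -(ring_repM rho_rep) -exprSr.
transitivity (\sum_(i < M) g i); last first.
  rewrite scaler_sumr; apply: eq_bigr => i _.
  by rewrite scalerA (exprS (w t)) invfM mulrA mulfV ?mul1r.
have := erefl (\sum_(i < M.+1) g i).
rewrite {1}big_ord_recl big_ord_recr /= addrC.
have -> : g M = g 0%N by rewrite /g wM zMS expr0 expr1.
by move/addrI.
Qed.

Let Pi_zX t i : Pi t *m rho (z ^+ i.+1) = w t ^+ i.+1 *: Pi t.
Proof.
elim: i => [|i IH]; first by rewrite !expr1 Pi_z.
by rewrite exprSr (ring_repM rho_rep) mulmxA IH -scalemxAl Pi_z scalerA -exprSr.
Qed.

Let Pi_e t : Pi t *m rho e = Pi t.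
Proof. by rewrite -zM -(prednK M_gt0) Pi_zX prednK // wM scale1r. Qed.

Let e_Pi t : rho e *m Pi t = Pi t.
Proof.
rewrite /Pi -scalemxAr mulmx_sumr; congr (_ *: _); apply: eq_bigr => i _.
by rewrite -scalemxAr -(ring_repM rho_rep) (proj1 (cornerX i cz)).
Qed.

Let Pi_Pi t s : (t < k u)%N -> (s < k u)%N ->
  Pi t *m Pi s = (t == s)%:R *: Pi t.
Proof.
move=> ltt lts; rewrite {2}/Pi -scalemxAr mulmx_sumr.
under eq_bigr do rewrite -scalemxAr Pi_zX scalerA.
rewrite -scaler_suml scalerA unity_root_sum ?wM // w_eq //.
by rewrite eq_sym.
Qed.

Let block_of m (U : 'M[K]_(m, n.+1)) (V : 'M_(n.+1, m)) v s (T : 'M_(m, d v)) :=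
  intertwiner (fun a => U *m rho a *m V) (fun a => twist (p ^ s) (th v a)) T.

Let block_other m (U : 'M[K]_(m, n.+1)) V v s (T : 'M_(m, d v)) a :
  block_of U V s T -> corner a -> v != u -> U *m rho a *m V *m T = 0.
Proof.
move=> iT ca nvu; rewrite iT th_corner0 // twist0 ?mulmx0 //.
exact: add_expX s (add_exp_pchar pK).
Qed.

Let block_same m (U : 'M[K]_(m, n.+1)) V s (T : 'M_(m, d u)) a y :
  block_of U V s T -> th u a = y *: delta_mx o o ->
  U *m rho a *m V *m T = y ^+ (p ^ s) *: (T *m delta_mx o o).
Proof.
move=> iT au; have ap := add_expX s (add_exp_pchar pK).
rewrite iT au -mul_scalar_mx (twistM ap) (twist_scalar ap).
have -> : twist (p ^ s) (delta_mx o o) = delta_mx o o :> 'M[K]_(d u).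
  apply/matrixP => r r'; rewrite !mxE; case: (_ && _); rewrite ?expr1n //.
  by rewrite expr0n gtn_eqF //; case: ap.
by rewrite mul_scalar_mx -scalemxAr.
Qed.

Let block_Pi_mul m (U : 'M[K]_(m, n.+1)) V s (T : 'M_(m, d u)) t a y :
  block_of U V s T -> (s < k u)%N -> (t < k u)%N -> th u a = y *: delta_mx o o ->
  U *m (Pi t *m rho a) *m V *m T =
    ((t == s)%:R * y ^+ (p ^ s)) *: (T *m delta_mx o o).
Proof.
move=> iT lts ltt au; rewrite -w_eq // -(unity_root_sum nzM) // -mulrA mulr_suml.
rewrite -scalerA scaler_suml -scalemxAl -scalemxAr -!scalemxAl; congr (_ *: _).
rewrite mulmx_suml mulmx_sumr !mulmx_suml; apply: eq_bigr => i _.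
rewrite -scalemxAl -(ring_repM rho_rep) -scalemxAr -!scalemxAl -!mulrA -scalerA.
congr (_ *: _); rewrite (block_same (y := x0 ^+ i.+1 * y) iT).
  by rewrite exprMn -!exprM [(i.+1 * _)%N]mulnC.
by rewrite thM (th_cornerX _ zu) au -scalemxAl -scalemxAr mul_delta_mx scalerA.
Qed.

Let span_nilpotent : exists N, forall b, in_span rho b ->
  (forall m (U : 'M_(m, n.+1)) (V : 'M_(n.+1, m)) v s (T : 'M_(m, d v)),
     (s < k v)%N -> block_of U V s T -> U *m b *m V *m T = 0) ->
  b ^+ N.+1 = 0.
Proof.
have [I [dI [X [Y [N [_ factors nilN]]]]]] := sq_factors sq.
exists N => b sb b0; have : mxprod (nseq N b) = b ^+ N.
  by elim: N {nilN} => //= N ->; rewrite exprS.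
rewrite exprS => <-; rewrite (_ : mxprod _ = 0) ?mulr0 //.
apply: nilN; first by rewrite size_nseq.
move=> _ /nseqP [-> _]; split=> // i.
have [v [s [T [lts freeT _ iT]]]] := factors i.
by apply/eqP; rewrite -(mulmx_free_eq0 _ freeT); apply/eqP; apply: b0 iT.
Qed.

(** The difference is an idempotent of the span. Only twists with [t < k u] occur among the
    composition factors, so it vanishes on all of them; it is thus nilpotent, and zero. *)
Let Pi_sum : \sum_(t < k u) Pi t = rho e.
Proof.
apply/esym/eqP; rewrite -subr_eq0; apply/eqP.
set R := _ - _; have [N nilN] := span_nilpotent.
have sR : in_span rho R.
  apply: in_spanD; first exact: in_span_rep.
  rewrite -scaleN1r; apply: in_spanZ; apply: in_span_sum => t _; exact: Pi_span.
have S2 : (\sum_(t < k u) Pi t) *m (\sum_(t < k u) Pi t) = \sum_(t < k u) Pi t.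
  rewrite mulmx_suml; apply: eq_bigr => t _; rewrite mulmx_sumr (bigD1 t) //=.
  rewrite big1 ?addr0 => [|s nst]; rewrite Pi_Pi // ?eqxx ?scale1r //.
  by rewrite val_eqE eq_sym (negPf nst) scale0r.
have RR : R *m R = R.
  rewrite mulmxBl !mulmxBr S2 -(ring_repM rho_rep) ee mulmx_sumr mulmx_suml.
  under eq_bigr do rewrite e_Pi.
  under [X in _ - (X - _)]eq_bigr do rewrite Pi_e.
  by rewrite subrr subr0.
have RX i : R ^+ i.+1 = R by elim: i => [|i IH]; rewrite ?expr1 // exprS IH.
rewrite -(RX N); apply: nilN => // m U V v s T lts iT.
rewrite mulmxBr !mulmxBl mulmx_sumr !mulmx_suml.
under eq_bigr do rewrite -Pi_e.
have ce : corner e by [].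
have [evu|nvu] := eqVneq v u; last first.
  rewrite (block_other iT) // big1 ?subrr // => t _.
  rewrite /Pi -scalemxAl -scalemxAr -!scalemxAl.
  rewrite mulmx_suml mulmx_sumr !mulmx_suml big1 ?scaler0 // => i _.
  rewrite -scalemxAl -(ring_repM rho_rep) -scalemxAr -!scalemxAl.
  by rewrite (block_other iT) ?scaler0 //; apply: cornerM => //; apply: cornerX.
move: T iT lts; rewrite evu => T iT lts.
have e1 : th u e = 1 *: delta_mx o o by rewrite scale1r.
rewrite (block_same iT e1).
under eq_bigr => t _ do rewrite (block_Pi_mul iT lts (ltn_ord t) e1).
rewrite -scaler_suml -mulr_suml (bigD1 (Ordinal lts)) //= eqxx big1 ?addr0.
  by rewrite mul1r subrr.
by move=> t /negPf nts; rewrite -(val_eqE t (Ordinal lts)) /= in nts; rewrite nts.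
Qed.

Let sq_rootX x j : x \in E u -> exists2 y, y \in E u & y ^+ (p ^ j) = x.
Proof.
elim: j x => [|j IH] x Ex; first by exists x; rewrite ?expn0 ?expr1.
have [y /IH [y' Ey' y'E] yE] := sq_root sq Ex; exists y' => //.
by rewrite expnSr exprM y'E.
Qed.

(** A lift [b] of a root [y] of [x] which commutes with [z] acts on the image of [Pi t] as
    [y ^ (p ^ t)] plus a nilpotent. Raising to the power [p ^ N.+1] removes the nilpotent and
    changes [y] into [x]. *)
Let torus_lift x : x \in E u -> exists a,
  [/\ th u a = x *: delta_mx o o, forall v, v != u -> th v a = 0
    & forall t, (t < k u)%N -> Pi t *m rho a = x ^+ (p ^ t) *: Pi t].
Proof.
move=> Ex; have [N nilN] := span_nilpotent.
have [y Ey yx] := sq_rootX N.+1 Ex; have [a ca au] := corner_lift Ey.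
have caz i : corner (a * z ^+ i).
  by case: i => [|i]; [rewrite expr0 mulr1 | apply: cornerM => //; apply: cornerX].
(* The average of [a] over conjugation by [z], hence commuting with [z]; the sign stands for the
   inverse of [M], which is -1 in [K]. *)
pose b := - \sum_(i < M) z ^+ (M - i) * (a * z ^+ i).
have cb : corner b.
  have ct (i : 'I_M) : corner (z ^+ (M - i) * (a * z ^+ i)).
    by apply: cornerM => //; rewrite -(@prednK (M - i)) ?subn_gt0 //; apply: cornerX.
  split; rewrite /b ?mulrN ?mulNr; congr (- _).
    by rewrite mulr_sumr; apply: eq_bigr => i _; rewrite (proj1 (ct i)).
  by rewrite mulr_suml; apply: eq_bigr => i _; rewrite (proj2 (ct i)).
have bu : th u b = y *: delta_mx o o.
  rewrite /b (ring_repN _ (th_rep u)) (ring_rep_sum _ _ _ (th_rep u)).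
  rewrite (eq_bigr (fun=> y *: delta_mx o o)).
    by rewrite sumr_const card_ord -scaler_nat scalerA M1 mulN1r scaleNr opprK.
  move=> i _; have azu : th u (a * z ^+ i) = (y * x0 ^+ i) *: delta_mx o o.
    case: (nat_of_ord i) => [|j]; first by rewrite !expr0 !mulr1.
    by rewrite thM au (th_cornerX _ zu) -scalemxAl -scalemxAr mul_delta_mx scalerA.
  rewrite thM azu -(@prednK (M - i)) ?subn_gt0 // (th_cornerX _ zu).
  rewrite prednK ?subn_gt0 // -scalemxAl -scalemxAr mul_delta_mx scalerA mulrCA -exprD.
  by rewrite subnK ?(prim_expr_order px0) ?mulr1 // ltnW.
have zb : z * b = b * z.
  rewrite /b mulrN mulNr; congr (- _).
  pose g i := z ^+ (M.+1 - i) * (a * z ^+ i).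
  transitivity (\sum_(i < M) g i).
    rewrite mulr_sumr; apply: eq_bigr => i _.
    by rewrite /g subSn ?(ltnW (ltn_ord i)) // exprS !mulrA.
  transitivity (\sum_(i < M) g i.+1); last first.
    rewrite mulr_suml; apply: eq_bigr => i _.
    by rewrite /g subSS exprSr !mulrA.
  have := erefl (\sum_(i < M.+1) g i).
  rewrite {1}big_ord_recr big_ord_recl /=.
  have -> : g M = g 0%N.
    rewrite /g subSn // subnn expr1 subn0 zMS zM expr0 mulr1.
    by case: ca => _ ->.
  by rewrite addrC => /addrI.
exists (b ^+ (p ^ N.+1)).
have [q qE] : exists q, (p ^ N.+1 = q.+1)%N.
  by exists (p ^ N.+1).-1; rewrite prednK // expn_gt0 prime_gt0.
split.
- by rewrite qE (th_cornerX _ bu) -qE yx.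
- by move=> v nvu; rewrite qE th_corner0 //; apply: cornerX.
move=> t ltt; set cc := y ^+ (p ^ t).
have PiB : Pi t *m rho b = rho b *m Pi t.
  rewrite /Pi -scalemxAl -scalemxAr mulmx_suml mulmx_sumr; congr (_ *: _).
  apply: eq_bigr => i _; rewrite -scalemxAl -scalemxAr -!(ring_repM rho_rep).
  by congr (_ *: rho _); apply/esym/commrX/commr_sym.
pose D := Pi t *m (rho b - cc%:M).
have DN : D ^+ N.+1 = 0.
  apply: nilN.
    rewrite /D mulmxBr mul_mx_scalar; apply: in_spanD.
      by apply: in_spanM => //; apply: in_span_rep.
    by rewrite -scaleN1r; do 2!apply: in_spanZ.
  move=> m U V v s T lts iT.
  rewrite /D mulmxBr mul_mx_scalar -[in cc *: Pi t]Pi_e.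
  rewrite mulmxBr !mulmxBl -(scalemxAr cc) -!(scalemxAl cc).
  have [evu|nvu] := eqVneq v u; last first.
    have Pi0 a' : corner a' -> U *m (Pi t *m rho a') *m V *m T = 0.
      move=> ca'; rewrite /Pi -scalemxAl -scalemxAr -!scalemxAl.
      rewrite mulmx_suml mulmx_sumr !mulmx_suml big1 ?scaler0 // => i _.
      rewrite -scalemxAl -(ring_repM rho_rep) -scalemxAr -!scalemxAl.
      by rewrite (block_other iT) ?scaler0 //; apply: cornerM => //; apply: cornerX.
    by rewrite !Pi0 // scaler0 subrr.
  move: T iT lts; rewrite evu => T iT lts.
  have e1 : th u e = 1 *: delta_mx o o by rewrite scale1r.
  rewrite (block_Pi_mul iT lts ltt bu) (block_Pi_mul iT lts ltt e1) scalerA.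
  rewrite expr1n mulr1 /cc; case: eqP => [<-|_]; last by rewrite mul0r mulr0 subrr.
  by rewrite mul1r mulr1 subrr.
have pR : p \in [pchar 'M[K]_n.+1] by rewrite pchar_lalg.
have Dq : D ^+ (p ^ N.+1) = 0.
  have : (N.+1 <= p ^ N.+1)%N by apply: ltnW; apply: ltn_expl; apply: prime_gt1.
  by move=> /subnK <-; rewrite exprD DN mulr0.
have comB : GRing.comm (rho b) (cc%:M : 'M[K]_n.+1) by apply: comm_mx_scalar.
have Piq : (Pi t : 'M[K]_n.+1) ^+ (p ^ N.+1) = Pi t.
  rewrite qE; elim: (q) => [|i IH]; first by rewrite expr1.
  by rewrite exprS IH -[_ * _]/(Pi t *m Pi t) Pi_Pi // eqxx scale1r.
have rhoX i : rho (b ^+ i) = (rho b : 'M[K]_n.+1) ^+ i.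
  elim: i => [|i IH]; first by rewrite !expr0 (ring_rep1 rho_rep).
  by rewrite !exprS (ring_repM rho_rep) IH.
have := Dq; rewrite /D exprMn_comm; last first.
  by apply: commrB => //; apply: comm_mx_scalar.
rewrite Piq (expr_pcharB_comm _ pR comB) -rhoX mulrBr => /eqP; rewrite subr_eq0.
have -> : (cc%:M : 'M[K]_n.+1) ^+ (p ^ N.+1) = (x ^+ (p ^ t))%:M.
  by rewrite -rmorphXn /= /cc -exprM mulnC exprM yx.
by move/eqP; rewrite -[_ * rho _]/(Pi t *m _) -[_ * _%:M]/(Pi t *m _) mul_mx_scalar.
Qed.

Lemma torus_projections_of : exists Pi : nat -> 'M[K]_n.+1,
  [/\ forall t, in_span rho (Pi t), forall t, Pi t *m rho e = Pi t,
      \sum_(t < k u) Pi t = rho e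
    & forall x, x \in E u -> exists a,
      [/\ th u a = x *: delta_mx o o, forall v, v != u -> th v a = 0
        & forall t, (t < k u)%N -> Pi t *m rho a = x ^+ (p ^ t) *: Pi t]].
Proof. by exists Pi; split. Qed.

End Projections.

Lemma torus_projections_pchar : exists Pi : nat -> 'M[K]_n.+1,
  [/\ forall t, in_span rho (Pi t), forall t, Pi t *m rho e = Pi t,
      \sum_(t < k u) Pi t = rho e
    & forall x, x \in E u -> exists a,
      [/\ th u a = x *: delta_mx o o, forall v, v != u -> th v a = 0
        & forall t, (t < k u)%N -> Pi t *m rho a = x ^+ (p ^ t) *: Pi t]].
Proof.
have [x0 [z [px0 cz zu zM]]] := unity_root_lift.
exact: torus_projections_of px0 cz zu zM.
Qed.

End TorusLift.

Section TorusProjections.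
Variables (F : fieldType) (K : closedFieldType) (iota : {rmorphism F -> K}).
Variables (A : algType F) (n : nat) (rho : A -> 'M[K]_n.+1).
Hypotheses (rho_rep : ring_rep rho) (rho_inj : injective rho).
Variables (P c : nat) (d : 'I_c -> nat) (E : 'I_c -> {pred K}) (k : 'I_c -> nat).
Variables (th : forall u, A -> 'M[K]_(d u)).
Hypothesis sq : semisimple_quotient iota rho P E k th.

Lemma torus_projections u e (o := ord_first sq u) :
  e * e = e -> th u e = delta_mx o o -> (forall v, v != u -> th v e = 0) ->
  exists Pi : nat -> 'M[K]_n.+1,
  [/\ forall t, in_span rho (Pi t), forall t, Pi t *m rho e = Pi t,
      \sum_(t < k u) Pi t = rho e
    & forall x, x \in E u -> exists a,
      [/\ th u a = x *: delta_mx o o, forall v, v != u -> th v a = 0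
        & forall t, (t < k u)%N -> Pi t *m rho a = x ^+ (P ^ t) *: Pi t]].
Proof.
move=> ee eu ev.
case: (sq_cases sq) => [[P1 k1 scale]|pK]; last first.
  exact: (torus_projections_pchar rho_rep rho_inj pK ee eu ev).
(* Without Frobenius there is a single twist, and the scalars come from the fact that the image of
   [rho] is stable under [K]. *)
exists (fun=> rho e); split=> [t|t||x Ex].
- exact: in_span_rep.
- by rewrite -(ring_repM rho_rep) ee.
- by rewrite k1 big_ord1.
have [a aE] := scale x e; exists a.
have [X [Y XY]] := sq_block sq.
have tha v : th v a = x *: th v e.
  by rewrite !XY aE -scalemxAr -scalemxAl.
split=> [|v nvu|t _]; first by rewrite tha eu.
  by rewrite tha ev // scaler0.
by rewrite aE P1 exp1n expr1 -scalemxAr -(ring_repM rho_rep) ee.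
Qed.

Record torus_units (eps : 'I_c -> A) (al be : {u : 'I_c & 'I_(d u)} -> A)
    (Pi : 'I_c -> nat -> 'M[K]_n.+1) (tau : 'I_c -> K -> A) : Prop := TorusUnits {
  tu_al : forall z, eps (tag z) * al z = al z;
  tu_be : forall z, be z * eps (tag z) = be z;
  tu_albe : forall z y, al z * be y = if z == y then eps (tag z) else 0;
  tu_sum : \sum_z be z * al z = 1;
  tu_al_th : forall z, th (tag z) (al z) = delta_mx (ord_first sq (tag z)) (tagged z);
  tu_be_th : forall z, th (tag z) (be z) = delta_mx (tagged z) (ord_first sq (tag z));
  tu_al_th0 : forall z v, v != tag z -> th v (al z) = 0;
  tu_Pi_span : forall u t, in_span rho (Pi u t);
  tu_Pi_eps : forall u t, Pi u t *m rho (eps u) = Pi u t;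
  tu_Pi_sum : forall u, \sum_(t < k u) Pi u t = rho (eps u);
  tu_tau_th : forall u x, x \in E u ->
    th u (tau u x) = x *: delta_mx (ord_first sq u) (ord_first sq u);
  tu_tau_th0 : forall u x v, x \in E u -> v != u -> th v (tau u x) = 0;
  tu_Pi_tau : forall u x t, x \in E u -> (t < k u)%N ->
    Pi u t *m rho (tau u x) = x ^+ (P ^ t) *: Pi u t;
  tu_eps_th : forall u, th u (eps u) = delta_mx (ord_first sq u) (ord_first sq u);
  tu_eps_th0 : forall u v, v != u -> th v (eps u) = 0
}.

Lemma torus_units_exist : exists eps al be Pi tau, torus_units eps al be Pi tau.
Proof.
have [eps epsP] := choice (lift_corner rho_rep rho_inj sq).
have eps_idem u : eps u * eps u = eps u by case: (epsP u).
have eps_th u : th u (eps u) = delta_mx (ord_first sq u) (ord_first sq u).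
  by case: (epsP u).
have eps_th0 u v : v != u -> th v (eps u) = 0 by case: (epsP u) => _ _; apply.
have [al [be [cu sum1]]] := corner_units_full rho_rep rho_inj eps_idem eps_th eps_th0.
have [Pi PiP] := choice (fun u => torus_projections (eps_idem u) (eps_th u) (@eps_th0 u)).
have tauP u x : exists a, x \in E u ->
    [/\ th u a = x *: delta_mx (ord_first sq u) (ord_first sq u),
        forall v, v != u -> th v a = 0
      & forall t, (t < k u)%N -> Pi u t *m rho a = x ^+ (P ^ t) *: Pi u t].
  have [Ex|nEx] := boolP (x \in E u); last by exists 0.
  by have [_ _ _ /(_ x Ex) [a aP]] := PiP u; exists a.
have [tau {}tauP] := choice (fun ux : 'I_c * K => tauP ux.1 ux.2).
have inT z : z \in enum {: {u : 'I_c & 'I_(d u)}} by rewrite mem_enum.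
exists eps, al, be, Pi, (fun u x => tau (u, x)); split.
- by move=> z; apply: (cu_al cu).
- by move=> z; apply: (cu_be cu).
- by move=> z y; apply: (cu_albe cu).
- by [].
- by move=> z; apply: (cu_al_th cu).
- by move=> z; apply: (cu_be_th cu).
- by move=> z v; apply: (cu_al_th0 cu).
- by move=> u; case: (PiP u).
- by move=> u; case: (PiP u).
- by move=> u; case: (PiP u).
- by move=> u x Ex; case: (tauP (u, x) Ex).
- by move=> u x v Ex nvu; have [_ H _] := tauP (u, x) Ex; apply: H.
- by move=> u x t Ex ltt; case: (tauP (u, x) Ex) => _ _; apply.
- by [].
- by [].
Qed.

End TorusProjections.

(** * A basis adapted to the radical filtration *)

Section AdaptedBasis.
Variables (F : fieldType) (K : closedFieldType) (iota : {rmorphism F -> K}).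
Variables (A : algType F) (n : nat) (rho : A -> 'M[K]_n.+1).
Hypotheses (rho_rep : ring_rep rho).
Variables (P c : nat) (d : 'I_c -> nat) (E : 'I_c -> {pred K}) (k : 'I_c -> nat).
Variables (th : forall u, A -> 'M[K]_(d u)).
Hypothesis sq : semisimple_quotient iota rho P E k th.
Variables (eps : 'I_c -> A) (al be : {u : 'I_c & 'I_(d u)} -> A).
Variables (Pi : 'I_c -> nat -> 'M[K]_n.+1) (tau : 'I_c -> K -> A).
Hypothesis tu : torus_units sq eps al be Pi tau.
Variable W : nat -> 'M[K]_n.+1.
Hypotheses (W_span : forall l b, in_span rho b -> (W l *m b <= W l)%MS)
  (W_rad : forall l a, rad th a -> (W l *m rho a <= W l.+1)%MS).

Let T : finType := {u : 'I_c & 'I_(d u)}.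
Let tg v (i : 'I_(d v)) : T := existT (fun v => 'I_(d v)) v i.
Let rhoM := ring_repM rho_rep.

(* A block [(u, t, l, b)] is a copy of the [P ^ t]-th twist of [th u], spanned *)
(* by the rows [b * al (u, i)]; [b] lies in the [l]-th step of the filtration. *)
Let B := ('I_c * nat * nat * 'rV[K]_n.+1)%type.
Definition bcmp (x : B) := x.1.1.1.
Definition btw (x : B) := x.1.1.2.
Definition blev (x : B) := x.1.2.

Definition brows (x : B) : 'M[K]_(d (bcmp x), n.+1) :=
  \matrix_i (x.2 *m rho (al (tg i))).

(** These conditions on the generator [x.2] make the block a copy of a twist: it lies in the corner,
    and lifted scalars act on it exactly through Frobenius. *)
Definition good_block (x : B) : Prop :=
  [/\ x.2 *m rho (eps (bcmp x)) = x.2, (x.2 <= W (blev x))%MS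
    & forall y, y \in E (bcmp x) ->
        x.2 *m rho (tau (bcmp x) y) = y ^+ (P ^ btw x) *: x.2].

Definition bspan (s : seq B) (Q : pred B) : 'M[K]_n.+1 :=
  (\sum_(x <- s | Q x) <<brows x>>)%MS.

Lemma bspan_sup s (Q : pred B) x : x \in s -> Q x -> (brows x <= bspan s Q)%MS.
Proof.
rewrite /bspan; elim: s => // y s IH; rewrite inE big_cons => /predU1P [->|sx] Qx.
  by rewrite Qx -(genmxE (brows y)) addsmxSl.
case: ifP => _; last exact: IH.
by apply: submx_trans (IH sx Qx) _; apply: addsmxSr.
Qed.

Lemma bspan_sub s (Q : pred B) m (M : 'M_(m, n.+1)) :
  (forall x, x \in s -> Q x -> (brows x <= M)%MS) -> (bspan s Q <= M)%MS.
Proof.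
rewrite /bspan; elim: s => [|y s IH] sM; first by rewrite big_nil sub0mx.
rewrite big_cons; case: ifP => Qy.
  rewrite addsmx_sub genmxE sM ?mem_head //=; apply: IH => x sx.
  by apply: sM; rewrite inE sx orbT.
by apply: IH => x sx; apply: sM; rewrite inE sx orbT.
Qed.

Let delta_al (v : 'rV[K]_n.+1) u (z y : T) i : v *m rho (eps u) = v ->
  v *m rho (al (tg (i : 'I_(d u)))) *m rho (be z) *m rho (al y) =
  if tg i == z then v *m rho (al y) else 0.
Proof.
move=> ve; rewrite -(mulmxA v) -rhoM (tu_albe tu); case: eqP => _.
  by rewrite /= ve.
by rewrite (ring_rep0 rho_rep) mulmx0 mul0mx.
Qed.

Lemma bspan_stable s (Q : pred B) z y : (forall x, x \in s -> good_block x) ->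
  tag y = tag z -> (bspan s Q *m rho (be z) *m rho (al y) <= bspan s Q)%MS.
Proof.
move=> gs ezy; rewrite submxE; set S := bspan s Q.
have: S *m cokermx S = 0 by rewrite mulmx_coker.
move: (cokermx S) => C SC.
have : (S <= kermx (rho (be z) *m rho (al y) *m C))%MS.
  apply: bspan_sub => x sx Qx; apply/row_subP => i; rewrite rowK sub_kermx.
  have [xe _ _] := gs x sx.
  rewrite !mulmxA (delta_al _ _ _ xe); case: (tg i =P z) => [ez|_]; last first.
    by rewrite mul0mx.
  move: ezy; rewrite -ez; case: y => v j /= evu.
  move: j; rewrite evu => j {evu v}.
  have /submxP [D xD] := bspan_sup sx Qx.
  have := congr1 (fun M => row j (M *m C)) xD.
  by rewrite row_mul rowK -mulmxA SC mulmx0 linear0 => ->.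
by rewrite sub_kermx !mulmxA.
Qed.

(** State of the construction while level [l] is being filled: independent blocks, with step [l.+1]
    of the filtration already covered by blocks of level above [l]. *)
Record adapted (m l : nat) (s : seq B) : Prop := Adapted {
  ad_good : forall x, x \in s -> good_block x;
  ad_lev : forall x, x \in s -> (l <= blev x < m)%N;
  ad_tw : forall x, x \in s -> (btw x < k (bcmp x))%N;
  ad_nz : forall x, x \in s -> x.2 != 0;
  ad_rank : \rank (bspan s xpredT) = (\sum_(x <- s) d (bcmp x))%N;
  ad_sorted : sorted leq [seq blev x | x <- s];
  ad_rad : forall x a, x \in s -> rad th a ->
    (brows x *m rho a <= bspan s (fun y => blev x < blev y)%N)%MS;
  ad_next : (W l.+1 <= bspan s (fun y => l < blev y)%N)%MS
}.

Lemma bspan_cons_false x s (Q : pred B) : ~~ Q x -> bspan (x :: s) Q = bspan s Q.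
Proof. by move=> /negPf Qx; rewrite /bspan big_cons Qx. Qed.

(** Matrix units and projections [Pi] split [v] into pieces, one of which lies outside the span [S]
    and provides the new block. If a nontrivial combination of its rows lay in [S], multiplying by
    matrix units would bring this piece into [S]. *)
Lemma adapted_cons m l s (v : 'rV[K]_n.+1) : (l < m)%N -> adapted m l s ->
  (v <= W l)%MS -> ~~ (v <= bspan s xpredT)%MS ->
  exists x, adapted m l (x :: s).
Proof.
move=> ltlm ad vW nvs; set S := bspan s xpredT in nvs *.
have [z [t [ltt nzt]]] : exists z t, (t < k (tag z))%N /\
    ~~ (v *m rho (be z) *m Pi (tag z) t *m rho (al z) <= S)%MS.
  apply: contrapT => none; case/negP: nvs.
  have -> : v = \sum_z \sum_(t < k (tag z))
      v *m rho (be z) *m Pi (tag z) t *m rho (al z).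
    rewrite -[LHS]mulmx1 -(ring_rep1 rho_rep) -(tu_sum tu).
    rewrite (ring_rep_sum _ _ _ rho_rep) mulmx_sumr; apply: eq_bigr => z _.
    rewrite -mulmx_suml -mulmx_sumr (tu_Pi_sum tu) -[v *m _ *m rho (eps _)]mulmxA -rhoM.
    by rewrite (tu_be tu) rhoM mulmxA.
  apply: summx_sub => z _; apply: summx_sub => t _; apply: contrapT => /negP nzt.
  by apply: none; exists z, t.
set u := tag z in ltt nzt; set b := v *m rho (be z) *m Pi u t in nzt.
pose x : B := (u, t, l, b).
have bW : (b <= W l)%MS.
  apply: submx_trans (W_span l (tu_Pi_span tu u t)); apply: submxMr.
  apply: submx_trans (W_span l (in_span_rep (be z))); exact: submxMr.
have be_ : b *m rho (eps u) = b by rewrite /b -mulmxA (tu_Pi_eps tu).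
have nzb : b != 0.
  by apply: contraNneq nzt => b0; rewrite b0 mul0mx sub0mx.
have gx : good_block x.
  split=> // y Ey; rewrite /b -[_ *m rho (tau _ _)]mulmxA (tu_Pi_tau tu) //.
  by rewrite -scalemxAr.
have gs y : y \in s -> good_block y := ad_good ad (x := y).
have freex (w : 'rV_(d u)) : (w *m brows x <= S)%MS -> w = 0.
  move=> wS; apply/rowP => j; rewrite mxE; apply: contraNeq nzt => nzw.
  rewrite -(eqmx_scale _ nzw).
  have -> : w 0 j *: (b *m rho (al z)) =
      w *m brows x *m rho (be (tg j)) *m rho (al z).
    rewrite -!mulmxA [RHS]mulmx_sum_row (bigD1 j) //= big1 ?addr0 => [|i nij].
      rewrite row_mul rowK !mulmxA (delta_al _ _ _ be_) eqxx //.
    rewrite row_mul rowK !mulmxA (delta_al _ _ _ be_).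
    have -> : tg i == tg j = false; last by rewrite scaler0.
    apply: contraNF nij => /eqP e; apply/eqP; move: e.
    by move/eqP; rewrite -tag_eqE /tag_eq /= eqxx tagged_asE => /eqP.
  apply: submx_trans (bspan_stable _ gs _ : (S *m rho (be (tg j)) *m rho (al z) <= S)%MS).
    by do 2!apply: submxMr.
  by [].
exists x; split.
- by move=> y; rewrite inE => /predU1P [->|/gs].
- move=> y; rewrite inE => /predU1P [->|/(ad_lev ad)] //.
  by rewrite /blev /= leqnn.
- by move=> y; rewrite inE => /predU1P [->|/(ad_tw ad)].
- by move=> y; rewrite inE => /predU1P [->|/(ad_nz ad)].
- rewrite big_cons -(ad_rank ad) /bspan big_cons /= -/(bspan s xpredT) -/S.
  have rx : \rank (brows x) = d u.
    apply/eqP; rewrite -[_ == _]/(row_free _); apply/inj_row_free => w w0.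
    by apply: freex; rewrite w0 sub0mx.
  rewrite mxrank_disjoint_sum ?mxrank_gen ?rx //.
  apply/eqP; rewrite -submx0; apply/rV_subP => w; rewrite sub_capmx genmxE.
  case/andP=> /submxP [y ->] /freex ->; by rewrite mul0mx sub0mx.
- rewrite /=; have := ad_sorted ad; case: (s) (ad_lev ad) => //= y s' levs ->.
  by rewrite andbT; have /andP[] := levs y (mem_head _ _).
- have blx : blev x = l by [].
  move=> y a; rewrite inE => /predU1P [->|sy] ra.
    rewrite bspan_cons_false ?ltnn //.
    apply: submx_trans (ad_next ad); apply/row_subP => i.
    rewrite row_mul rowK -mulmxA -rhoM.
    apply: submx_trans (W_rad l (radMl sq _ ra)); exact: submxMr.
  rewrite bspan_cons_false; first exact: (ad_rad ad).
  by have /andP[lel _] := ad_lev ad sy; rewrite blx -leqNgt.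
- by rewrite bspan_cons_false ?(ad_next ad) // /blev /= ltnn.
Qed.

Lemma adapted_fill m l s : (l < m)%N -> adapted m l s ->
  exists2 s', adapted m l s' & (W l <= bspan s' xpredT)%MS.
Proof.
move=> ltlm; have [N] := ubnP (n.+1 - \rank (bspan s xpredT))%N.
elim: N s => // N IH s ltN ad.
case: (boolP (W l <= bspan s xpredT)%MS) => [|/row_subPn [i nWs]]; first by exists s.
have [x adx] := adapted_cons ltlm ad (row_sub i (W l)) nWs.
apply: (IH (x :: s)) => //.
have : (\rank (bspan s xpredT) < \rank (bspan (x :: s) xpredT))%N.
  rewrite (ad_rank ad) (ad_rank adx) big_cons -[X in (X < _)%N]add0n ltn_add2r.
  exact: (sq_deg sq).
have := rank_leq_col (bspan (x :: s) xpredT); have := rank_leq_col (bspan s xpredT).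
move: ltN; lia.
Qed.

(** Descending induction on the level, from [W m = 0] up to the whole space [W 0]. *)
Lemma adapted_basis m : (0 < m)%N -> W m = 0 -> row_full (W 0) ->
  exists2 s, adapted m 0 s & row_full (bspan s xpredT).
Proof.
case: m => // m _ Wm fullW.
suff H l : (l <= m)%N -> exists2 s, adapted m.+1 (m - l) s &
    (W (m - l) <= bspan s xpredT)%MS.
  have [s ad sW] := H m (leqnn m); rewrite subnn in ad sW.
  by exists s => //; rewrite -sub1mx (submx_trans _ sW) // submx_full.
elim: l => [_|l IH ltlm].
  rewrite subn0; apply: (@adapted_fill _ _ [::]) => //; split=> //.
    by rewrite /bspan !big_nil mxrank0.
  by rewrite Wm sub0mx.
have [s ad sW] := IH (ltnW ltlm).
have ml : (m - l)%N = (m - l.+1).+1 by rewrite subnSK.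
apply: (@adapted_fill _ _ s); first by lia.
rewrite ml in ad sW; split; try by case: ad.
- by move=> x /(ad_lev ad) /andP[/ltnW -> ->].
- apply: submx_trans sW _; apply: bspan_sub => x sx _.
  by apply: bspan_sup => //; have /andP[] := ad_lev ad sx.
Qed.

End AdaptedBasis.

(** * A lift of the semisimple quotient acting through twists *)

Section SemisimpleLift.
Variables (F : fieldType) (K : closedFieldType) (iota : {rmorphism F -> K}).
Variables (A : algType F) (n : nat) (rho : A -> 'M[K]_n.+1).
Hypotheses (rho_rep : ring_rep rho) (rho_inj : injective rho)
  (rhoZ : forall x a, rho (x *: a) = iota x *: rho a).
Variables (P c : nat) (d : 'I_c -> nat) (E : 'I_c -> {pred K}) (k : 'I_c -> nat).
Variables (th : forall u, A -> 'M[K]_(d u)).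
Hypothesis sq : semisimple_quotient iota rho P E k th.
Variables (eps : 'I_c -> A) (al be : {u : 'I_c & 'I_(d u)} -> A).
Variables (Pi : 'I_c -> nat -> 'M[K]_n.+1) (tau : 'I_c -> K -> A).
Hypothesis tu : torus_units sq eps al be Pi tau.
Variable W : nat -> 'M[K]_n.+1.

Let tg v (i : 'I_(d v)) : {u : 'I_c & 'I_(d u)} := existT (fun v => 'I_(d v)) v i.
Let th_rep := sq_rep sq.
Let thM v := ring_repM (th_rep v).
Let good_block := good_block rho P E eps tau W.

(** [Z] is rebuilt from lifted matrix units and scalars, which act on good blocks exactly and not
    only modulo the radical. *)
Lemma semisimple_lift (Z : forall u, 'M[K]_(d u)) :
  (forall u, Z u \is a mxOver (E u)) ->
  exists2 a, forall u, th u a = Z u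
    & forall x, good_block x ->
        brows rho al x *m rho a = twist (P ^ btw x) (Z (bcmp x)) *m brows rho al x.
Proof.
move=> EZ; pose t u i j := be (tg i) * tau u (Z u i j) * al (tg j).
have EZij u i j : Z u i j \in E u by have /mxOverP := EZ u; apply.
have th_t u i j v : v != u -> th v (t u i j) = 0.
  by move=> nvu; rewrite !thM (tu_tau_th0 tu) // mulmx0 mul0mx.
exists (\sum_u \sum_i \sum_j t u i j) => [v|x [xe _ xtau]].
  rewrite (ring_rep_sum _ _ _ (th_rep v)) (bigD1 v) //= [X in _ + X]big1 => [|u nuv].
    rewrite addr0 [RHS]matrix_sum_delta (ring_rep_sum _ _ _ (th_rep v)).
    apply: eq_bigr => i _; rewrite (ring_rep_sum _ _ _ (th_rep v)).
    apply: eq_bigr => j _; rewrite !thM (tu_be_th tu (tg i)) (tu_al_th tu (tg j)).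
    by rewrite (tu_tau_th tu) // -scalemxAr -scalemxAl !mul_delta_mx.
  rewrite (ring_rep_sum _ _ _ (th_rep v)) big1 // => i _.
  rewrite (ring_rep_sum _ _ _ (th_rep v)) big1 // => j _.
  by rewrite th_t // eq_sym.
set u := bcmp x in xe xtau *.
apply/row_matrixP => i; rewrite !row_mul rowK -/u -mulmxA -(ring_repM rho_rep).
have tgE v (j : 'I_(d v)) : (tg i == tg j) = (v == u) && (tagged_as (tg i) (tg j) == i).
  by rewrite -tag_eqE /tag_eq /= [u == v]eq_sym [i == _]eq_sym.
have alE v i' j : tg i != tg (i' : 'I_(d v)) -> al (tg i) * t v i' j = 0.
  by move=> /negPf ni; rewrite /t !mulrA (tu_albe tu) ni !mul0r.
rewrite mulr_sumr (bigD1 u) //= [X in _ + X]big1 ?addr0 => [|v nvu]; last first.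
  rewrite mulr_sumr big1 // => i' _; rewrite mulr_sumr big1 // => j _.
  by rewrite alE // tgE (negPf nvu).
rewrite mulr_sumr (bigD1 i) //= [X in _ + X]big1 ?addr0 => [|i' ni]; last first.
  rewrite mulr_sumr big1 // => j _; rewrite alE // tgE eqxx /=.
  by rewrite tagged_asE.
rewrite mulr_sumr (ring_rep_sum _ _ _ rho_rep) mulmx_sumr.
rewrite [RHS]mulmx_sum_row; apply: eq_bigr => j _.
rewrite !mxE rowK /t !mulrA (tu_albe tu) eqxx !(ring_repM rho_rep) !mulmxA xe.
by rewrite xtau // -scalemxAl.
Qed.

(* [tau u c - c * eps u] is nilpotent and acts on [x] as a scalar.             *)
Lemma good_block_frobenius x (y : F) : good_block x -> x.2 != 0 ->
  iota y ^+ (P ^ btw x) = iota y.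
Proof.
move=> [xe _ xtau] nzx; set u := bcmp x in xe xtau.
have [_ Fu _] := sq_field sq u.
pose r := tau u (iota y) - y *: eps u.
have rr : rad th r.
  move=> v; rewrite (ring_repB _ _ (th_rep v)) (sq_lin sq).
  have [->|nvu] := eqVneq v u.
    by rewrite (tu_tau_th tu) // (tu_eps_th tu) subrr.
  by rewrite (tu_tau_th0 tu) // (tu_eps_th0 tu) // scaler0 subrr.
have [N _ /(_ r rr) rN] := rad_expn rho_rep rho_inj sq.
have xr : x.2 *m rho r = (iota y ^+ (P ^ btw x) - iota y) *: x.2.
  by rewrite (ring_repB _ _ rho_rep) mulmxBr rhoZ -scalemxAr xe xtau // scalerBl.
have xrX i : x.2 *m rho (r ^+ i) = (iota y ^+ (P ^ btw x) - iota y) ^+ i *: x.2.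
  elim: i => [|i IH]; first by rewrite !expr0 (ring_rep1 rho_rep) mulmx1 scale1r.
  by rewrite !exprS (ring_repM rho_rep) mulmxA xr -scalemxAl IH scalerA.
have /esym/eqP := xrX N; rewrite rN (ring_rep0 rho_rep) mulmx0 scaler_eq0.
by rewrite (negPf nzx) orbF expf_eq0 subr_eq0 => /andP[_ /eqP].
Qed.

End SemisimpleLift.

(** * Block form *)

Section Representations.
Variables (F : fieldType) (K : closedFieldType) (iota : {rmorphism F -> K}).
Variable A : algType F.

Lemma representation_ring_rep n (f : representation iota A n) :
  ring_rep f /\ forall x a, f (x *: a) = iota x *: f a.
Proof.
split; last by move=> x a; rewrite linearZ.
by split=> [x y|x y|]; rewrite ?rmorphD ?rmorph1 // rmorphM.
Qed.

Lemma ring_rep_representation n (f : A -> 'M[K]_n) : ring_rep f ->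
  (forall x a, f (x *: a) = iota x *: f a) ->
  exists g : representation iota A n, forall a, g a = f a.
Proof.
move=> rf fZ.
have fB : zmod_morphism f by move=> x y; rewrite (ring_repB _ _ rf).
have fM : monoid_morphism f.
  by split=> [|x y]; rewrite ?(ring_rep1 rf) // (ring_repM rf).
have fS : scalable_for (iota \; *:%R) f by move=> x a; rewrite fZ.
pose mB := GRing.isZmodMorphism.Build A 'M[K]_n f fB.
pose mM := GRing.isMonoidMorphism.Build A 'M[K]_n f fM.
pose mS := GRing.isScalable.Build F A 'M[K]_n (iota \; *:%R) f fS.
pose g : representation iota A n := HB.pack f mB mM mS.
by exists g.
Qed.

End Representations.

Lemma zariski_closed_linear (K : fieldType) m n (L : 'M[K]_(n * n, m * m))
    (Z : set 'M[K]_m) (f : 'M[K]_n -> 'M[K]_m) :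
  (forall X, mxvec (f X) = mxvec X *m L) -> zariski_closed Z ->
  zariski_closed (f @^-1` Z)%classic.
Proof.
move=> fL [Q ->].
pose lq := [tuple \sum_l L l k *: mpoly.mpolyX K (mpoly.mnm1 l) | k < m * m].
exists [set q | exists2 p, Q p & q = mpoly.comp_mpoly lq p]%classic.
have evE p X : mpoly.meval (fun i => mxvec X 0 i) (mpoly.comp_mpoly lq p) =
    mpoly.meval (fun i => mxvec (f X) 0 i) p.
  rewrite mpoly.comp_mpoly_meval; apply: mpoly.meval_eq => k.
  rewrite tnth_mktuple raddf_sum fL mxE /=; apply: eq_bigr => l _.
  by rewrite mpoly.mevalZ mpoly.mevalXU mulrC.
apply/seteqP; split=> X /=.
  by move=> Zf _ [p Qp ->]; rewrite evE; apply: Zf.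
by move=> Zf p Qp; rewrite -evE; apply: Zf; exists p.
Qed.

Lemma zariski_closed_conj (K : fieldType) (A : Type) m n (f : A -> 'M[K]_m)
    (U : 'M[K]_(n, m)) (V : 'M_(m, n)) : U *m V = 1%:M -> V *m U = 1%:M ->
  zariski_closed (range f) -> zariski_closed (range (fun a => U *m f a *m V)).
Proof.
move=> UV VU cf; pose g (X : 'M[K]_n) := V *m X *m U.
have -> : range (fun a => U *m f a *m V) = (g @^-1` range f)%classic.
  apply/seteqP; split=> X /=.
    by move=> [a _ <-]; exists a => //; rewrite /g !mulmxA VU mul1mx -mulmxA VU mulmx1.
  by move=> [a _ fX]; exists a => //; rewrite fX /g !mulmxA UV mul1mx -mulmxA UV mulmx1.
apply: (@zariski_closed_linear _ _ _ (lin_mulmx V *m lin_mulmxr U)) cf => X.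
by rewrite mulmxA mul_vec_lin /= mul_vec_lin.
Qed.

Lemma submxblock_mxdiag (R : nmodType) n (p_ : 'I_n -> nat)
    (B : forall r, 'M[R]_(p_ r)) r s :
  r != s -> submxblock (\mxdiag_r B r) r s = 0.
Proof. by move=> /negPf nrs; rewrite mxblockK nrs. Qed.

Section BlockForm.
Variables (F : fieldType) (K : closedFieldType) (iota : {rmorphism F -> K}).
Variables (A : algType F) (n : nat) (rho : A -> 'M[K]_n.+1).
Hypotheses (rho_rep : ring_rep rho) (rho_inj : injective rho)
  (rhoZ : forall x a, rho (x *: a) = iota x *: rho a)
  (rho_closed : zariski_closed (range rho)).
Variables (P c : nat) (d : 'I_c -> nat) (E : 'I_c -> {pred K}) (k : 'I_c -> nat).
Variables (th : forall u, A -> 'M[K]_(d u)).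
Hypothesis sq : semisimple_quotient iota rho P E k th.
Variables (eps : 'I_c -> A) (al be : {u : 'I_c & 'I_(d u)} -> A).
Variables (Pi : 'I_c -> nat -> 'M[K]_n.+1) (tau : 'I_c -> K -> A).
Hypothesis tu : torus_units sq eps al be Pi tau.
Variables (W : nat -> 'M[K]_n.+1) (m : nat).
Variable s : seq ('I_c * nat * nat * 'rV[K]_n.+1).
Hypotheses (ad : adapted rho P E k th eps al tau W m 0 s)
  (full_s : row_full (bspan rho al s xpredT)).

Let X r := tnth (in_tuple s) r.
Let Xs r : X r \in s := mem_tnth r (in_tuple s).
Let th_rep := sq_rep sq.
Let ae r : add_exp K (P ^ btw (X r)) := add_expX _ (sq_exp sq).
Let br r := brows rho al (X r).

(** The twist on a block fixes the image of [F], so its exponent, a priori a power of [P], is a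
    power of [qcard F]. *)
Let frob_exists r : exists t, (P ^ btw (X r) = qcard F ^ t)%N.
Proof.
apply: (sq_pow sq) => x.
exact: (good_block_frobenius rho_rep rho_inj rhoZ tu x (ad_good ad (Xs r)) (ad_nz ad (Xs r))).
Qed.

Let frob r : nat := projT1 (cid (frob_exists r)).
Let frobE r : (P ^ btw (X r) = qcard F ^ frob r)%N := projT2 (cid (frob_exists r)).

Let D : block_data K := BlockData d E (fun r => bcmp (X r)) frob.

Let U : 'M[K]_(bdim D, n.+1) := \mxcol_r br r.
Let V := pinvmx U.

Let bspanE Q : bspan rho al s Q = (\sum_(r | Q (X r)) <<br r>>)%MS.
Proof. by rewrite /bspan big_tnth. Qed.

Let eqU : (U :=: bspan rho al s xpredT)%MS.
Proof. by rewrite bspanE; apply: eqmx_col. Qed.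

Let fullU : row_full U.
Proof. by rewrite /row_full eqU. Qed.

Let freeU : row_free U.
Proof. by rewrite /row_free eqU (ad_rank ad) big_tnth. Qed.

Let UV : U *m V = 1%:M. Proof. exact: mulmxVp. Qed.
Let VU : V *m U = 1%:M. Proof. exact: mulVpmx. Qed.

Let f a := U *m rho a *m V.

Let f_rep : ring_rep f := ring_rep_conj UV VU rho_rep.

Let f_inj : injective f := inj_comp (conj_inj VU) rho_inj.

Let fZ x a : f (x *: a) = iota x *: f a.
Proof. by rewrite /f rhoZ -scalemxAr -scalemxAl. Qed.

Let f_diag a (Z : forall r, 'M[K]_(d (bcmp (X r)))) :
  (forall r, br r *m rho a = Z r *m br r) -> f a = \mxdiag_r Z r.
Proof.
move=> ZE; rewrite /f /U mxcol_mul (eq_mxcol ZE) -mul_mxdiag_mxcol.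
by rewrite -mulmxA [_ *m V]UV mulmx1.
Qed.

Let lev r := blev (X r).

Let brV r t : r != t -> br r *m submxrow (V : 'M_(n.+1, \sum_r bsize r)) t = 0.
Proof.
move=> nrt; have -> : br r = submxcol (U : 'M_(\sum_r bsize r, n.+1)) r.
  by rewrite mxcolK.
rewrite mul_submxrow submxcol_mul UV.
by rewrite -(mxdiagZ (p_ := @bsize K D) 1) -submxblockEv submxblock_mxdiag.
Qed.

Let f_rad a r t : rad th a -> (lev t <= lev r)%N ->
  submxblock (f a : 'M_(\sum_r bsize r)) r t = 0.
Proof.
move=> ra letr; rewrite submxblockEv -submxcol_mul -mul_submxrow -submxcol_mul.
rewrite mxcolK; apply/eqP; rewrite -sub_kermx; apply: submx_trans (ad_rad ad (Xs r) ra) _.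
apply: bspan_sub => y /(tnthP (in_tuple s)) [r' ->] ltr; rewrite sub_kermx.
by apply/eqP/brV; apply: contraTneq ltr => ->; rewrite -leqNgt.
Qed.

(** Blocks are sorted by level, so raising the level strictly implies being strictly upper
    triangular. *)
Let lev_homo (r t : 'I_(size s)) : (r <= t)%N -> (lev r <= lev t)%N.
Proof.
pose x0 := X r; move=> lert; rewrite /lev /X !(tnth_nth x0) /=.
have := sorted_leq_nth leq_trans leqnn 0%N (ad_sorted ad).
move=> /(_ r t); rewrite !inE size_map !(nth_map x0) //; exact.
Qed.

Let theta u := projT1 (cid (ring_rep_representation (th_rep u) (sq_lin sq u))).
Let thetaE u a : theta u a = th u a :=
  projT2 (cid (ring_rep_representation (th_rep u) (sq_lin sq u))) a.

(** The elements acting on every block exactly through its twist; this is the semisimple complement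
    of the radical. *)
Let S : {pred A} := [pred a | `[< forall r,
  br r *m rho a = twist (P ^ btw (X r)) (th (bcmp (X r)) a) *m br r >]].

Let SP a : reflect (forall r, br r *m rho a =
  twist (P ^ btw (X r)) (th (bcmp (X r)) a) *m br r) (a \in S).
Proof. exact: asboolP. Qed.

Let S_diag a : a \in S ->
  f a = \mxdiag_r twist (P ^ btw (X r)) (th (bcmp (X r)) a).
Proof. by move=> /SP aS; apply: f_diag. Qed.

Let S_lift (Z : forall u, 'M[K]_(d u)) : (forall u, Z u \is a mxOver (E u)) ->
  exists2 a, a \in S & forall u, th u a = Z u.
Proof.
move=> EZ; have [a aZ aS] := semisimple_lift rho_rep tu W EZ; exists a => //.
by apply/SP => r; rewrite aZ aS //; apply: (ad_good ad).
Qed.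

Let S_subalg : GRing.subalg_closed S.
Proof.
split.
- apply/SP => r; rewrite (ring_rep1 rho_rep) (ring_rep1 (th_rep _)) twist1 //.
  by rewrite mulmx1 mul1mx.
- move=> x a b /SP aS /SP bS; apply/SP => r.
  rewrite (ring_repD rho_rep) (ring_repD (th_rep _)) (twistD (ae r)) rhoZ (sq_lin sq).
  rewrite mulmxDr mulmxDl bS -scalemxAr aS -[iota x *: th _ _]mul_scalar_mx.
  rewrite (twistM (ae r)) (twist_scalar (ae r)) mul_scalar_mx -scalemxAl.
  by rewrite frobE -(frobE r) (good_block_frobenius rho_rep rho_inj rhoZ tu x
    (ad_good ad (Xs r)) (ad_nz ad (Xs r))).
- move=> a b /SP aS /SP bS; apply/SP => r.
  rewrite (ring_repM rho_rep) (ring_repM (th_rep _)) (twistM (ae r)).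
  by rewrite mulmxA aS -mulmxA bS mulmxA.
Qed.

Let S_split a : exists x y, [/\ x \in S, rad th y & a = x + y].
Proof.
have [x xS xa] := S_lift (fun u => sq_over sq u a).
by exists x, (a - x); split=> //; [apply: (rad_eq sq) | rewrite addrC subrK].
Qed.

Let S_rad a : a \in S -> rad th a -> a = 0.
Proof.
move=> /S_diag fa ra; apply: f_inj; rewrite (ring_rep0 f_rep) fa -(mxdiag0 (p_ := @bsize K D)).
by apply: eq_mxdiag => r; rewrite ra (twist0 (ae r)).
Qed.

Let jacE a : jacobson A a <-> rad th a := rad_jacobson rho_rep rho_inj sq a.

(** The unit of a component without block would lift to an element of [S] acting as zero, against
    faithfulness. *)
Let glue_onto u : exists r, bcmp (X r) = u.
Proof.
apply: contrapT => nr; pose Z v : 'M[K]_(d v) := (v == u)%:R%:M.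
have EZ v : Z v \is a mxOver (E v).
  apply/mxOverP => i j; rewrite mxE.
  case: (v == u); case: (i == j); rewrite ?mulr1n ?mulr0n;
    by first [apply: (sq_mem0 sq) | apply: (sq_mem1 sq)].
have [a aS aZ] := S_lift EZ; have a0 : a = 0.
  apply: f_inj; rewrite (ring_rep0 f_rep) (S_diag aS) -(mxdiag0 (p_ := @bsize K D)).
  apply: eq_mxdiag => r; rewrite aZ /Z; case: eqP => [e|_]; first by case: nr; exists r.
  by rewrite (raddf0 (@scalar_mx K _)) (twist0 (ae r)).
have := aZ u; rewrite a0 (ring_rep0 (th_rep u)) /Z eqxx.
move/matrixP => /(_ (ord_first sq u) (ord_first sq u)); rewrite !mxE eqxx.
by move/eqP; rewrite eq_sym oner_eq0.
Qed.

(** Besides the block form, this records what the quiver needs: levels below [m] strictly raised by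
    the radical, and off-diagonal blocks all coming from the radical. *)
Lemma block_form_exists : exists (D : block_data K)
    (f : representation iota A (bdim D)) (lev : 'I_(bell D) -> nat),
  [/\ faithful_closed f, wedderburn_block_form f, forall r, (lev r < m)%N,
      forall a, jacobson A a -> forall r t, (lev t <= lev r)%N ->
        submxblock (f a : 'M_(\sum_r bsize r)) r t = 0
    & forall a, exists2 b, jacobson A b & forall r t, r != t ->
        submxblock (f a : 'M_(\sum_r bsize r)) r t =
        submxblock (f b : 'M_(\sum_r bsize r)) r t].
Proof.
have [g gE] := ring_rep_representation f_rep fZ.
exists D, g, lev; split.
- split; first by move=> a b; rewrite !gE => /f_inj.
  have -> : range g = range f by apply: eq_imagel => a _; rewrite gE.
  exact: zariski_closed_conj.
- exists S, theta; split.
  + move=> u; split; [exact: (sq_deg sq) | exact: (sq_field sq) | exact: glue_onto].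
  + split.
    * by move=> a; rewrite jacE; split=> ra u; [rewrite thetaE ra | rewrite -thetaE ra].
    * by move=> a u; rewrite thetaE; apply: (sq_over sq).
    * move=> Z EZ; have [a aZ] := sq_surj sq EZ.
      by exists a => u; rewrite thetaE aZ.
  + split=> [|a|a aS /jacE]; first exact: S_subalg.
      have [x [y [xS ry axy]]] := S_split a.
      by exists x, y; split=> //; apply/jacE.
    exact: S_rad.
  + move=> u a [aS a0]; rewrite gE (S_diag aS); apply: eq_mxdiag => r.
    rewrite frobE -[bglue r]/(bcmp (X r)); case: ifPn => [_|/a0]; rewrite thetaE //.
    by move=> ->; rewrite -frobE (twist0 (ae r)).
  + by move=> a /jacE ra r t /lev_homo; rewrite gE; apply: f_rad.
- by move=> r; have /andP[] := ad_lev ad (Xs r).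
- by move=> a /jacE ra r t; rewrite gE; apply: f_rad.
- move=> a; have [x [y [xS ry ->]]] := S_split a.
  exists y; first exact/jacE.
  move=> r t nrt; rewrite !gE (ring_repD f_rep) submxblockD (S_diag xS).
  by rewrite submxblock_mxdiag // add0r.
Qed.

End BlockForm.

(** * Paths of the full quiver *)

Section QuiverPaths.
Variables (F : fieldType) (K : closedFieldType) (iota : {rmorphism F -> K}).
Variables (A : algType F) (D : block_data K) (f : representation iota A (bdim D)).
Variables (lev : 'I_(bell D) -> nat) (m : nat).
Let blk a : forall r s, 'M[K]_(bsize r, bsize s) :=
  submxblock (f a : 'M_(\sum_r bsize r, \sum_r bsize r)).
Hypotheses (f_inj : injective f) (lev_lt : forall r, (lev r < m)%N)
  (f_lev : forall a, jacobson A a -> forall r s, (lev s <= lev r)%N -> blk a r s = 0)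
  (f_tri : forall a, jacobson A a -> forall r s : 'I_(bell D), (s <= r)%N -> blk a r s = 0)
  (f_rad : forall a, exists2 b, jacobson A b
    & forall r s, r != s -> blk a r s = blk b r s)
  (m_idx : nilpotency_index (jacobson A) m).

Let arrow : rel 'I_(bell D) := @qv_arrow K (full_quiver f).

Let submxblock_unit (M : 'M[K]_(bdim D)) r s :
  (block_unit r *m M *m block_unit s == 0) =
  (submxblock (M : 'M_(\sum_r bsize r, \sum_r bsize r)) r s == 0).
Proof.
rewrite -{1}[M](submxblockK (p_ := @bsize K D) (q_ := @bsize K D)).
rewrite mul_mxdiag_mxblock mul_mxblock_mxdiag.
apply/eqP/eqP => [M0 | M0].
  have := congr1 (fun B : 'M_(\sum_r bsize r, \sum_r bsize r) => submxblock B r s) M0.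
  by rewrite mxblockK submxblock0 !eqxx mul1mx mulmx1.
rewrite -(mxblock0 (p_ := @bsize K D) (q_ := @bsize K D)).
apply: eq_mxblock => r' s'.
case: eqP => [->|_]; last by rewrite (raddf0 (@scalar_mx K _)) !mul0mx.
case: eqP => [->|_]; last by rewrite (raddf0 (@scalar_mx K _)) mulmx0.
by rewrite M0 mulmx0 mul0mx.
Qed.

Let arrowP (r s : 'I_(bell D)) : reflect ((r < s)%N /\ exists a, blk a r s != 0) (arrow r s).
Proof.
apply: (iffP andP) => [[lt_rs /asboolP [a na]] | [lt_rs [a na]]]; split=> //.
  by exists a; rewrite -submxblock_unit.
by apply/asboolP; exists a; rewrite submxblock_unit.
Qed.

Let arrow_lev r s : arrow r s -> (lev r < lev s)%N.
Proof.
case/arrowP=> lt_rs [a]; apply: contraR; rewrite -leqNgt => le_sr.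
have [b Jb ab] := f_rad a; rewrite ab; last by rewrite -val_eqE ltn_eqF.
by rewrite f_lev.
Qed.

Let path_lev x p : path arrow x p -> (lev x + size p <= lev (last x p))%N.
Proof.
elim: p x => [|y p IH] x /=; first by rewrite addn0.
case/andP=> /arrow_lev lt_xy /IH; apply: leq_trans.
by rewrite addnS -addSn leq_add2r.
Qed.

Let path_size x p : path arrow x p -> (size p < m)%N.
Proof.
by move/path_lev => le_p; apply: leq_ltn_trans (lev_lt (last x p)); lia.
Qed.

(** A nonzero block of a product involves nonzero blocks of both factors. The last factor lies in
    the radical, so its block is strictly upper triangular and gives the last arrow. *)
Let path_exists l a r s : ideal_pow (jacobson A) l a -> blk a r s != 0 ->
  exists x p, [/\ path arrow x p, size p = l & last x p = s].
Proof.
elim: l a r s => [|l IH] a r s /=; first by move=> _ _; exists s, [::].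
move=> [q qJ ->] nz.
have [z zq nzz] : exists2 z, z \in q & blk (z.1 * z.2) r s != 0.
  apply: contrapT => none; case/eqP: nz; rewrite /blk rmorph_sum /=.
  rewrite (big_morph (fun B : 'M_(\sum_r bsize r, \sum_r bsize r) => submxblock B r s)
    (fun B C => submxblockD B C r s) (submxblock0 r s)).
  rewrite big_seq big1 // => z zq; apply: contrapT => /eqP nzz.
  by apply: none; exists z.
have [/IH{}IH Jz2] := qJ z zq.
have [t nz1 nz2] : exists2 t, blk z.1 r t != 0 & blk z.2 t s != 0.
  apply: contrapT => none; case/eqP: nzz; rewrite /blk rmorphM /=.
  rewrite -[f z.1](submxblockK (p_ := @bsize K D) (q_ := @bsize K D)).
  rewrite -[f z.2](submxblockK (p_ := @bsize K D) (q_ := @bsize K D)).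
  rewrite -[_ * _]/(_ *m _) mul_mxblock mxblockK big1 // => t _.
  apply: contrapT => /eqP nzt; apply: none; exists t.
    by apply: contraNneq nzt; rewrite /blk => ->; rewrite mul0mx.
  by apply: contraNneq nzt; rewrite /blk => ->; rewrite mulmx0.
have [x [p [xp szp lastp]]] := IH _ _ nz1.
exists x, (rcons p s); rewrite rcons_path size_rcons szp last_rcons lastp xp.
split=> //=; apply/arrowP; split; last by exists z.2.
by apply: contraR nz2; rewrite -leqNgt => /(f_tri Jz2) ->.
Qed.

(** Levels increase along a path and stay below [m], which bounds its length. A nonzero element of
    the power [m.-1] of the radical gives a path with [m.-1] arrows, and any extension of it would
    exceed the bound. *)
Lemma max_branch_length_full_quiver : max_branch_length (full_quiver f) (m - 1).
Proof.
have [m_gt0 _ Jm1] := m_idx; split; last first.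
  by move=> x p [xp _ _]; rewrite -ltnS subn1 prednK //; exact: path_size xp.
have [a Ja nza] : exists2 a, ideal_pow (jacobson A) m.-1 a & a != 0.
  apply: contrapT => none; apply: Jm1; apply/seteqP; split=> a /=.
    by move=> Ja; apply: contrapT => /eqP nza; apply: none; exists a.
  by move=> ->; case: (m.-1) => // l; exists [::] => //; rewrite big_nil.
have [r [s nzrs]] : exists r s, blk a r s != 0.
  apply: contrapT => none; case/eqP: nza; apply: f_inj; rewrite raddf0.
  apply/(mxblockP (p_ := @bsize K D) (q_ := @bsize K D)) => r s.
  rewrite submxblock0; apply: contrapT => /eqP nz; apply: none; exists r, s.
  exact: nz.
have [x [p [xp szp _]]] := path_exists Ja nzrs.
exists x, p; split; last by rewrite szp subn1.
split=> // y; apply/negP => yx.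
  have : path arrow y (x :: p) by rewrite /= xp andbT; exact: yx.
  by move/path_size => /=; rewrite szp prednK // ltnn.
have : path arrow x (rcons p y) by rewrite rcons_path xp; exact: yx.
by move/path_size; rewrite size_rcons szp prednK // ltnn.
Qed.

End QuiverPaths.

Theorem theorem1p4 (F : fieldType) (K : closedFieldType)
    (iota : {rmorphism F -> K}) (A : algType F)
    (hA : exists (n : nat) (rho0 : representation iota A n),
            faithful_closed rho0) :
  exists (D : block_data K) (rho : representation iota A (bdim D)),
    [/\ faithful_closed rho,
        wedderburn_block_form rho
      & exists m : nat, nilpotency_index (jacobson A) m /\
          max_branch_length (full_quiver rho) (m - 1)%N].
Proof.
have [n [rho0 [inj0 closed0]]] := hA.
have [rep0 Z0] := representation_ring_rep rho0.
case: n rho0 inj0 closed0 rep0 Z0 => [|n] rho0 inj0 closed0 rep0 Z0.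
  (* Degree zero is impossible: the representation is faithful and [1 != 0] in [A]. *)
  by have /eqP := inj0 1 0 (etrans (thinmx0 _) (esym (thinmx0 _))); rewrite oner_eq0.
have [P [c [d [E [k [th sq]]]]]] :
    exists P c d E k th, @semisimple_quotient F K iota A n.+1 rho0 P c d E k th.
  have [finF|infF] := pselect (finite_set [set: F]%classic).
    exact: semisimple_quotient_finite.
  exact: semisimple_quotient_infinite.
have [m m_idx] := rad_nilpotency_index rep0 inj0 sq.
have [m_gt0 Jm _] := m_idx.
have [W [W_pow W_span W_rad W0]] := radical_filtration rep0 sq.
have [eps [al [be [Pi [tau tu]]]]] := torus_units_exist rep0 inj0 sq.
have Wm : W m = 0 by apply: W0; rewrite -(jacobson_rad rep0 inj0 sq).
have fullW : row_full (W 0%N).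
  by rewrite -sub1mx -(ring_rep1 rep0); apply: W_pow.
have [s ad full_s] := adapted_basis rep0 tu W_span W_rad m_gt0 Wm fullW.
have [D [f [lev [fc wbf lev_lt f_lev f_rad]]]] :=
  block_form_exists rep0 inj0 Z0 closed0 tu ad full_s.
exists D, f; split=> //; exists m; split=> //.
apply: (max_branch_length_full_quiver (lev := lev)) => //; first by case: fc.
by case: wbf => S [th' [_ _ _ _]].
Qed.
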